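(* Let $R$ be a commutative regular ring that is an integral domain and let $f\in R$ be a nonzero element (hence a non-zero divisor). Let $B$ be the $R$-algebra generated by $e_+,e_-,u,v$ with relations $$e_\pm^2=e_\pm,\quad e_++e_-=1,\quad u=e_+ue_-,\quad v=e_-ve_+,\quad uv=fe_+,\quad vu=fe_- .$$ Let $i^*:\mathrm{Mod}(B)\to \mathrm{Mod}(B/Be_-B)$ be the functor $i^*=-\otimes_B B/Be_-B$, where $B/Be_-B\cong R/(f)$. Then $i^*$ induces an equivalence of categories $$\mathrm{CM}(B)/\langle e_-B\rangle\;\simeq\;\mathrm{CM}(R/(f)).$$
   Context: $\mathrm{Mod}(B)$ is the category of right $B$-modules. $B$ is a free $R$-module with basis $e_+,e_-,u,v$ (it is the path algebra over $R$ of the quiver with two vertices $+,-$ and one arrow in each direction, with the relations that both length-two cycles equal $f$). $\mathrm{CM}(B)$ is the full subcategory of right $B$-modules that are finitely generated and projective as $R$-modules. $\mathrm{CM}(R/(f))$ is the category of (finitely generated) maximal Cohen--Macaulay $R/(f)$-modules. $\langle e_-B\rangle$ is the ideal of the category $\mathrm{CM}(B)$ generated by the object $e_-B$, i.e. consisting of the morphisms that factor through direct summands of finite direct sums of copies of $e_-B$; the quotient category has the same objects and Hom-groups modulo this ideal. *)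

(* Defs.v *)
From HB Require Import structures.
From mathcomp Require Import all_boot all_algebra.
From mathcomp Require Import ring_quotient ring.
From mathcomp Require Import boolp classical_sets.
From mathcomp.multinomials Require Import freeg.

Set Implicit Arguments.
Unset Strict Implicit.
Unset Printing Implicit Defensive.

Import GRing.Theory.
Local Open Scope ring_scope.
Local Open Scope quotient_scope.

Inductive zspan (V : zmodType) (T : V -> Prop) : V -> Prop :=
| zspan0 : zspan T 0
| zspan_gen x : T x -> zspan T x
| zspanB x y : zspan T x -> zspan T y -> zspan T (x - y).

Definition zspanp (V : zmodType) (T : V -> Prop) : {pred V} :=
  fun x => `[< zspan T x >].

Lemma zspanpP (V : zmodType) (T : V -> Prop) x :
  reflect (zspan T x) (x \in zspanp T).
Proof. exact: asboolP. Qed.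

Lemma zspanp_closed (V : zmodType) (T : V -> Prop) : zmod_closed (zspanp T).
Proof.
split; first exact/zspanpP/zspan0.
by move=> x y /zspanpP xT /zspanpP yT; apply/zspanpP/zspanB.
Qed.

HB.instance Definition _ (V : zmodType) (T : V -> Prop) :=
  GRing.isZmodClosed.Build V (zspanp T) (zspanp_closed T).

Lemma zspan_morph (V W : zmodType) (T : V -> Prop) (T' : W -> Prop)
    (h : {additive V -> W}) :
  (forall x, T x -> zspan T' (h x)) -> forall x, zspan T x -> zspan T' (h x).
Proof.
move=> hT x; elim=> {x} [|x /hT //|x y _ IHx _ IHy].
  by rewrite raddf0; apply: zspan0.
by rewrite raddfB; apply: zspanB.
Qed.

Notation zquot T := (Quotient.quot (zspanp T)).

Section ZQuot.
Variables (V : zmodType) (T : V -> Prop).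

Definition zproj (x : V) : zquot T := \pi x.

Lemma zproj_is_zmod_morphism : zmod_morphism zproj.
Proof. by move=> x y; rewrite /zproj !piE. Qed.
HB.instance Definition _ :=
  GRing.isZmodMorphism.Build V (zquot T) zproj zproj_is_zmod_morphism.

Lemma zprojP x y : zproj x = zproj y <-> zspan T (x - y).
Proof.
rewrite /zproj; split => [/eqP|h].
  by rewrite -Quotient.idealrBE => /zspanpP.
by apply/eqP; rewrite -Quotient.idealrBE; apply/zspanpP.
Qed.

Lemma zprojK (x : zquot T) : zproj (repr x) = x.
Proof. exact: reprK. Qed.

Lemma zproj_repr (x : V) : zspan T (repr (zproj x) - x).
Proof. by apply/zprojP; rewrite zprojK. Qed.

Lemma zproj_ind (P : zquot T -> Prop) : (forall x, P (zproj x)) -> forall q, P q.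
Proof. by move=> h q; rewrite -[q]zprojK. Qed.

End ZQuot.

Section IdealQuotient.
Variables (A : pzRingType) (e : A).

Definition sandwich (x : A) : Prop := exists b c : A, x = b * e * c.

(* The quotient by the two-sided ideal AeA, which is the subgroup spanned by the
   products b e c. The quotient may be the zero ring. *)
Definition quot_ring : Type := zquot sandwich.
HB.instance Definition _ := GRing.Zmodule.on quot_ring.

Definition qproj (x : A) : quot_ring := zproj sandwich x.
Lemma qproj_is_zmod_morphism : zmod_morphism qproj.
Proof. exact: zproj_is_zmod_morphism. Qed.
HB.instance Definition _ :=
  GRing.isZmodMorphism.Build A quot_ring qproj qproj_is_zmod_morphism.

Lemma qproj_ind (P : quot_ring -> Prop) : (forall x, P (qproj x)) -> forall q, P q.
Proof. exact: zproj_ind. Qed.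

Lemma sandwichM a b x : zspan sandwich x -> zspan sandwich (a * x * b).
Proof.
elim=> {x} [|x [c [d ->]]|x y _ IHx _ IHy].
- by rewrite mulr0 mul0r; apply: zspan0.
- by apply: zspan_gen; exists (a * c), (d * b); rewrite !mulrA.
- by rewrite mulrBr mulrBl; apply: zspanB.
Qed.

Definition qmul (x y : quot_ring) : quot_ring := qproj (repr x * repr y).

Lemma qprojM x y : qproj (x * y) = qmul (qproj x) (qproj y).
Proof.
apply/esym/zprojP.
have -> : repr (qproj x) * repr (qproj y) - x * y =
          1 * (repr (qproj x) - x) * repr (qproj y)
          - - (x * (repr (qproj y) - y) * 1).
  by rewrite opprK mul1r mulr1 mulrBl mulrBr addrA subrK.
apply: zspanB; first exact/sandwichM/zproj_repr.
rewrite -sub0r; apply: zspanB; first exact: zspan0.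
exact/sandwichM/zproj_repr.
Qed.

Lemma qmulA : associative qmul.
Proof.
by do 3![elim/qproj_ind=> ?]; rewrite -!qprojM mulrA.
Qed.
Lemma qmul1 : left_id (qproj 1) qmul.
Proof. by elim/qproj_ind=> x; rewrite -qprojM mul1r. Qed.
Lemma q1mul : right_id (qproj 1) qmul.
Proof. by elim/qproj_ind=> x; rewrite -qprojM mulr1. Qed.
Lemma qmulDl : left_distributive qmul +%R.
Proof.
by do 3![elim/qproj_ind=> ?]; rewrite -raddfD -!qprojM mulrDl raddfD.
Qed.
Lemma qmulDr : right_distributive qmul +%R.
Proof.
by do 3![elim/qproj_ind=> ?]; rewrite -raddfD -!qprojM mulrDr raddfD.
Qed.
HB.instance Definition _ :=
  GRing.Zmodule_isPzRing.Build quot_ring qmulA qmul1 q1mul qmulDl qmulDr.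

Lemma qproj_is_monoid_morphism : monoid_morphism qproj.
Proof. by split=> // x y; rewrite qprojM. Qed.
HB.instance Definition _ :=
  GRing.isMonoidMorphism.Build A quot_ring qproj qproj_is_monoid_morphism.

End IdealQuotient.

Lemma qmulC (A : comPzRingType) (e : A) : commutative (@qmul A e).
Proof. by do 2![elim/qproj_ind=> ?]; rewrite -!qprojM mulrC. Qed.
HB.instance Definition _ (A : comPzRingType) (e : A) :=
  GRing.PzRing_hasCommutativeMul.Build (quot_ring e) (@qmulC A e).

(* A right A-module is an [lmodType A^c], with m.b written [(b : A^c) *: m]. *)

Definition restr (A B : pzRingType) (phi : {rmorphism A -> B}) (M : lmodType B)
  : Type := M.

Section Restriction.
Variables (A B : pzRingType) (phi : {rmorphism A -> B}).

Section RestrMod.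
Variable M : lmodType B.
HB.instance Definition _ := GRing.Zmodule.on (restr phi M).

Definition restr_scale (a : A) (x : restr phi M) : restr phi M := phi a *: (x : M).
Lemma restr_scaleA a b x :
  restr_scale a (restr_scale b x) = restr_scale (a * b) x.
Proof. by rewrite /restr_scale rmorphM scalerA. Qed.
Lemma restr_scale1 : left_id 1 restr_scale.
Proof. by move=> x; rewrite /restr_scale rmorph1 scale1r. Qed.
Lemma restr_scaleDr : right_distributive restr_scale +%R.
Proof. by move=> a x y; rewrite /restr_scale scalerDr. Qed.
Lemma restr_scaleDl x : {morph restr_scale^~ x : a b / a + b}.
Proof. by move=> a b; rewrite /restr_scale rmorphD scalerDl. Qed.
HB.instance Definition _ := GRing.Zmodule_isLmodule.Build A (restr phi M)
  restr_scaleA restr_scale1 restr_scaleDr restr_scaleDl.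
End RestrMod.

Section RestrMap.
Variables (M N : lmodType B) (g : {linear M -> N}).
Definition restr_map (x : restr phi M) : restr phi N := g x.
Lemma restr_map_is_linear : linear restr_map.
Proof. by move=> a x y; rewrite /restr_map; apply: (linearP g). Qed.
HB.instance Definition _ :=
  GRing.isLinear.Build A (restr phi M) (restr phi N) _ restr_map restr_map_is_linear.
End RestrMap.

End Restriction.
Arguments restr_map {A B} phi {M N} g x.

Definition fin_gen (S : pzRingType) (M : lmodType S) : Prop :=
  exists (n : nat) (g : 'I_n -> M),
    forall x, exists c : 'I_n -> S, x = \sum_(i < n) c i *: g i.

Definition projective (S : pzRingType) (P : lmodType S) : Prop :=
  forall (M N : lmodType S) (p : {linear M -> N}) (h : {linear P -> N}),
    (forall y, exists x, p x = y) ->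
    exists l : {linear P -> M}, forall x, p (l x) = h x.

Section Ideals.
Variable S : comPzRingType.

Definition is_ideal (I : set S) : Prop :=
  [/\ I 0, forall x y, I x -> I y -> I (x + y) & forall a x, I x -> I (a * x)].

Definition is_prime (P : set S) : Prop :=
  [/\ is_ideal P, ~ P 1 & forall x y, P (x * y) -> P x \/ P y].

Definition is_maximal (I : set S) : Prop :=
  [/\ is_ideal I, ~ I 1 &
      forall J, is_ideal J -> ~ J 1 -> (I `<=` J)%classic -> J = I].

Definition generated_by (I : set S) n (g : 'I_n -> S) : Prop :=
  forall x, I x <-> exists c : 'I_n -> S, x = \sum_(i < n) c i * g i.

Definition noetherian : Prop :=
  forall I, is_ideal I -> exists n (g : 'I_n -> S), generated_by I g.

Definition local_ring (m : set S) : Prop :=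
  is_maximal m /\ forall m', is_maximal m' -> m' = m.

Definition prime_chain (n : nat) (P : nat -> set S) : Prop :=
  (forall i, (i <= n)%N -> is_prime (P i)) /\
  (forall i, (i < n)%N -> (P i `<` P i.+1)%classic).

Definition krull_dim (d : nat) : Prop :=
  (exists P, prime_chain d P) /\ (forall n P, prime_chain n P -> (n <= d)%N).

Definition regular_local : Prop :=
  noetherian /\ exists m, local_ring m /\
  exists d, krull_dim d /\ exists g : 'I_d -> S, generated_by m g.

Section Depth.
Variable M : lmodType S.

Definition seq_submod (s : seq S) (x : M) : Prop :=
  exists y : 'I_(size s) -> M, x = \sum_(i < size s) s`_i *: y i.

(* M <> sM is part of the definition, so the zero module has no regular
   sequence, not even the empty one. *)
Definition regular_seq (s : seq S) : Prop :=
  (forall i, (i < size s)%N -> forall x,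
     seq_submod (take i s) (s`_i *: x) -> seq_submod (take i s) x) /\
  (exists x, ~ seq_submod s x).

(* The depth of M with respect to I: the maximal length of an M-regular sequence
   in I. *)
Definition depth (I : set S) (d : nat) : Prop :=
  let regular_in n :=
    exists s, [/\ size s = n, forall i, (i < n)%N -> I s`_i & regular_seq s] in
  regular_in d /\ forall n, regular_in n -> (n <= d)%N.

(* depth M = dim S over a local ring S; the zero module, whose depth is infinite,
   counts as maximal Cohen-Macaulay. *)
Definition local_mcm : Prop :=
  exists m, local_ring m /\
    ((forall x : M, x = 0) \/ exists d, krull_dim d /\ depth m d).

End Depth.
End Ideals.

Record primeIdeal (S : comPzRingType) :=
  PrimeIdeal { prime_set : set S; prime_setP : is_prime prime_set }.

Section Localization.
Variables (S : comPzRingType) (p : primeIdeal S).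

(* The denominators: the elements of S outside p. *)
Definition denom : Type := {s : S | `[< ~ prime_set p s >]}.
HB.instance Definition _ := Choice.on denom.

Lemma denomP (s : denom) : ~ prime_set p (val s).
Proof. exact: asboolW (valP s). Qed.
Definition mkdenom (s : S) (h : ~ prime_set p s) : denom := Sub s (asboolT h).

Lemma denom1_subproof : ~ prime_set p 1. Proof. by case: (prime_setP p). Qed.
Definition denom1 := mkdenom denom1_subproof.
Lemma denomM_subproof (s t : denom) : ~ prime_set p (val s * val t).
Proof.
by case: (prime_setP p) => _ _ h /h [] ; apply: denomP.
Qed.
Definition denomM s t := mkdenom (@denomM_subproof s t).

Section LocMod.
Variable M : lmodType S.

Definition frac_eq (x y : M * denom) : Prop :=
  exists u : denom, val u *: (val y.2 *: x.1 - val x.2 *: y.1) = 0.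
Definition frac_eqb (x y : M * denom) : bool := `[< frac_eq x y >].

Lemma frac_eqb_refl : reflexive frac_eqb.
Proof. by move=> x; apply/asboolP; exists denom1; rewrite subrr scaler0. Qed.
Lemma frac_eqb_sym : symmetric frac_eqb.
Proof.
have h x y : frac_eqb x y -> frac_eqb y x.
  move=> /asboolP [u hu]; apply/asboolP; exists u.
  by rewrite -opprB scalerN hu oppr0.
by move=> x y; apply/idP/idP; apply: h.
Qed.
Lemma frac_eqb_trans : transitive frac_eqb.
Proof.
move=> [y t] [x s] [z r] /asboolP [u /= hu] /asboolP [v /= hv].
apply/asboolP; exists (denomM (denomM u v) t) => /=.
pose w := val u * val v * val t.
have -> : w *: (val r *: x - val s *: z) =
  (val v * val r) *: (val u *: (val t *: x - val s *: y)) +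
  (val u * val s) *: (val v *: (val r *: y - val t *: z)).
  rewrite /w !(scalerBr, scalerA) addrA.
  have -> : val v * val r * val u * val t = val u * val v * val t * val r by ring.
  have -> : val u * val s * val v * val r = val v * val r * val u * val s by ring.
  have -> : val u * val s * val v * val t = val u * val v * val t * val s by ring.
  by rewrite subrK.
by rewrite hu hv !scaler0 addr0.
Qed.

Canonical frac_equiv :=
  EquivRel frac_eqb frac_eqb_refl frac_eqb_sym frac_eqb_trans.
Canonical frac_encModRel := defaultEncModRel frac_eqb.

Definition loc_mod : Type := {eq_quot frac_eqb}.
HB.instance Definition _ := Choice.on loc_mod.

Definition frac (x : M) (s : denom) : loc_mod := \pi_({eq_quot frac_eqb}) (x, s).

Lemma fracP x s y t :
  frac x s = frac y t <-> exists u : denom, val u *: (val t *: x - val s *: y) = 0.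
Proof.
have e : (x, s) = (y, t) %[mod {eq_quot frac_eqb}] <-> frac_eqb (x, s) (y, t).
  by split=> h; apply/(eqmodP frac_equiv).
by split=> [/e/asboolW //|h]; apply/e/asboolP.
Qed.

Lemma frac_ind (P : loc_mod -> Prop) :
  (forall x s, P (frac x s)) -> forall q, P q.
Proof.
move=> h q; rewrite -[q](@reprK _ {eq_quot frac_eqb}).
by case: (repr _) => x s; apply: h.
Qed.

Definition loc_num (q : loc_mod) : M := (repr (q : {eq_quot frac_eqb})).1.
Definition loc_den (q : loc_mod) : denom := (repr (q : {eq_quot frac_eqb})).2.
Lemma loc_numden q : frac (loc_num q) (loc_den q) = q.
Proof. by rewrite /frac /loc_num /loc_den -surjective_pairing reprK. Qed.

Lemma loc_numdenP x s : exists u : denom,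
  val u *: (val s *: loc_num (frac x s) - val (loc_den (frac x s)) *: x) = 0.
Proof. by apply/fracP; rewrite loc_numden. Qed.

Lemma frac_expand x s t : frac (val t *: x) (denomM t s) = frac x s.
Proof.
apply/fracP; exists denom1 => /=; rewrite scalerA [val s * _]mulrC subrr.
exact: scaler0.
Qed.

Lemma frac_common (q1 q2 : loc_mod) :
  exists x y s, q1 = frac x s /\ q2 = frac y s.
Proof.
elim/frac_ind: q1 => x s; elim/frac_ind: q2 => y t.
exists (val t *: x), (val s *: y), (denomM t s); split.
  by rewrite frac_expand.
rewrite -(frac_expand y t s); apply/fracP; exists denom1 => /=.
by rewrite [val t * _]mulrC subrr scaler0.
Qed.

Definition loc_zero : loc_mod := frac 0 denom1.
Definition loc_opp (q : loc_mod) : loc_mod := frac (- loc_num q) (loc_den q).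
Definition loc_add (q r : loc_mod) : loc_mod :=
  frac (val (loc_den r) *: loc_num q + val (loc_den q) *: loc_num r) (denomM (loc_den q) (loc_den r)).

Lemma loc_oppE x s : loc_opp (frac x s) = frac (- x) s.
Proof.
have [u hu] := loc_numdenP x s; apply/fracP; exists u.
by rewrite !scalerN -opprD scalerN hu oppr0.
Qed.

Lemma loc_addE x s y t :
  loc_add (frac x s) (frac y t) =
  frac (val t *: x + val s *: y) (denomM s t).
Proof.
have [u hu] := loc_numdenP x s; have [v hv] := loc_numdenP y t.
rewrite /loc_add.
move: (loc_num (frac x s)) (loc_den (frac x s)) hu => x' s' hu.
move: (loc_num (frac y t)) (loc_den (frac y t)) hv => y' t' hv.
apply/fracP; exists (denomM u v) => /=.
have -> : (val u * val v) *: ((val s * val t) *: (val t' *: x' + val s' *: y')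
   - (val s' * val t') *: (val t *: x + val s *: y)) =
  (val v * val t * val t') *: (val u *: (val s *: x' - val s' *: x)) +
  (val u * val s * val s') *: (val v *: (val t *: y' - val t' *: y)).
  rewrite !(scalerBr, scalerDr, scalerA) opprD addrACA.
  by congr (_ - _ + (_ - _)); congr (_ *: _); ring.
by rewrite hu hv !scaler0 addr0.
Qed.

Lemma loc_addDE x y s : loc_add (frac x s) (frac y s) = frac (x + y) s.
Proof. by rewrite loc_addE -scalerDr frac_expand. Qed.

Lemma loc_addA : associative loc_add.
Proof.
elim/frac_ind=> x s; elim/frac_ind=> y t; elim/frac_ind=> z r.
rewrite !loc_addE; apply/fracP; exists denom1.
apply: (etrans _ (scaler0 _ _)); congr (_ *: _) => /=.
apply/eqP; rewrite subr_eq0; apply/eqP; rewrite !(scalerDr, scalerA) !addrA.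
by congr (_ + _ + _); congr (_ *: _); ring.
Qed.
Lemma loc_addC : commutative loc_add.
Proof.
move=> q r; have [x [y [s [-> ->]]]] := frac_common q r.
by rewrite !loc_addDE addrC.
Qed.
Lemma loc_add0 : left_id loc_zero loc_add.
Proof.
elim/frac_ind=> x s; rewrite /loc_zero loc_addE scaler0 add0r.
exact: frac_expand.
Qed.
Lemma loc_addN : left_inverse loc_zero loc_opp loc_add.
Proof.
elim/frac_ind=> x s; rewrite loc_oppE loc_addDE addNr.
by apply/fracP; exists denom1; rewrite !scaler0 subrr scaler0.
Qed.
HB.instance Definition _ :=
  GRing.isZmodule.Build loc_mod loc_addA loc_addC loc_add0 loc_addN.

Lemma fracD x y s : frac x s + frac y s = frac (x + y) s.
Proof. exact: loc_addDE. Qed.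

End LocMod.

Definition loc_ring : Type := loc_mod S^o.
HB.instance Definition _ := GRing.Zmodule.on loc_ring.

Section LocAct.
Variable M : lmodType S.

Definition loc_act (a : loc_ring) (q : loc_mod M) : loc_mod M :=
  frac ((loc_num a : S) *: loc_num q) (denomM (loc_den a) (loc_den q)).

Lemma loc_actE (a : S) s (x : M) t :
  loc_act (frac (a : S^o) s) (frac x t) = frac (a *: x) (denomM s t).
Proof.
have [u hu] := loc_numdenP (a : S^o) s; have [v hv] := loc_numdenP x t.
rewrite /loc_act.
move: (loc_num (frac (a : S^o) s)) (loc_den (frac (a : S^o) s)) hu => a' s' hu.
move: (loc_num (frac x t)) (loc_den (frac x t)) hv => x' t' hv.
have {}hu : val u * (val s * (a' : S) - val s' * a) = 0 by exact: hu.
apply/fracP; exists (denomM u v) => /=.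
have -> : (val u * val v) *: ((val s * val t) *: ((a' : S) *: x')
   - (val s' * val t') *: (a *: x)) =
  (val u * (val s * (a' : S) - val s' * a)) *: ((val v * val t) *: x') +
  (val u * val s' * a) *: (val v *: (val t *: x' - val t' *: x)).
  rewrite mulrBr scalerBl !(scalerBr, scalerA) addrA.
  have -> : val u * (val s * (a' : S)) * (val v * val t) =
            val u * val v * (val s * val t) * (a' : S) by ring.
  have -> : val u * (val s' * a) * (val v * val t) =
            val u * val s' * a * val v * val t by ring.
  have -> : val u * val s' * a * val v * val t' =
            val u * val v * (val s' * val t') * a by ring.
  by rewrite subrK !mulrA.
by rewrite hu hv scale0r scaler0 addr0.
Qed.

Lemma loc_act1 : left_id (frac (1 : S^o) denom1) loc_act.
Proof. by elim/frac_ind=> x s; rewrite loc_actE; apply: (frac_expand x s denom1). Qed.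

Lemma loc_actDr : right_distributive loc_act +%R.
Proof.
elim/frac_ind=> a s q r; have [x [y [t [-> ->]]]] := frac_common q r.
by rewrite fracD !loc_actE fracD scalerDr.
Qed.
Lemma loc_actDl q : {morph loc_act^~ q : a b / a + b}.
Proof.
move=> a b; have [x [y [t [-> ->]]]] := frac_common a b.
by elim/frac_ind: q => z r; rewrite fracD !loc_actE fracD scalerDl.
Qed.
End LocAct.

Definition loc_mul (a b : loc_ring) : loc_ring := loc_act a b.

Lemma loc_actA (M : lmodType S) (a b : loc_ring) (q : loc_mod M) :
  loc_act a (loc_act b q) = loc_act (loc_mul a b) q.
Proof.
elim/frac_ind: a => a s; elim/frac_ind: b => b t; elim/frac_ind: q => x r.
rewrite /loc_mul (loc_actE b t x r) (loc_actE a s (b *: x)).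
rewrite (loc_actE a s (b : S^o) t) loc_actE; congr (frac _ _).
  exact: scalerA.
by apply: val_inj; rewrite /= mulrA.
Qed.

Lemma loc_mulA : associative loc_mul. Proof. exact: loc_actA. Qed.
Lemma loc_mulC : commutative loc_mul.
Proof.
elim/frac_ind=> a s; elim/frac_ind=> b t; rewrite /loc_mul.
rewrite (loc_actE a s (b : S^o) t) (loc_actE b t (a : S^o) s).
congr (frac _ _); first exact: mulrC.
by apply: val_inj; rewrite /= mulrC.
Qed.
HB.instance Definition _ := GRing.Zmodule_isComPzRing.Build loc_ring
  loc_mulA loc_mulC (@loc_act1 S^o) (fun a b c => loc_actDl c a b).

HB.instance Definition _ (M : lmodType S) :=
  GRing.Zmodule_isLmodule.Build loc_ring (loc_mod M)
    (@loc_actA M) (@loc_act1 M) (@loc_actDr M) (@loc_actDl M).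

End Localization.

Definition regular_ring (S : comPzRingType) : Prop :=
  noetherian S /\ forall p : primeIdeal S, regular_local (loc_ring p).

Definition max_cohen_macaulay (S : comPzRingType) (M : lmodType S) : Prop :=
  fin_gen M /\ forall p : primeIdeal S, local_mcm (loc_mod p M).

Section Tensor.
Variables (B : pzRingType) (M : lmodType B^c) (N : lmodType B).

Local Notation free := {freeg (M * N)%type / int}.

Inductive tensor_rel : free -> Prop :=
| tensor_relDl x x' y :
    tensor_rel (<<(x + x', y)>> - <<(x, y)>> - <<(x', y)>>)
| tensor_relDr x y y' :
    tensor_rel (<<(x, y + y')>> - <<(x, y)>> - <<(x, y')>>)
| tensor_relM (b : B) x y :
    tensor_rel (<<((b : B^c) *: x, y)>> - <<(x, b *: y)>>).

Definition tensor : Type := zquot tensor_rel.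
HB.instance Definition _ := GRing.Zmodule.on tensor.

Definition tens (x : M) (y : N) : tensor := zproj tensor_rel <<(x, y)>>.

Lemma tensDl x x' y : tens (x + x') y = tens x y + tens x' y.
Proof.
rewrite /tens -raddfD; apply/zprojP; rewrite opprD addrA.
exact/zspan_gen/tensor_relDl.
Qed.
Lemma tensDr x y y' : tens x (y + y') = tens x y + tens x y'.
Proof.
rewrite /tens -raddfD; apply/zprojP; rewrite opprD addrA.
exact/zspan_gen/tensor_relDr.
Qed.
Lemma tensM (b : B) x y : tens ((b : B^c) *: x) y = tens x (b *: y).
Proof. exact/zprojP/zspan_gen/tensor_relM. Qed.

Lemma tensor_ind (P : tensor -> Prop) :
  P 0 -> (forall x y, P x -> P y -> P (x - y)) -> (forall x y, P (tens x y)) ->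
  forall q, P q.
Proof.
move=> P0 PB Pt; have PN x : P x -> P (- x) by rewrite -[- x]sub0r => Px; apply: PB.
have PD x y : P x -> P y -> P (x + y).
  by move=> Px /PN Py; rewrite -[y]opprK; apply: PB.
have PMn x n : P x -> P (x *+ n).
  by move=> Px; elim: n => [|n IH]; rewrite ?mulr0n // mulrS; apply: PD.
apply: zproj_ind => D; rewrite -(freeg_sumE D) raddf_sum.
apply: (big_ind P) => // -[x y] _; set c := coeff _ _.
have -> : << c *g (x, y) >> = << (x, y) >> *~ c :> free.
  by rewrite freegU_mulz intz.
rewrite raddfMz; case: c => n; first by rewrite -pmulrn; apply/PMn/Pt.
by rewrite NegzE mulrNz -pmulrn; apply/PN/PMn/Pt.
Qed.
End Tensor.

Section TensorMap.
Variables (B : pzRingType) (M M' : lmodType B^c) (N N' : lmodType B).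
Variables (f : {linear M -> M'}) (g : {linear N -> N'}).

Definition free_map : {freeg (M * N)%type / int} -> {freeg (M' * N')%type / int} :=
  fglift (fun z => <<(f z.1, g z.2)>>).
Lemma free_map_is_zmod_morphism : zmod_morphism free_map.
Proof. exact: lift_is_additive. Qed.
HB.instance Definition _ :=
  GRing.isZmodMorphism.Build _ _ free_map free_map_is_zmod_morphism.
Lemma free_mapU x y : free_map <<(x, y)>> = <<(f x, g y)>>.
Proof. by rewrite /free_map liftU scale1r. Qed.

Lemma free_map_rel D : tensor_rel D -> zspan (@tensor_rel _ M' N') (free_map D).
Proof.
have fB := free_map_is_zmod_morphism.
case=> [x x' y|x y y'|b x y]; apply: zspan_gen.
- by rewrite !fB !free_mapU raddfD; apply: tensor_relDl.
- by rewrite !fB !free_mapU raddfD; apply: tensor_relDr.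
- by rewrite !fB !free_mapU !linearZ_LR; apply: tensor_relM.
Qed.

Definition tensor_map (q : tensor M N) : tensor M' N' :=
  zproj _ (free_map (repr q)).

Lemma tensor_mapE D : tensor_map (zproj _ D) = zproj _ (free_map D).
Proof.
apply/zprojP; rewrite -raddfB; apply: zspan_morph (zproj_repr _ D).
exact: free_map_rel.
Qed.
Lemma tensor_map_is_zmod_morphism : zmod_morphism tensor_map.
Proof.
by do 2![elim/zproj_ind=> ?]; rewrite -raddfB !tensor_mapE !raddfB.
Qed.
HB.instance Definition _ :=
  GRing.isZmodMorphism.Build _ _ tensor_map tensor_map_is_zmod_morphism.
Lemma tensor_map_tens x y : tensor_map (tens x y) = tens (f x) (g y).
Proof. by rewrite [LHS]tensor_mapE free_mapU. Qed.
End TensorMap.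

(* [ext_mod pi M] is the right C-module [M (x)_B C], where C is a B-C-bimodule
   through [pi : B -> C]. *)
Section Extension.
Variables (B C : pzRingType) (pi : {rmorphism B -> C}).

Definition bimod : lmodType B := restr pi C^o.

Definition rmul (c : C) (x : bimod) : bimod := (x : C) * c.
Lemma rmul_is_linear c : linear (rmul c).
Proof.
move=> b x y; rewrite /rmul mulrDl; congr (_ + _).
exact: (esym (mulrA (pi b) x c)).
Qed.
HB.instance Definition _ c :=
  GRing.isLinear.Build B bimod bimod _ (rmul c) (rmul_is_linear c).

Section ExtMod.
Variable M : lmodType B^c.

Definition ext_mod : Type := tensor M bimod.
HB.instance Definition _ := GRing.Zmodule.on ext_mod.

Definition ext_scale (c : C^c) (q : ext_mod) : ext_mod :=
  tensor_map (idfun : {linear M -> M}) (rmul c : {linear bimod -> bimod}) q.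

Lemma ext_scaleE c (x : M) (y : bimod) :
  ext_scale c (tens x y : ext_mod) = tens x (rmul c y).
Proof. exact: tensor_map_tens. Qed.

Lemma ext_scaleDr : right_distributive ext_scale +%R.
Proof. by move=> c x y; apply: raddfD. Qed.
Lemma ext_scaleBr c x y : ext_scale c (x - y) = ext_scale c x - ext_scale c y.
Proof. exact: raddfB. Qed.
Lemma ext_scale0r c : ext_scale c 0 = 0.
Proof. exact: raddf0. Qed.
Lemma ext_scaleA (a b : C^c) q : ext_scale a (ext_scale b q) = ext_scale (a * b) q.
Proof.
elim/tensor_ind: q => [|x y hx hy|x y].
- by rewrite !ext_scale0r.
- by rewrite !ext_scaleBr hx hy.
- by rewrite !ext_scaleE; congr tens; apply: esym (mulrA (y : C) b a).
Qed.
Lemma ext_scale1 : left_id 1 ext_scale.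
Proof.
elim/tensor_ind=> [|x y hx hy|x y].
- by rewrite !ext_scale0r.
- by rewrite !ext_scaleBr hx hy.
- by rewrite !ext_scaleE; congr tens; apply: mulr1.
Qed.
Lemma ext_scaleDl q : {morph ext_scale^~ q : a b / a + b}.
Proof.
move=> a b; elim/tensor_ind: q => [|x y hx hy|x y].
- by rewrite !ext_scale0r addr0.
- by rewrite !ext_scaleBr hx hy opprD addrACA.
- by rewrite !ext_scaleE -tensDr; congr tens; apply: mulrDr.
Qed.
HB.instance Definition _ := GRing.Zmodule_isLmodule.Build C^c ext_mod
  ext_scaleA ext_scale1 ext_scaleDr ext_scaleDl.
End ExtMod.

Section ExtMap.
Variables (M N : lmodType B^c) (g : {linear M -> N}).

Definition ext_map (q : ext_mod M) : ext_mod N :=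
  tensor_map g (idfun : {linear bimod -> bimod}) q.

Lemma ext_mapE (x : M) (y : bimod) : ext_map (tens x y : ext_mod M) = tens (g x) y.
Proof. exact: tensor_map_tens. Qed.

Lemma ext_map_is_zmod_morphism : zmod_morphism ext_map.
Proof. exact: tensor_map_is_zmod_morphism. Qed.
Lemma ext_map_is_scalable : scalable ext_map.
Proof.
move=> c; elim/tensor_ind=> [|x y hx hy|x y].
- by rewrite scaler0 [ext_map 0]raddf0 scaler0.
- by rewrite scalerBr !ext_map_is_zmod_morphism scalerBr hx hy.
- by apply: (etrans (congr1 ext_map (ext_scaleE c x y)));
     rewrite !ext_mapE; apply/esym/ext_scaleE.
Qed.
HB.instance Definition _ :=
  GRing.isZmodMorphism.Build _ _ ext_map ext_map_is_zmod_morphism.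
HB.instance Definition _ :=
  GRing.isScalable.Build C^c (ext_mod M) (ext_mod N) _ ext_map ext_map_is_scalable.
End ExtMap.
End Extension.
Arguments ext_map {B C} pi {M N} g q.

Section ExtFunctoriality.
Variables (B C : pzRingType) (pi : {rmorphism B -> C}).

Lemma ext_map_eq (M N : lmodType B^c) (g h : {linear M -> N}) :
  g =1 h -> ext_map pi g =1 ext_map pi h.
Proof.
move=> gh; elim/tensor_ind=> [|x y hx hy|x y].
- by rewrite !raddf0.
- by rewrite !ext_map_is_zmod_morphism hx hy.
- by rewrite !ext_mapE gh.
Qed.
Lemma ext_map_id (M : lmodType B^c) :
  ext_map pi (idfun : {linear M -> M}) =1 idfun.
Proof.
elim/tensor_ind=> [|x y hx hy|x y].
- by rewrite raddf0.
- by rewrite ext_map_is_zmod_morphism hx hy.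
- by rewrite ext_mapE.
Qed.
Lemma ext_map_comp (M N K : lmodType B^c) (g : {linear N -> K}) (h : {linear M -> N}) :
  ext_map pi (g \o h) =1 ext_map pi g \o ext_map pi h.
Proof.
elim/tensor_ind=> [|x y hx hy|x y].
- by rewrite !raddf0.
- by rewrite ext_map_is_zmod_morphism hx hy /= -raddfB -ext_map_is_zmod_morphism.
- by rewrite /= !ext_mapE.
Qed.
End ExtFunctoriality.

(* Hom-types carry an equality relation [heq], so that a quotient category has
   the same Hom-types with a coarser [heq]. *)

Record category := Category {
  obj :> Type;
  mor : obj -> obj -> Type;
  heq : forall X Y, mor X Y -> mor X Y -> Prop;
  idm : forall X, mor X X;
  mcomp : forall X Y Z, mor Y Z -> mor X Y -> mor X Z;
  heq_refl : forall X Y (g : mor X Y), heq g g;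
  heq_sym : forall X Y (g h : mor X Y), heq g h -> heq h g;
  heq_trans : forall X Y (g h k : mor X Y), heq g h -> heq h k -> heq g k;
  comp_heq : forall X Y Z (g g' : mor Y Z) (h h' : mor X Y),
    heq g g' -> heq h h' -> heq (mcomp g h) (mcomp g' h');
  comp1m : forall X Y (g : mor X Y), heq (mcomp (idm Y) g) g;
  compm1 : forall X Y (g : mor X Y), heq (mcomp g (idm X)) g;
  compA : forall X Y Z W (g : mor Z W) (h : mor Y Z) (k : mor X Y),
    heq (mcomp g (mcomp h k)) (mcomp (mcomp g h) k)
}.
Arguments idm {c} X.
Arguments heq {c X Y}.
Arguments mcomp {c X Y Z}.

Record functor (C D : category) := Functor {
  fobj :> C -> D;
  fmap : forall X Y, mor X Y -> mor (fobj X) (fobj Y);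
  fmap_heq : forall X Y (g h : mor X Y), heq g h -> heq (fmap g) (fmap h);
  fmap_id : forall X, heq (fmap (idm X)) (idm (fobj X));
  fmap_comp : forall X Y Z (g : mor Y Z) (h : mor X Y),
    heq (fmap (mcomp g h)) (mcomp (fmap g) (fmap h))
}.
Arguments fmap {C D} f {X Y}.

Definition id_functor (C : category) : functor C C.
Proof.
by refine (@Functor C C id (fun _ _ g => g) _ _ _) => // *; apply: heq_refl.
Defined.

Definition comp_functor (C D E : category) (G : functor D E) (F : functor C D) :
  functor C E.
Proof.
refine (@Functor C E (fun X => G (F X)) (fun _ _ g => fmap G (fmap F g)) _ _ _).
- by move=> X Y g h gh; do 2!apply: fmap_heq.
- by move=> X; apply: heq_trans (fmap_heq G (fmap_id F X)) (fmap_id G (F X)).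
- move=> X Y Z g h.
  exact: heq_trans (fmap_heq G (fmap_comp F g h)) (fmap_comp G _ _).
Defined.

Definition naturally_isomorphic (C D : category) (F G : functor C D) : Prop :=
  exists (a : forall X, mor (F X) (G X)) (b : forall X, mor (G X) (F X)),
  [/\ forall X, heq (mcomp (b X) (a X)) (idm (F X)),
      forall X, heq (mcomp (a X) (b X)) (idm (G X)) &
      forall X Y (g : mor X Y), heq (mcomp (a Y) (fmap F g)) (mcomp (fmap G g) (a X))].

Definition is_equivalence (C D : category) (F : functor C D) : Prop :=
  exists G : functor D C,
    naturally_isomorphic (comp_functor G F) (id_functor C) /\
    naturally_isomorphic (comp_functor F G) (id_functor D).

Definition full_subcat (C : category) (P : C -> Prop) : category.
Proof.
refine (@Category {X : C | P X} (fun X Y => mor (sval X) (sval Y))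
  (fun _ _ => heq) (fun X => idm (sval X)) (fun _ _ _ => mcomp) _ _ _ _ _ _ _).
- by move=> *; apply: heq_refl.
- by move=> *; apply: heq_sym.
- by move=> X Y g h k; apply: heq_trans.
- by move=> *; apply: comp_heq.
- by move=> *; apply: comp1m.
- by move=> *; apply: compm1.
- by move=> *; apply: compA.
Defined.

Record congruence (C : category) := Congruence {
  crel : forall X Y : C, mor X Y -> mor X Y -> Prop;
  crel_heq : forall (X Y : C) (g h : mor X Y), heq g h -> crel g h;
  crel_sym : forall (X Y : C) (g h : mor X Y), crel g h -> crel h g;
  crel_trans : forall (X Y : C) (g h k : mor X Y), crel g h -> crel h k -> crel g k;
  crel_comp : forall (X Y Z : C) (g g' : mor Y Z) (h h' : mor X Y),
    crel g g' -> crel h h' -> crel (mcomp g h) (mcomp g' h')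
}.
Arguments crel {C} c {X Y}.

Definition quotient_cat (C : category) (E : congruence C) : category.
Proof.
refine (@Category C (@mor C) (fun _ _ => crel E) (@idm C) (@mcomp C) _ _ _ _ _ _ _).
- by move=> *; apply/crel_heq/heq_refl.
- by move=> *; apply: crel_sym.
- by move=> X Y g h k; apply: crel_trans.
- by move=> *; apply: crel_comp.
- by move=> *; apply/crel_heq/comp1m.
- by move=> *; apply/crel_heq/compm1.
- by move=> *; apply/crel_heq/compA.
Defined.

Definition full_congruence (C : category) (E : congruence C) (P : C -> Prop) :
  congruence (full_subcat P).
Proof.
refine (@Congruence (full_subcat P) (fun _ _ => crel E) _ _ _ _).
- by move=> X Y; apply: (@crel_heq _ E (sval X) (sval Y)).
- by move=> X Y; apply: (@crel_sym _ E (sval X) (sval Y)).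
- by move=> X Y; apply: (@crel_trans _ E (sval X) (sval Y)).
- by move=> X Y Z; apply: (@crel_comp _ E (sval X) (sval Y) (sval Z)).
Defined.

Section Induced.
Variables (C D : category) (F : functor C D) (P : C -> Prop) (Q : D -> Prop).
Variable E : congruence (full_subcat P).
Hypothesis FPQ : forall X, P X -> Q (F X).
Hypothesis FE : forall (X Y : full_subcat P) (g h : mor X Y),
  crel E g h -> heq (fmap F g) (fmap F h).

Definition induced_functor : functor (quotient_cat E) (full_subcat Q).
Proof.
refine (@Functor (quotient_cat E) (full_subcat Q)
  (fun X => exist Q (F (sval X)) (FPQ (svalP X))) (fun X Y g => fmap F g) _ _ _).
- by move=> X Y g h; apply: FE.
- by move=> X; apply: fmap_id.
- by move=> X Y Z g h; apply: fmap_comp.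
Defined.
End Induced.

Definition modcat (A : pzRingType) : category.
Proof.
refine (@Category (lmodType A) (fun M N => {linear M -> N}) (fun _ _ g h => g =1 h)
  (fun M => idfun : {linear M -> M})
  (fun _ _ _ g h => (g \o h : {linear _ -> _})) _ _ _ _ _ _ _) => //.
- by move=> M N g h gh x; rewrite gh.
- by move=> M N g h k gh hk x; rewrite gh hk.
- by move=> M N P g g' h h' gg' hh' x /=; rewrite hh' gg'.
Defined.

Definition restr_functor (A B : pzRingType) (phi : {rmorphism A -> B}) :
  functor (modcat B) (modcat A).
Proof.
by refine (@Functor (modcat B) (modcat A) (fun M => restr phi M)
  (fun M N g => restr_map phi g : {linear restr phi M -> restr phi N}) _ _ _).
Defined.

Definition ext_functor (B C : pzRingType) (pi : {rmorphism B -> C}) :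
  functor (modcat B^c) (modcat C^c).
Proof.
refine (@Functor (modcat B^c) (modcat C^c) (fun M => ext_mod pi M)
  (fun M N g => ext_map pi g : {linear ext_mod pi M -> ext_mod pi N}) _ _ _).
- by move=> M N; apply: ext_map_eq.
- by move=> M; apply: ext_map_id.
- by move=> M N K; apply: ext_map_comp.
Defined.

Section AddIdeal.
Variables (A : pzRingType) (L : lmodType A).

Definition direct_summand (P W : lmodType A) : Prop :=
  exists (Q : lmodType A) (i : {linear (P * Q)%type -> W}), bijective i.

Definition add_ideal (M N : lmodType A) (g : M -> N) : Prop :=
  exists (P : lmodType A) (n : nat) (a : {linear M -> P}) (b : {linear P -> N}),
    direct_summand P {ffun 'I_n -> L} /\ forall x, g x = b (a x).

Lemma direct_summand0 : direct_summand {ffun 'I_0 -> L} {ffun 'I_0 -> L}.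
Proof.
exists {ffun 'I_0 -> L}, fst; exists (fun x => (x, 0)) => [[x y]|x] //=.
by congr (_, _); apply/ffunP=> -[].
Qed.

Lemma direct_summandD (P P' : lmodType A) n n' :
  direct_summand P {ffun 'I_n -> L} -> direct_summand P' {ffun 'I_n' -> L} ->
  direct_summand (P * P')%type {ffun 'I_(n + n') -> L}.
Proof.
move=> [Q [i [j ij ji]]] [Q' [i' [j' ij' ji']]].
pose h (x : (P * P') * (Q * Q')) : {ffun 'I_(n + n') -> L} :=
  [ffun k => match split k with
             | inl k1 => i (x.1.1, x.2.1) k1
             | inr k2 => i' (x.1.2, x.2.2) k2 end].
have hlin : linear h.
  move=> c x y; apply/ffunP=> k; rewrite !ffunE.
  case: (split k) => k'.
    have -> : ((c *: x + y).1.1, (c *: x + y).2.1) =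
              c *: (x.1.1, x.2.1) + (y.1.1, y.2.1) by [].
    by rewrite linearP !ffunE.
  have -> : ((c *: x + y).1.2, (c *: x + y).2.2) =
            c *: (x.1.2, x.2.2) + (y.1.2, y.2.2) by [].
  by rewrite linearP !ffunE.
pose hL : {linear _ -> _} := HB.pack h (GRing.isLinear.Build _ _ _ _ h hlin).
exists (Q * Q')%type, hL.
pose l (w : {ffun 'I_(n + n') -> L}) := j [ffun k => w (lshift n' k)].
pose r (w : {ffun 'I_(n + n') -> L}) := j' [ffun k => w (rshift n k)].
exists (fun w => (((l w).1, (r w).1), ((l w).2, (r w).2))) => [[[p p'] [q q']]|w].
  have -> : l (hL (p, p', (q, q'))) = (p, q).
    rewrite -[RHS]ij; congr j; apply/ffunP=> k; rewrite !ffunE.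
    by rewrite (unsplitK (inl k)).
  have -> // : r (hL (p, p', (q, q'))) = (p', q').
  rewrite -[RHS]ij'; congr j'; apply/ffunP=> k; rewrite !ffunE.
  by rewrite (unsplitK (inr k)).
apply/ffunP=> k; rewrite ffunE /= -!surjective_pairing ji ji'.
by case: splitP => m km; rewrite ffunE; congr (w _); apply: val_inj.
Qed.

Lemma add_ideal0 (M N : lmodType A) (g : M -> N) :
  (forall x, g x = 0) -> add_ideal g.
Proof.
move=> g0; exists {ffun 'I_0 -> L}, 0%N, \0, \0.
by split=> //; apply: direct_summand0.
Qed.

Lemma add_idealD (M N : lmodType A) (g h k : M -> N) :
  (forall x, k x = g x + h x) -> add_ideal g -> add_ideal h -> add_ideal k.
Proof.
move=> kgh [P [n [a [b [sP gE]]]]] [P' [n' [a' [b' [sP' hE]]]]].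
pose aa x := (a x, a' x); pose bb (y : P * P') := b y.1 + b' y.2.
have aal : linear aa.
  by move=> c x y; rewrite /aa !linearP.
have bbl : linear bb.
  by move=> c x y; rewrite /bb /= !linearP scalerDr addrACA.
exists (P * P')%type, (n + n')%N,
  (HB.pack_for {linear M -> (P * P')%type} aa (GRing.isLinear.Build _ _ _ _ aa aal)),
  (HB.pack_for {linear (P * P')%type -> N} bb (GRing.isLinear.Build _ _ _ _ bb bbl)).
by split=> [|x]; [apply: direct_summandD | rewrite kgh gE hE].
Qed.

Lemma add_idealN (M N : lmodType A) (g h : M -> N) :
  (forall x, h x = - g x) -> add_ideal g -> add_ideal h.
Proof.
move=> hg [P [n [a [b [sP gE]]]]]; exists P, n, a, (\- b); split=> // x.
by rewrite hg gE.
Qed.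

Lemma add_ideal_compl (M N K : lmodType A) (g : M -> N) (h : {linear N -> K})
    (k : M -> K) :
  (forall x, k x = h (g x)) -> add_ideal g -> add_ideal k.
Proof.
move=> kE [P [n [a [b [sP gE]]]]]; exists P, n, a, (h \o b); split=> // x.
by rewrite kE gE.
Qed.

Lemma add_ideal_compr (M N K : lmodType A) (g : N -> K) (h : {linear M -> N})
    (k : M -> K) :
  (forall x, k x = g (h x)) -> add_ideal g -> add_ideal k.
Proof.
move=> kE [P [n [a [b [sP gE]]]]]; exists P, n, (a \o h), b; split=> // x.
by rewrite kE gE.
Qed.

Definition add_congruence : congruence (modcat A).
Proof.
refine (@Congruence (modcat A)
  (fun (M N : lmodType A) (g h : {linear M -> N}) => add_ideal (g \- h)) _ _ _ _).
- by move=> M N g h gh; apply: add_ideal0 => x /=; rewrite gh subrr.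
- by move=> M N g h; apply: add_idealN => x /=; rewrite opprB.
- move=> M N g h k; apply: add_idealD => x /=.
  by rewrite addrA subrK.
- move=> M N K g g' h h' gg' hh'.
  apply: (@add_idealD M K (g \o (h \- h')) ((g \- g') \o h')).
  + by move=> x /=; rewrite raddfB addrA subrK.
  + exact: (add_ideal_compl (h := g)) hh'.
  + exact: (add_ideal_compr (h := h')) gg'.
Defined.
End AddIdeal.

(* [right_ideal e] is eA as a right A-module. *)
Section RightIdeal.
Variables (A : pzRingType) (e : A).

Definition right_idealp : {pred (A^c)^o} := fun x => `[< exists b : A, x = (e * b : A) >].
Lemma right_idealp_closed : submod_closed right_idealp.
Proof.
split; first by apply/asboolP; exists 0; rewrite mulr0.
move=> c x y /asboolP[b ->] /asboolP[d ->]; apply/asboolP.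
by exists (b * c + d); rewrite mulrDr; congr (_ + _); apply: esym (mulrA e b c).
Qed.
HB.instance Definition _ :=
  GRing.isSubmodClosed.Build A^c (A^c)^o right_idealp right_idealp_closed.

Definition right_ideal : Type := {x : (A^c)^o | right_idealp x}.
HB.instance Definition _ := SubChoice.on right_ideal.
HB.instance Definition _ := [SubChoice_isSubLmodule of right_ideal by <:].
End RightIdeal.

Record quiver_relations (R : comNzRingType) (f : R) (A : algType R)
    (ep em u v : A) : Prop := QuiverRelations {
  epep : ep * ep = ep;
  emem : em * em = em;
  epDem : ep + em = 1;
  epuem : u = ep * u * em;
  emvep : v = em * v * ep;
  uvE : u * v = f *: ep;
  vuE : v * u = f *: em
}.

(* [Quiver f a b c d] stands for [a e_+ + b e_- + c u + d v]; the product is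
   read off from the relations. *)
Record quiver_alg (R : comNzRingType) (f : R) :=
  Quiver { coef_ep : R; coef_em : R; coef_u : R; coef_v : R }.
Arguments Quiver {R} f.

Section QuiverAlgebra.
Variables (R : comNzRingType) (f : R).
Local Notation quiver_alg := (quiver_alg f).
Local Notation quiver := (Quiver f).

Definition quiver_tuple (x : quiver_alg) : R * R * R * R :=
  (coef_ep x, coef_em x, coef_u x, coef_v x).
Definition tuple_quiver (x : R * R * R * R) : quiver_alg :=
  quiver x.1.1.1 x.1.1.2 x.1.2 x.2.
Lemma quiver_tupleK : cancel quiver_tuple tuple_quiver.
Proof. by case. Qed.
HB.instance Definition _ := Choice.copy quiver_alg (can_type quiver_tupleK).

Definition quiver_add (x y : quiver_alg) : quiver_alg :=
  let: Quiver a b c d := x in let: Quiver a' b' c' d' := y in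
  quiver (a + a') (b + b') (c + c') (d + d').
Definition quiver_opp (x : quiver_alg) : quiver_alg :=
  let: Quiver a b c d := x in quiver (- a) (- b) (- c) (- d).
Definition quiver_scale (k : R) (x : quiver_alg) : quiver_alg :=
  let: Quiver a b c d := x in quiver (k * a) (k * b) (k * c) (k * d).
Definition quiver_mul (x y : quiver_alg) : quiver_alg :=
  let: Quiver a b c d := x in let: Quiver a' b' c' d' := y in
  quiver (a * a' + f * (c * d')) (b * b' + f * (d * c'))
         (a * c' + c * b') (d * a' + b * d').

Lemma quiver_addA : associative quiver_add.
Proof. by do 3![case=> ? ? ? ?] => /=; congr quiver; ring. Qed.
Lemma quiver_addC : commutative quiver_add.
Proof. by do 2![case=> ? ? ? ?] => /=; congr quiver; ring. Qed.
Lemma quiver_add0 : left_id (quiver 0 0 0 0) quiver_add.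
Proof. by case=> ? ? ? ? /=; congr quiver; ring. Qed.
Lemma quiver_addN : left_inverse (quiver 0 0 0 0) quiver_opp quiver_add.
Proof. by case=> ? ? ? ? /=; congr quiver; ring. Qed.
HB.instance Definition _ := GRing.isZmodule.Build quiver_alg
  quiver_addA quiver_addC quiver_add0 quiver_addN.

Lemma quiver_mulA : associative quiver_mul.
Proof. by do 3![case=> ? ? ? ?] => /=; congr quiver; ring. Qed.
Lemma quiver_mul1 : left_id (quiver 1 1 0 0) quiver_mul.
Proof. by case=> ? ? ? ? /=; congr quiver; ring. Qed.
Lemma quiver_1mul : right_id (quiver 1 1 0 0) quiver_mul.
Proof. by case=> ? ? ? ? /=; congr quiver; ring. Qed.
Lemma quiver_mulDl : left_distributive quiver_mul +%R.
Proof.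
by do 3![case=> ? ? ? ?]; rewrite /GRing.add /=; congr quiver; ring.
Qed.
Lemma quiver_mulDr : right_distributive quiver_mul +%R.
Proof.
by do 3![case=> ? ? ? ?]; rewrite /GRing.add /=; congr quiver; ring.
Qed.
Lemma quiver_1neq0 : quiver 1 1 0 0 != 0.
Proof. by apply/eqP => -[/eqP]; rewrite oner_eq0. Qed.
HB.instance Definition _ := GRing.Zmodule_isNzRing.Build quiver_alg
  quiver_mulA quiver_mul1 quiver_1mul quiver_mulDl quiver_mulDr quiver_1neq0.

Lemma quiver_scaleA a b x :
  quiver_scale a (quiver_scale b x) = quiver_scale (a * b) x.
Proof. by case: x => ? ? ? ? /=; congr quiver; ring. Qed.
Lemma quiver_scale1 : left_id 1 quiver_scale.
Proof. by case=> ? ? ? ? /=; congr quiver; ring. Qed.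
Lemma quiver_scaleDr : right_distributive quiver_scale +%R.
Proof.
by move=> k; do 2![case=> ? ? ? ?]; rewrite /GRing.add /=; congr quiver; ring.
Qed.
Lemma quiver_scaleDl x : {morph quiver_scale^~ x : a b / a + b}.
Proof.
move=> a b; case: x => ? ? ? ?; rewrite [RHS]/GRing.add /=.
by congr quiver; ring.
Qed.
HB.instance Definition _ := GRing.Zmodule_isLmodule.Build R quiver_alg
  quiver_scaleA quiver_scale1 quiver_scaleDr quiver_scaleDl.

Lemma quiver_addE a b c d a' b' c' d' :
  quiver a b c d + quiver a' b' c' d' = quiver (a + a') (b + b') (c + c') (d + d').
Proof. by []. Qed.
Lemma quiver_mulE a b c d a' b' c' d' :
  quiver a b c d * quiver a' b' c' d' =
  quiver (a * a' + f * (c * d')) (b * b' + f * (d * c'))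
         (a * c' + c * b') (d * a' + b * d').
Proof. by []. Qed.
Lemma quiver_scaleE k a b c d :
  k *: quiver a b c d = quiver (k * a) (k * b) (k * c) (k * d).
Proof. by []. Qed.
Lemma quiver_1E : 1 = quiver 1 1 0 0.
Proof. by []. Qed.

Lemma quiver_scalerAl (k : R) (x y : quiver_alg) : k *: (x * y) = (k *: x) * y.
Proof.
case: x y => ? ? ? ? [? ? ? ?]; rewrite !(quiver_scaleE, quiver_mulE).
by congr quiver; ring.
Qed.
HB.instance Definition _ := GRing.Lmodule_isLalgebra.Build R quiver_alg quiver_scalerAl.
Lemma quiver_scalerAr (k : R) (x y : quiver_alg) : k *: (x * y) = x * (k *: y).
Proof.
case: x y => ? ? ? ? [? ? ? ?]; rewrite !(quiver_scaleE, quiver_mulE).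
by congr quiver; ring.
Qed.
HB.instance Definition _ := GRing.Lalgebra_isAlgebra.Build R quiver_alg quiver_scalerAr.

Definition e_plus : quiver_alg := quiver 1 0 0 0.
Definition e_minus : quiver_alg := quiver 0 1 0 0.
Definition arrow_u : quiver_alg := quiver 0 0 1 0.
Definition arrow_v : quiver_alg := quiver 0 0 0 1.

Lemma quiver_alg_relations : quiver_relations f e_plus e_minus arrow_u arrow_v.
Proof.
by split; rewrite !(quiver_mulE, quiver_scaleE, quiver_addE) ?quiver_1E;
  congr quiver; ring.
Qed.

(* [quiver_alg] is presented by these generators and relations. *)
Lemma quiver_algP (A : algType R) (ep em u v : A) :
  quiver_relations f ep em u v ->
  exists phi : {lrmorphism quiver_alg -> A},
    [/\ phi e_plus = ep, phi e_minus = em, phi arrow_u = u & phi arrow_v = v] /\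
    forall psi : {lrmorphism quiver_alg -> A},
      [/\ psi e_plus = ep, psi e_minus = em, psi arrow_u = u & psi arrow_v = v] ->
      psi =1 phi.
Proof.
move=> [pp mm pm pum mvp uv vu].
have emE : em = 1 - ep by rewrite -pm addrC addKr.
have pm0 : ep * em = 0 by rewrite emE mulrBr mulr1 pp subrr.
have mp0 : em * ep = 0 by rewrite emE mulrBl mul1r pp subrr.
have pu : ep * u = u by rewrite {1}pum !mulrA pp -pum.
have um : u * em = u by rewrite {1}pum -!mulrA mm mulrA -pum.
have mv : em * v = v by rewrite {1}mvp !mulrA mm -mvp.
have vp : v * ep = v by rewrite {1}mvp -!mulrA pp mulrA -mvp.
have up : u * ep = 0 by rewrite -um -mulrA mp0 mulr0.
have mu : em * u = 0 by rewrite -pu mulrA mp0 mul0r.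
have vm : v * em = 0 by rewrite -vp -mulrA pm0 mulr0.
have pv : ep * v = 0 by rewrite -mv mulrA pm0 mul0r.
have uu : u * u = 0 by rewrite -{2}pu mulrA up mul0r.
have vv : v * v = 0 by rewrite -{2}mv mulrA vm mul0r.
pose h (x : quiver_alg) : A :=
  coef_ep x *: ep + coef_em x *: em + coef_u x *: u + coef_v x *: v.
have hlin : linear h.
  move=> k [a b c d] [a' b' c' d']; rewrite quiver_scaleE quiver_addE /h /=.
  rewrite !scalerDl !scalerDr -!scalerA.
  by rewrite (addrACA _ (a' *: ep)) (addrACA _ (a' *: ep + _)) (addrACA _ (_ + c' *: u)).
have hmon : monoid_morphism h.
  split; first by rewrite quiver_1E /h /= !scale1r !scale0r !addr0.
  move=> [a b c d] [a' b' c' d']; rewrite quiver_mulE /h /=.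
  rewrite !(mulrDl, mulrDr) -!(scalerAl, scalerAr) !(pp, mm, pm0, mp0, pu, um, mv, vp,
    up, mu, vm, pv, uu, vv, uv, vu, scaler0, addr0, add0r) !scalerA.
  by rewrite !scalerDl ![f * _]mulrC
    [LHS](AC (2 * 2 * 2 * 2) ((1 * 5) * (3 * 8) * (6 * 2) * (7 * 4)))%AC.
exists (HB.pack_for {lrmorphism quiver_alg -> A} h
  (GRing.isLinear.Build _ _ _ _ h hlin) (GRing.isMonoidMorphism.Build _ _ h hmon)).
split.
  by split; rewrite /= /h /= !scale1r !scale0r ?addr0 ?add0r.
move=> psi [psip psim psiu psiv] [a b c d]; rewrite /= /h /=.
rewrite -psip -psim -psiu -psiv -!linearZ_LR -!raddfD; congr (psi _).
by rewrite !(quiver_scaleE, quiver_addE); congr quiver; ring.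
Qed.

(* The structure map R -> B, with values in the centre of B, so that it is also
   a ring morphism to the opposite of B. *)
Definition quiver_base (r : R) : quiver_alg^c := r%:A : quiver_alg.
Lemma quiver_base_is_zmod_morphism : zmod_morphism quiver_base.
Proof. by move=> a b; apply: scalerBl. Qed.
Lemma quiver_base_is_monoid_morphism : monoid_morphism quiver_base.
Proof.
split=> [|a b]; first exact: scale1r.
rewrite mulrC /quiver_base; apply: (rmorphM (in_alg quiver_alg)).
Qed.
HB.instance Definition _ := GRing.isZmodMorphism.Build R quiver_alg^c
  quiver_base quiver_base_is_zmod_morphism.
HB.instance Definition _ := GRing.isMonoidMorphism.Build R quiver_alg^c
  quiver_base quiver_base_is_monoid_morphism.

Local Notation BeB := (quot_ring e_minus).

(* The map R/(f) -> B/Be_-B induced by the structure map. *)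
Definition quot_map (q : quot_ring f) : BeB^c :=
  qproj e_minus (quiver_base (repr q)).

Lemma quot_mapE (r : R) : quot_map (qproj f r) = qproj e_minus (quiver_base r).
Proof.
apply/zprojP; rewrite -quiver_base_is_zmod_morphism.
apply: (zspan_morph (h := quiver_base)) (zproj_repr _ r) => _ [a [b ->]].
pose c := quiver 0 0 (a * b) 0; pose d := quiver 0 (a * f * b) 0 0.
have E : quiver_base (a * f * b) =
    c * e_minus * arrow_v - (0 - d * e_minus * 1) :> quiver_alg.
  rewrite sub0r opprK /quiver_base quiver_1E quiver_scaleE !quiver_mulE quiver_addE.
  by congr quiver; ring.
apply: (@eq_ind_r _ _ (zspan (sandwich e_minus)) _ _ E).
apply: zspanB; first by apply: zspan_gen; do 2 eexists.
by apply: zspanB; [apply: zspan0 | apply: zspan_gen; do 2 eexists].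
Qed.
Lemma quot_map_is_zmod_morphism : zmod_morphism quot_map.
Proof.
do 2![elim/qproj_ind=> ?]; rewrite -raddfB !quot_mapE.
by rewrite quiver_base_is_zmod_morphism qproj_is_zmod_morphism.
Qed.
Lemma quot_map_is_monoid_morphism : monoid_morphism quot_map.
Proof.
case: quiver_base_is_monoid_morphism => b1 bM.
split; first by rewrite [LHS]quot_mapE b1; apply: (rmorph1 (qproj e_minus)).
do 2![elim/qproj_ind=> ?]; rewrite -rmorphM !quot_mapE bM.
exact: (rmorphM (qproj e_minus)).
Qed.
HB.instance Definition _ := GRing.isZmodMorphism.Build (quot_ring f) BeB^c
  quot_map quot_map_is_zmod_morphism.
HB.instance Definition _ := GRing.isMonoidMorphism.Build (quot_ring f) BeB^c
  quot_map quot_map_is_monoid_morphism.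

Definition is_CM_quiver (M : modcat quiver_alg^c) : Prop :=
  fin_gen (restr quiver_base M) /\ projective (restr quiver_base M).

Definition CM_quiver : category := full_subcat is_CM_quiver.

(* The congruence on CM(B) of the ideal <e_-B>. The object through which a
   morphism factors ranges over Mod(B), but a direct summand of a power of e_-B
   always lies in CM(B). *)
Definition e_minus_congruence : congruence CM_quiver :=
  full_congruence (add_congruence (right_ideal e_minus)) is_CM_quiver.

Definition i_star : functor (modcat quiver_alg^c) (modcat BeB^c) :=
  ext_functor (qproj e_minus).

(* i^* followed by restriction along R/(f) -> B/Be_-B. *)
Definition i_star_quot : functor (modcat quiver_alg^c) (modcat (quot_ring f)) :=
  comp_functor (restr_functor quot_map) i_star.

End QuiverAlgebra.

Definition is_mcm (S : comPzRingType) (M : modcat S) : Prop :=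
  max_cohen_macaulay M.

(* Main.v *)
From HB Require Import structures.
Require Import Defs.
From mathcomp.multinomials Require Import freeg.
From mathcomp Require Import all_boot all_algebra.
From mathcomp Require Import ring zify.
From mathcomp Require Import boolp classical_sets.

(** A module in CM(B) is a matrix factorization [P_+ -> P_- -> P_+] of [f], and [i^*]
    sends it to the cokernel of the injection [v : P_- -> P_+]. On the quotient by
    [<e_-B>] this functor is full, because maps of cokernels lift to the projective
    modules [P_+], and faithful, because a map that vanishes on cokernels factors over
    [R] through the projective module [N e_-], hence over [B] through [N e_- (x) e_-B].
    The rest is the Auslander-Buchsbaum formula in projective dimension one: a cokernel
    as above is maximal Cohen-Macaulay, and conversely the kernel of a surjection from
    [R^n] onto a maximal Cohen-Macaulay [R/(f)]-module is projective over [R].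

    Both directions are obtained from the Koszul complex of a regular system of
    parameters. Killing a regular element shifts the vanishing of Koszul homology by one
    degree, so a regular sequence of length [dim R/(f)] on [M / K] is equivalent to the
    vanishing of the homology of [M / K] in degrees at least two; and a submodule [K] of
    a free module is free at [p] once its first Koszul homology vanishes. That the
    parameters form a regular sequence, and that dividing by [f] lowers the dimension by
    one, follows from Krull's principal ideal theorem, in the form that a chain of primes
    can be made to contain a given element of its top from its second member on.

    Localizations are avoided: a statement at a prime [p] is a statement over [R] that
    holds after multiplication by some element outside [p]. *)

Set Implicit Arguments.
Unset Strict Implicit.
Unset Printing Implicit Defensive.

Import GRing.Theory.
Local Open Scope ring_scope.

(** * Linear identities in modules *)

(** The bound two on Koszul degrees is [dim R - dim R/(f) + 1]: with as many parameters as the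
    dimension of [R] at [p], a module of depth [dim R - 1] can have homology only in degrees 0 and
    1. This replaces any use of Ext or of minimal resolutions.

    Multipliers outside [p] can stand for localization because the modules concerned are finitely
    generated, so finitely many multipliers combine into one. Freeness at [p] then reads:
    multiplication by some [s] outside [p] factors through a finite free module. Such [s] form an
    ideal, and an ideal contained in no prime contains 1; projectivity over [R] is recovered in this
    way.

    Membership in CM(B) gives a dual basis over [R] of the whole of [M], not of [M e_-]. The summand
    [M e_-] is therefore never split off: it enters as the image of an idempotent operator, which is
    combined with the dual basis of the whole module. *)

Section ModuleNormalForm.
Variables (S : comPzRingType) (M : lmodType S).

Inductive mod_expr :=
| ModVar of nat | ModZero | ModAdd of mod_expr & mod_expr
| ModOpp of mod_expr | ModScale of S & mod_expr.

Fixpoint mod_eval (env : seq M) (e : mod_expr) : M :=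
  match e with
  | ModVar i => env`_i
  | ModZero => 0
  | ModAdd e1 e2 => mod_eval env e1 + mod_eval env e2
  | ModOpp e1 => - mod_eval env e1
  | ModScale k e1 => k *: mod_eval env e1
  end.

(** The index test computes on numerals, so that each coefficient of a concrete expression
    simplifies to a bare ring expression. *)
Fixpoint mod_coef (e : mod_expr) (i : nat) : S :=
  match e with
  | ModVar j => if PeanoNat.Nat.eqb j i then 1 else 0
  | ModZero => 0
  | ModAdd e1 e2 => mod_coef e1 i + mod_coef e2 i
  | ModOpp e1 => - mod_coef e1 i
  | ModScale k e1 => k * mod_coef e1 i
  end.

Lemma mod_evalE env e :
  mod_eval env e = \sum_(i < size env) mod_coef e i *: env`_i.
Proof.
elim: e => [j||e1 IH1 e2 IH2|e IH|k e IH] /=; rewrite ?IH1 ?IH2 ?IH.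
- have [lt_j|le_j] := ltnP j (size env).
    rewrite (bigD1 (Ordinal lt_j)) //= PeanoNat.Nat.eqb_refl scale1r.
    rewrite big1 ?addr0 // => i ne_i; case: PeanoNat.Nat.eqb_spec => [ji|_].
      by case/eqP: ne_i; apply: val_inj.
    by rewrite scale0r.
  rewrite nth_default // big1 // => i _; case: PeanoNat.Nat.eqb_spec => [ji|_].
    by move: le_j; rewrite ji leqNgt ltn_ord.
  by rewrite scale0r.
- by rewrite big1 // => i _; rewrite scale0r.
- by rewrite -big_split; apply: eq_bigr => i _; rewrite scalerDl.
- by rewrite -sumrN; apply: eq_bigr => i _; rewrite scaleNr.
- by rewrite scaler_sumr; apply: eq_bigr => i _; rewrite scalerA.
Qed.

(** A bounded quantifier that unfolds to a finite conjunction when [n] is a numeral, leaving one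
    goal for [ring] per atom. *)
Fixpoint upto (n : nat) (P : nat -> Prop) : Prop :=
  if n is n'.+1 then P 0%N /\ upto n' (fun i => P i.+1) else True.

Lemma uptoP n P : upto n P -> forall i, (i < n)%N -> P i.
Proof. by elim: n P => [//|n IH] P /= [P0 /IH PS] [|i] //; apply: PS. Qed.

Lemma mod_eval_eq env e1 e2 :
  upto (size env) (fun i => mod_coef e1 i = mod_coef e2 i) ->
  mod_eval env e1 = mod_eval env e2.
Proof.
move=> /uptoP e12; rewrite !mod_evalE; apply: eq_bigr => i _.
by rewrite (e12 i (ltn_ord i)).
Qed.
End ModuleNormalForm.

(** Atoms are compared up to unification because the same vector often appears under several
    convertible module structures. *)
Ltac mod_conv x y := match goal with _ => unify x y end.
Ltac mod_lookup x env :=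
  match env with
  | x :: _ => constr:(0%N)
  | ?y :: _ => let _ := mod_conv x y in constr:(0%N)
  | _ :: ?env' => let i := mod_lookup x env' in constr:(i.+1)
  end.
Ltac mod_mem x env :=
  match env with
  | x :: _ => constr:(true)
  | ?y :: _ => let _ := mod_conv x y in constr:(true)
  | _ :: ?env' => mod_mem x env'
  | _ => constr:(false)
  end.
Ltac mod_atoms t env :=
  lazymatch t with
  | ?a + ?b => let env := mod_atoms b env in mod_atoms a env
  | - ?a => mod_atoms a env
  | ?k *: ?a => mod_atoms a env
  | 0 => env
  | _ => lazymatch mod_mem t env with true => env | false => constr:(t :: env) end
  end.
Ltac mod_reify S t env :=
  lazymatch t with
  | ?a + ?b => let a := mod_reify S a env in let b := mod_reify S b env in
               constr:(@ModAdd S a b)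
  | - ?a => let a := mod_reify S a env in constr:(@ModOpp S a)
  | ?k *: ?a => let a := mod_reify S a env in constr:(@ModScale S k a)
  | 0 => constr:(@ModZero S)
  | _ => let i := mod_lookup t env in constr:(@ModVar S i)
  end.
(* Decides linear identities in a module over a commutative ring, comparing the
   coefficients of each atom with [ring]. *)
Ltac module_over S :=
  lazymatch goal with
  | |- @eq ?T ?a ?b =>
    let env := mod_atoms a (@nil T) in let env := mod_atoms b env in
    let ea := mod_reify S a env in let eb := mod_reify S b env in
    apply: (@mod_eval_eq S _ env ea eb); rewrite /=; repeat split; ring
  end.

(** * Submodules up to localization *)

Section Submodules.
Variables (S : comPzRingType) (M : lmodType S).
Implicit Types (U V W : M -> Prop) (I p : set S) (s : seq M).

Definition is_submod U : Prop :=
  [/\ U 0, forall x y, U x -> U y -> U (x + y) & forall a x, U x -> U (a *: x)].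

Lemma submod0 U : is_submod U -> U 0. Proof. by case. Qed.
Lemma submodD U x y : is_submod U -> U x -> U y -> U (x + y).
Proof. by case=> _ UD _; apply: UD. Qed.
Lemma submodZ U a x : is_submod U -> U x -> U (a *: x).
Proof. by case=> _ _; apply. Qed.
Lemma submodN U x : is_submod U -> U x -> U (- x).
Proof. by move=> sU Ux; rewrite -scaleN1r; apply: submodZ. Qed.
Lemma submodB U x y : is_submod U -> U x -> U y -> U (x - y).
Proof. by move=> sU Ux Uy; apply: submodD => //; apply: submodN. Qed.

Lemma submod_zero : is_submod (fun x : M => x = 0).
Proof.
split=> // [x y -> ->|a x ->]; [exact: addr0 | exact: scaler0].
Qed.

Lemma submod_setT : is_submod (fun _ : M => True).
Proof. by split. Qed.

Definition plus U V : M -> Prop := fun x => exists y, U y /\ V (x - y).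

Lemma submod_plus U V : is_submod U -> is_submod V -> is_submod (plus U V).
Proof.
move=> sU sV; split.
- by exists 0; split; [exact: submod0 | rewrite subrr; exact: submod0].
- move=> x y [x' [Ux' Vx']] [y' [Uy' Vy']]; exists (x' + y').
  split; first exact: submodD.
  have -> : x + y - (x' + y') = (x - x') + (y - y') by module_over S.
  exact: submodD.
- move=> a x [x' [Ux' Vx']]; exists (a *: x'); split; first exact: submodZ.
  by rewrite -scalerBr; apply: submodZ.
Qed.

Lemma plusl U V x : is_submod V -> U x -> plus U V x.
Proof. by move=> sV Ux; exists x; split=> //; rewrite subrr; apply: submod0. Qed.

Lemma plusr U V x : is_submod U -> V x -> plus U V x.
Proof. by move=> sU Ux; exists 0; split; [apply: submod0 | rewrite subr0]. Qed.

Definition smul (a : S) : M -> Prop := fun x => exists y, x = a *: y.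

Lemma submod_smul a : is_submod (smul a).
Proof.
split; first by exists 0; rewrite scaler0.
- by move=> _ _ [x ->] [y ->]; exists (x + y); rewrite scalerDr.
- by move=> b _ [x ->]; exists (b *: x); module_over S.
Qed.

(* [x] lies in [U] after localizing at [p]. *)
Definition lsat p U : M -> Prop := fun x => exists t, ~ p t /\ U (t *: x).

Lemma lsatW p U x : is_prime p -> U x -> lsat p U x.
Proof. by case=> _ p1 _ Ux; exists 1; rewrite scale1r. Qed.

Lemma lsatS p U V x : (forall y, U y -> V y) -> lsat p U x -> lsat p V x.
Proof. by move=> UV [t [pt Utx]]; exists t; split=> //; apply: UV. Qed.

Lemma primeM p t u : is_prime p -> ~ p t -> ~ p u -> ~ p (t * u).
Proof. by case=> _ _ pM nt nu /pM[]. Qed.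

Lemma submod_lsat p U : is_prime p -> is_submod U -> is_submod (lsat p U).
Proof.
move=> pp sU; split; first by apply: lsatW => //; apply: submod0.
- move=> x y [t [pt Ux]] [u [pu Uy]]; exists (t * u); split; first exact: primeM.
  have -> : (t * u) *: (x + y) = u *: (t *: x) + t *: (u *: y) by module_over S.
  by apply: submodD => //; apply: submodZ.
- move=> a x [t [pt Ux]]; exists t; split=> //.
  by rewrite scalerA mulrC -scalerA; apply: submodZ.
Qed.

Lemma lsat_lsat p U x : is_prime p -> lsat p (lsat p U) x -> lsat p U x.
Proof.
move=> pp [t [pt [u [pu Ux]]]]; exists (u * t); split; first exact: primeM.
by rewrite -scalerA.
Qed.

(** Equivalently, [U] is the preimage of its localization at [p]. *)
Definition saturated p U : Prop := forall x, lsat p U x -> U x.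

Lemma saturatedZ p U t x : saturated p U -> ~ p t -> U (t *: x) -> U x.
Proof. by move=> psU pt Utx; apply: psU; exists t. Qed.

Lemma saturated_lsat p U : is_prime p -> saturated p (lsat p U).
Proof. by move=> pp x; apply: lsat_lsat. Qed.

(** The product [I W], built one term at a time to give induction without index sets. With [I] the
    whole ring it is the submodule generated by [W]. *)
Inductive imul I W : M -> Prop :=
| imul0 : imul I W 0
| imulZD a w z : I a -> W w -> imul I W z -> imul I W (a *: w + z).

Lemma imulZ I W a w : I a -> W w -> imul I W (a *: w).
Proof. by move=> Ia Ww; rewrite -[a *: w]addr0; apply: imulZD => //; apply: imul0. Qed.

Lemma imulD I W x y : imul I W x -> imul I W y -> imul I W (x + y).
Proof.
move=> Ix Iy; elim: Ix => [|a w z Ia Ww _ IH]; first by rewrite add0r.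
by rewrite -addrA; apply: imulZD.
Qed.

Lemma submod_imul I W : is_submod W -> is_submod (imul I W).
Proof.
move=> sW; split; [exact: imul0 | exact: imulD |].
move=> b x; elim=> {x} [|a w z Ia Ww _ IH]; first by rewrite scaler0; apply: imul0.
have -> : b *: (a *: w + z) = a *: (b *: w) + b *: z by module_over S.
by apply: imulZD => //; apply: submodZ.
Qed.

Lemma imul_sub I W U x :
  is_submod U -> (forall a w, I a -> W w -> U (a *: w)) -> imul I W x -> U x.
Proof.
move=> sU IWU; elim=> [|a w z Ia Ww _ Uz]; first exact: submod0.
by apply: submodD => //; apply: IWU.
Qed.

Fixpoint span s : M -> Prop :=
  if s is g :: s' then fun x => exists a, span s' (x - a *: g) else fun x => x = 0.

Lemma submod_span s : is_submod (span s).
Proof.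
elim: s => [|g s IH] /=; first exact: submod_zero.
split; first by exists 0; rewrite scale0r subrr; apply: submod0.
- move=> x y [a sx] [b sy]; exists (a + b).
  have -> : x + y - (a + b) *: g = (x - a *: g) + (y - b *: g) by module_over S.
  exact: submodD.
- move=> c x [a sx]; exists (c * a).
  by rewrite -scalerA -scalerBr; apply: submodZ.
Qed.

Lemma span_cons g s x : span s x -> span (g :: s) x.
Proof. by exists 0; rewrite scale0r subr0. Qed.

Lemma span_mem s g : g \in s -> span s g.
Proof.
elim: s => [//|h s IH]; rewrite inE => /predU1P[->|/IH]; last exact: span_cons.
by exists 1; rewrite scale1r subrr; apply: submod0 (submod_span s).
Qed.

Lemma span_sub s U x : is_submod U -> (forall g, g \in s -> U g) -> span s x -> U x.
Proof.
move=> sU; elim: s x => [|g s IH] x sub_sU /=; first by move=> ->; apply: submod0.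
case=> a sx; rewrite -[x](subrK (a *: g)); apply: submodD => //.
  by apply: IH => // h sh; apply: sub_sU; rewrite inE sh orbT.
by apply: submodZ => //; apply: sub_sU; rewrite inE eqxx.
Qed.

Lemma span_catl s t x : span s x -> span (s ++ t) x.
Proof.
apply: span_sub; first exact: submod_span.
by move=> g sg; apply: span_mem; rewrite mem_cat sg.
Qed.

Lemma span_catr s t x : span t x -> span (s ++ t) x.
Proof.
apply: span_sub; first exact: submod_span.
by move=> g sg; apply: span_mem; rewrite mem_cat sg orbT.
Qed.

Lemma spanP n (g : 'I_n -> M) x :
  span [seq g i | i <- enum 'I_n] x <-> exists c : 'I_n -> S, x = \sum_i c i *: g i.
Proof.
split; last first.
  move=> [c ->]; apply: big_ind => [|y z|i _].
  - exact: submod0 (submod_span _).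
  - exact: submodD (submod_span _).
  - by apply: submodZ (submod_span _) _; apply/span_mem/map_f; rewrite mem_enum.
apply: (@span_sub _ (fun y => exists c : 'I_n -> S, y = \sum_i c i *: g i))
  => [|_ /mapP[i _ ->]].
  split=> [|y z [c ->] [d ->]|a y [c ->]].
  - by exists (fun _ => 0); rewrite big1 // => i _; rewrite scale0r.
  - exists (fun i => c i + d i); rewrite -big_split; apply: eq_bigr => i _.
    by rewrite scalerDl.
  - by exists (fun i => a * c i); rewrite scaler_sumr; apply: eq_bigr => i _;
      rewrite scalerA.
exists (fun j => if j == i then 1 else 0); rewrite (bigD1 i) //= eqxx scale1r.
by rewrite big1 ?addr0 // => j /negPf ->; rewrite scale0r.
Qed.

Definition fg_submod U : Prop :=
  exists s, (forall g, g \in s -> U g) /\ forall x, U x -> span s x.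

(* Induction on [s]: as [W] equals [p W] modulo [V], a relation [t *: g - a *: g] with
   [a] in [p] eliminates the generator [g], its coefficient being a unit at [p]. *)
Lemma nakayama_span p V W s : is_prime p -> is_submod V -> is_submod W ->
    (forall g, g \in s -> W g) ->
    (forall x, W x -> lsat p (plus V (span s)) x) ->
    (forall x, W x -> lsat p (plus V (imul p W)) x) ->
  forall x, W x -> lsat p V x.
Proof.
move=> pp sV sW; elim: s => [|g s IH] sub_sW Wspan Wp.
  move=> x /Wspan[t [pt [y [Vy /= /subr0_eq tx]]]].
  by exists t; split; rewrite ?tx.
apply: IH => // [h sh|]; first by apply: sub_sW; rewrite inE sh orbT.
have Wg : W g by apply: sub_sW; rewrite inE eqxx.
have sVs : is_submod (plus V (span s)) by apply: submod_plus (submod_span s).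
have pmul z : imul p W z ->
    exists t a, [/\ ~ p t, p a & plus V (span s) (t *: z - a *: g)].
  elim=> {z} [|a w z pa Ww _ [t [b [pt pb tz]]]].
    by case: pp => -[p0 _ _] p1 _; exists 1, 0; split=> //;
      rewrite scale0r scaler0 subrr; apply: submod0.
  have [u [pu [y [Vy [c suw]]]]] := Wspan w Ww.
  exists (u * t), (t * a * c + u * b); split.
  - exact: primeM.
  - by case: pp => -[_ pD pM] _ _; apply: pD; [rewrite mulrAC |]; apply: pM.
  - have -> : (u * t) *: (a *: w + z) - (t * a * c + u * b) *: g =
      (t * a) *: (u *: w - c *: g) + u *: (t *: z - b *: g) by module_over S.
    apply: submodD => //; apply: submodZ => //.
    exists y; split=> //.
    by have -> : u *: w - c *: g - y = u *: w - y - c *: g by module_over S.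
have [v [pv Vg]] : exists v, ~ p v /\ plus V (span s) (v *: g).
  have [t [pt [y [Vy /pmul [u [a [pu pa]]]]]]] := Wp g Wg.
  move=> h; exists (u * t - a); split.
    move=> pv; case: (primeM pp pu pt); case: pp => -[_ pD _] _ _.
    by rewrite -(subrK a (u * t)); apply: pD.
  have -> : (u * t - a) *: g = u *: y + (u *: (t *: g - y) - a *: g) by module_over S.
  by apply: submodD => //; apply/plusl; [exact: submod_span | apply: submodZ].
move=> x /Wspan[t [pt [y [Vy [a sx]]]]]; exists (v * t); split; first exact: primeM.
have -> : (v * t) *: x = v *: y + v *: (t *: x - y - a *: g) + a *: (v *: g).
  by module_over S.
apply: submodD => //; last exact: submodZ.
apply: submodD => //; first by apply/plusl; [exact: submod_span | apply: submodZ].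
by apply: plusr => //; apply: submodZ (submod_span _) _.
Qed.

Lemma nakayama p V W : is_prime p -> is_submod V -> is_submod W -> fg_submod W ->
    (forall x, W x -> lsat p (plus V (imul p W)) x) ->
  forall x, W x -> lsat p V x.
Proof.
move=> pp sV sW [s [sub_sW Wspan]] Wp; apply: (nakayama_span pp sV sW sub_sW _ Wp) => x Wx.
by apply: lsatW => //; apply: plusr => //; apply: Wspan.
Qed.

(** The multipliers of finitely many generators have a product that serves for all elements and
    stays outside the prime. *)
Lemma fg_lsat p V W : is_prime p -> is_submod V -> fg_submod W ->
  (forall x, W x -> lsat p V x) -> exists t, ~ p t /\ forall x, W x -> V (t *: x).
Proof.
move=> pp sV [s [sub_sW Wspan]] WV.
suff [t [pt ts]] : exists t, ~ p t /\ forall g, g \in s -> V (t *: g).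
  exists t; split=> // x /Wspan; apply: (@span_sub s (fun y => V (t *: y))) => //.
  split=> [|y z Vy Vz|a y Vy].
  - by rewrite scaler0; apply: submod0.
  - by rewrite scalerDr; apply: submodD.
  - by rewrite scalerA mulrC -scalerA; apply: submodZ.
have {sub_sW} : forall g, g \in s -> lsat p V g by move=> g /sub_sW/WV.
elim: s {Wspan} => [|g s IH] sV'.
  by exists 1; split=> //; case: pp.
have [t [pt ts]] := IH (fun h sh => sV' h (mem_behead (s := g :: s) sh)).
have [u [pu ug]] := sV' g (mem_head _ _).
exists (t * u); split; first exact: primeM.
move=> h; rewrite inE => /predU1P[->|/ts th]; first by rewrite -scalerA; apply: submodZ.
by rewrite mulrC -scalerA; apply: submodZ.
Qed.

End Submodules.

(** * Noetherian rings: maximal members and submodules of finite modules *)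

Section Noetherian.
Variable S : comPzRingType.
Implicit Types (I J p q : set S).

Lemma prime_ideal p : is_prime p -> is_ideal p. Proof. by case. Qed.
Lemma prime_submod p : is_prime p -> is_submod (M := S^o) p. Proof. by case. Qed.
Lemma prime_mul p x y : is_prime p -> p (x * y) -> ~ p x -> p y.
Proof. by case=> _ _ pM /pM[]. Qed.
Lemma prime_mull p x y : is_prime p -> p y -> p (x * y).
Proof. by case=> -[_ _ pM] _ _; apply: pM. Qed.
Lemma prime_mulr p x y : is_prime p -> p x -> p (x * y).
Proof. by rewrite mulrC; apply: prime_mull. Qed.

Hypothesis noethS : noetherian S.

Lemma fg_ideal I : is_ideal I -> fg_submod (M := S^o) I.
Proof.
move=> /noethS[n [g gI]]; exists [seq g i | i <- enum 'I_n]; split.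
  move=> _ /mapP[i _ ->]; apply/gI; exists (fun j => if j == i then 1 else 0).
  rewrite (bigD1 i) //= eqxx mul1r big1 ?addr0 // => j /negPf ->.
  by rewrite mul0r.
by move=> x /gI[c xE]; apply/(@spanP _ S^o); exists c.
Qed.

(** Without a maximal member, choice gives a strictly increasing sequence. The finitely many
    generators of its union already lie in one member, so the sequence stops growing there. *)
Lemma noeth_max (F : set S -> Prop) :
  (forall I, F I -> is_ideal I) -> (exists I, F I) ->
  exists I, F I /\ forall J, F J -> (forall x, I x -> J x) -> forall x, J x -> I x.
Proof.
move=> Fid [I0 FI0]; apply: contrapT => nomax.
have bigger (I : {I | F I}) :
    {J : {J | F J} | (forall x, sval I x -> sval J x) /\ exists x, sval J x /\ ~ sval I x}.
  apply: cid; case: I => I FI; apply: contrapT => nobig; apply: nomax.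
  exists I; split=> // J FJ IJ x Jx; apply: contrapT => nIx; apply: nobig.
  by exists (exist _ J FJ); split=> //; exists x.
pose G := fix G n : {I | F I} :=
  if n is n'.+1 then sval (bigger (G n')) else exist F I0 FI0.
have GS n : forall x, sval (G n) x -> sval (G n.+1) x.
  by have [] := svalP (bigger (G n)).
have Gle m n : (m <= n)%N -> forall x, sval (G m) x -> sval (G n) x.
  by move/subnK <-; elim: (n - m)%N => [//|k IH] x /IH; apply: GS.
pose U : set S := fun x => exists n, sval (G n) x.
have Gid n : is_ideal (sval (G n)) := Fid _ (svalP (G n)).
have Uid : is_ideal U.
  split; first by exists 0%N; case: (Gid 0%N).
  - move=> x y [m Gm] [n Gn]; exists (maxn m n); case: (Gid (maxn m n)) => _ GD _.
    by apply: GD; [apply: (Gle m) | apply: (Gle n)]; rewrite ?leq_maxl ?leq_maxr.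
  - by move=> a x [n Gn]; exists n; case: (Gid n) => _ _; apply.
have [s [sU Us]] := fg_ideal Uid.
have [n sn] : exists n, forall g, g \in s -> sval (G n) g.
  elim: s sU {Us} => [|g s IH] sU; first by exists 0%N.
  have [n Gn] := sU g (mem_head _ _).
  have [m sm] := IH (fun h sh => sU h (mem_behead (s := g :: s) sh)).
  exists (maxn n m) => h; rewrite inE => /predU1P[->|/sm].
    by apply: (Gle n); rewrite ?leq_maxl.
  by apply: (Gle m); rewrite ?leq_maxr.
have [x [Gx nGx]] : exists x, sval (G n.+1) x /\ ~ sval (G n) x.
  by have [] := svalP (bigger (G n)).
apply: nGx; apply: (span_sub (M := S^o) (s := s)) => //; last by apply: Us; exists n.+1.
exact: Gid.
Qed.

(** Peel off the generator [g]: the coefficients of [g] in elements of [U] form an ideal, whose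
    generators lift to [U]; what remains is the part of [U] in the span of [s], covered by
    induction. *)
Lemma fg_submodule (M : lmodType S) (s : seq M) (U : M -> Prop) :
  is_submod U -> (forall x, U x -> span s x) -> fg_submod U.
Proof.
elim: s U => [|g s IH] U sU Us.
  by exists [::]; split=> // x /Us.
pose I : set S := fun a => exists y, span s y /\ U (a *: g + y).
have Iid : is_ideal I.
  split.
  - exists 0; rewrite scale0r addr0; split; last exact: submod0.
    exact: submod0 (submod_span s).
  - move=> a b [y [sy Uy]] [z [sz Uz]]; exists (y + z); split.
      exact: submodD (submod_span s) sy sz.
    have -> : (a + b) *: g + (y + z) = (a *: g + y) + (b *: g + z) by module_over S.
    exact: submodD.
  - move=> a b [y [sy Uy]]; exists (a *: y); split.
      exact: submodZ (submod_span s) sy.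
    by rewrite -scalerA -scalerDr; apply: submodZ.
have [t [tI It]] := fg_ideal Iid.
have [t' [t'U t't]] : exists t' : seq M, (forall h, h \in t' -> U h) /\
    forall a, span (M := S^o) t a -> exists x, span t' x /\ span s (x - a *: g).
  elim: t tI {It} => [|a t IHt] tI.
    exists [::]; split=> // a /= ->; exists 0; split=> //.
    by rewrite scale0r subrr; apply: submod0 (submod_span s).
  have [t' [t'U t't]] := IHt (fun h th => tI h (mem_behead (s := a :: t) th)).
  have [y [sy Uy]] := tI a (mem_head _ _).
  exists (a *: g + y :: t'); split.
    by move=> h; rewrite inE => /predU1P[->|/t'U].
  move=> b /= [c /t't[x [t'x sx]]]; exists (x + c *: (a *: g + y)); split.
    by exists c; rewrite addrK.
  have -> : x + c *: (a *: g + y) - b *: g = (x - (b - c * a) *: g) + c *: y.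
    by module_over S.
  by apply: (submodD (submod_span s)) => //; apply: submodZ (submod_span s) _.
have [r [rU Ur]] : fg_submod (fun x => U x /\ span s x).
  apply: IH => [|x []//]; split;
    first by split; [|apply: submod0 (submod_span s)]; exact: submod0.
  - by move=> x y [Ux sx] [Uy sy]; split; [|apply: submodD (submod_span s) _ _];
      rewrite //; exact: submodD.
  - by move=> a x [Ux sx]; split; [|apply: submodZ (submod_span s) _];
      rewrite //; exact: submodZ.
exists (t' ++ r); split.
  by move=> h; rewrite mem_cat => /orP[/t'U|/rU[]].
move=> x Ux; have [a sx] := Us x Ux.
have [y [t'y sy]] : exists y, span t' y /\ span s (y - a *: g).
  apply/t't/It; exists (x - a *: g); split=> //.
  by rewrite addrC subrK.
have Uy : U y by apply: (span_sub sU t'U).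
have rx : span r (x - y).
  apply: Ur; split; first exact: submodB.
  have -> : x - y = (x - a *: g) - (y - a *: g) by module_over S.
  exact: submodB (submod_span s) _ _.
rewrite -(subrK y x); apply: submodD (submod_span _) _ _; first exact: span_catr.
exact: span_catl.
Qed.

(** A maximal proper ideal above [I] is prime: if [x] and [y] lie outside it, each generates 1 with
    it, and the product of the two expressions of 1 is congruent to a multiple of [x * y]. *)
Lemma exists_maximal I : is_ideal I -> ~ I 1 ->
  exists p, is_prime p /\ forall x, I x -> p x.
Proof.
move=> Iid I1.
pose F J := [/\ is_ideal J, ~ J 1 & forall x, I x -> J x].
have [//||p [[pid p1 Ip] pmax]] := @noeth_max F; first by move=> J [].
  by exists I.
exists p; split=> //; split=> // x y pxy; apply: contrapT => /not_orP[npx npy].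
have big z : ~ p z -> plus (M := S^o) p (smul (M := S^o) z) 1.
  move=> npz; apply: contrapT => n1; apply: npz.
  apply: (pmax (plus (M := S^o) p (smul (M := S^o) z))).
  - split=> //; first exact/submod_plus/submod_smul.
    by move=> w /Ip pw; apply: plusl => //; apply: submod_smul.
  - by move=> w pw; apply: plusl => //; apply: submod_smul.
  - by apply: plusr => //; exists 1; rewrite /= /GRing.scale /= mulr1.
have [a [pa [b ab]]] := big x npx; have [c [pc [d cd]]] := big y npy.
apply: p1; have -> : 1 = (1 - a + a) * (1 - c + c) :> S by rewrite !subrK mulr1.
rewrite ab cd /GRing.scale /=.
have -> : (x * b + a) * (y * d + c) = (b * d) * (x * y) + (x * b + a) * c + (y * d) * a.
  by ring.
case: pid => _ pD pM; apply: (pD); first by apply: pD; apply: (pM).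
exact: pM.
Qed.

End Noetherian.

(** * Krull's principal ideal theorem *)

Section PrincipalIdealTheorem.
Variable S : comPzRingType.
Hypothesis noethS : noetherian S.
Implicit Types (I p q : set S) (J : nat -> set S).

Definition sat_chain p I J : Prop :=
  [/\ forall n, is_ideal (J n), forall n, saturated (M := S^o) p (J n),
      forall n x, I x -> J n x & forall n x, J n.+1 x -> J n x].

(* An artinian ring without lengths: among the ideals [I] above which some chain
   does not stabilize take a maximal one; it is prime, since for [ab] in [I] the
   stability of [J n + (a)] and of [(J n : a)] implies that of [J n]. *)
Lemma sat_chain_stable p I J : is_prime p ->
    (forall q, is_prime q -> (forall x, I x -> q x) -> (forall x, q x -> p x) ->
       forall x, p x -> q x) ->
    sat_chain p I J ->
  exists N, forall n x, (N <= n)%N -> J n x -> J n.+1 x.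
Proof.
move=> pp Imin JI.
pose stable J := exists N, forall n x, (N <= n)%N -> J n x -> J n.+1 x.
pose bad K := [/\ is_ideal K, saturated (M := S^o) p K, forall x, I x -> K x &
                  exists J, sat_chain p K J /\ ~ stable J].
apply: contrapT => unstable.
have [|K [[Kid Ksat IK [{JI unstable}J [[Jid Jsat KJ Jdec] Juns]]] Kmax]] :=
    @noeth_max S noethS bad (fun K b => let: And4 k _ _ _ := b in k).
  (* [I] is only a set here; the intersection of the chain is a saturated ideal above it and below
     every member, hence a first bad ideal. *)
  case: JI => Jid Jsat IJ Jdec; exists (fun x => forall n, J n x); split.
  - split=> [n|x y Jx Jy n|a x Jx n]; case: (Jid n) => // _ JD JM.
      exact: JD.
    exact: JM.
  - by move=> x [t [pt Jt]] n; apply: Jsat; exists t; split=> //; apply: Jt.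
  - by move=> x Ix n; apply: IJ.
  - by exists J.
have pid := prime_ideal pp.
have Jle m n x : (m <= n)%N -> J n x -> J m x.
  by move/subnK <-; elim: (n - m)%N => [//|k IH] /Jdec.
have K1 : ~ K 1.
  move=> K1; apply: Juns; exists 0%N => n x _ _; apply: KJ.
  by rewrite -[x]mulr1; case: Kid => _ _; apply.
have Kp x : K x -> p x.
  move=> Kx; apply: contrapT => px; apply: K1; apply: Ksat; exists x; split=> //.
  by rewrite /GRing.scale /= mulr1.
(* A prime [K] contains [p] by minimality. A proper saturated member of the chain lies in [p], hence
   in [K], hence in the next member; if no member is proper the chain is constant. *)
have [Kpr|] := pselect (is_prime K).
  have pK := Imin K Kpr IK Kp; apply: Juns.
  have [[N nJ1]|J1] := pselect (exists N, ~ J N 1); last first.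
    exists 0%N => n x _ _; apply: contrapT => nJx; apply: J1; exists n.+1 => J1.
    by apply: nJx; rewrite -[x]mulr1; case: (Jid n.+1) => _ _; apply.
  exists N => n x /Jle leJ Jx; apply/KJ/pK; apply: contrapT => px; apply: nJ1.
  apply: leJ; apply: Jsat; exists x; split=> //.
  by rewrite /GRing.scale /= mulr1.
move=> nKpr; apply: nKpr; split=> // a b Kab; apply: contrapT => /not_orP[Ka Kb].
have stab K' J' : (forall x, K x -> K' x) -> (exists x, K' x /\ ~ K x) ->
    is_ideal K' -> saturated (M := S^o) p K' -> sat_chain p K' J' -> stable J'.
  move=> KK' [x [K'x nKx]] K'id K'sat chJ'; apply: contrapT => uns; apply: nKx.
  by apply: (Kmax K') => //; split=> // [y /IK/KK'//|]; exists J'.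
pose add (L : set S) : set S :=
  lsat (M := S^o) p (plus (M := S^o) L (smul (M := S^o) a)).
pose colon (L : set S) : set S := fun x => L (x * a).
have sub_add L x : L x -> add L x.
  by move=> Lx; apply: lsatW => //; apply: plusl => //; apply: submod_smul.
have add_id L : is_ideal L -> is_ideal (add L).
  by move=> Lid; apply/submod_lsat/submod_plus/submod_smul.
have add_a L : is_ideal L -> add L a.
  move=> Lid; apply: lsatW => //; apply: plusr => //; exists 1.
  by rewrite /GRing.scale /= mulr1.
have addS L L' x : (forall y, L y -> L' y) -> add L x -> add L' x.
  by move=> LL'; apply: lsatS => y [z [Lz ?]]; exists z; split=> //; apply: LL'.
have colon_id L : is_ideal L -> is_ideal (colon L).
  move=> [L0 LD LM]; split; rewrite /colon; first by rewrite mul0r.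
    by move=> x y ? ?; rewrite mulrDl; apply: LD.
  by move=> c x ?; rewrite -mulrA; apply: LM.
have colon_sat L : saturated (M := S^o) p L -> saturated (M := S^o) p (colon L).
  move=> Lsat x [t [pt Lt]]; apply: Lsat; exists t; split=> //.
  by move: Lt; rewrite /colon /GRing.scale /= mulrA.
have sub_colon L x : is_ideal L -> L x -> colon L x.
  by case=> _ _ LM Lx; rewrite /colon mulrC; apply: LM.
have [N1 st1] : stable (fun n => add (J n)).
  apply: (stab (add K) (fun n => add (J n))).
  - exact: sub_add.
  - by exists a; split=> //; apply: add_a.
  - exact: add_id.
  - exact: saturated_lsat.
  - split=> [n|n|n x|n x].
    + exact: add_id.
    + exact: saturated_lsat.
    + by apply: addS; apply: KJ.
    + by apply: addS; apply: Jdec.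
have [N2 st2] : stable (fun n => colon (J n)).
  apply: (stab (colon K) (fun n => colon (J n))).
  - by move=> x Kx; apply: sub_colon.
  - by exists b; split=> //; rewrite /colon mulrC.
  - exact: colon_id.
  - exact: colon_sat.
  - split=> [n|n|n x|n x].
    + exact: colon_id.
    + exact: colon_sat.
    + exact: KJ.
    + exact: Jdec.
apply: Juns; exists (maxn N1 N2) => n x; rewrite geq_max => /andP[le1 le2] Jx.
(* Modular law: write [t x = y + c a] with [y] in [J n.+1]. Then [c a] lies in [J n], so [c] lies in
   the colon ideal, which is stable, and [c a] lies in [J n.+1]. *)
have /st1 : add (J n) x by apply: sub_add.
case=> // t [pt [y [Jy [c cE]]]].
have Jca : J n (c * a).
  have -> : c * a = t * x - y by rewrite mulrC; apply: esym.
  exact: (submodB (M := S^o) (Jid n) (submodZ (M := S^o) t (Jid n) Jx) (Jdec _ _ Jy)).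
apply: Jsat; exists t; split=> //.
have -> : t *: (x : S^o) = y + c * a.
  by rewrite [c * a]mulrC; apply/eqP; rewrite addrC -subr_eq; apply/eqP.
exact: (submodD (M := S^o) (Jid n.+1) Jy (st2 _ _ le2 Jca)).
Qed.

Fixpoint ideal_pow q n : set S :=
  if n is n'.+1 then imul (M := S^o) q (ideal_pow q n') else fun=> True.

Lemma ideal_pow_id q n : is_ideal (ideal_pow q n).
Proof. by elim: n => [|n IH] //=; apply: submod_imul. Qed.

Lemma ideal_powS q n x : is_ideal q -> ideal_pow q n.+1 x -> ideal_pow q n x.
Proof.
move=> qid; apply: imul_sub; first exact: ideal_pow_id.
move=> a w qa qw; exact: (submodZ (M := S^o) a (ideal_pow_id q n) qw).
Qed.

(* Krull's principal ideal theorem, with his proof by symbolic powers. *)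
Lemma principal_ideal_theorem (p0 p1 p2 : set S) (x : S) :
  is_prime p0 -> is_prime p1 -> is_prime p2 ->
  (p0 `<` p1)%classic -> (p1 `<` p2)%classic -> p2 x ->
  exists q, [/\ is_prime q, (p0 `<` q)%classic, (q `<` p2)%classic & q x].
Proof.
move=> P0 P1 P2 lt01 lt12 p2x; have [le01 _] := lt01; have [le12 _] := lt12.
have ne01 : p0 <> p1 by move=> e; case: lt01 => _; rewrite e; apply.
have ne12 : p1 <> p2 by move=> e; case: lt12 => _; rewrite e; apply.
have [p0x|np0x] := pselect (p0 x).
  by exists p1; split=> //; apply: le01.
apply: contrapT => noq.
pose I := plus (M := S^o) p0 (smul (M := S^o) x).
have Iid : is_ideal I by apply/submod_plus/submod_smul; apply: prime_submod.
have Ix : I x.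
  by apply: plusr; [exact: prime_submod | exists 1; rewrite /GRing.scale /= mulr1].
have p0I y : p0 y -> I y by move=> p0y; apply: plusl => //; apply: submod_smul.
(* If no intermediate prime contains [x], then [p2] is minimal over [p0 + (x)], which is what makes
   descending saturated chains above it stop. *)
have Imin q : is_prime q -> (forall y, I y -> q y) -> (forall y, q y -> p2 y) ->
    forall y, p2 y -> q y.
  move=> Q Iq q2 y p2y; apply: contrapT => nqy; apply: noq; exists q; split=> //.
  - split=> [z /p0I/Iq//|]; apply: contra_not np0x => qp0; exact/qp0/Iq.
  - by split=> // /(_ y p2y).
  - exact: Iq.
have np1x : ~ p1 x.
  move=> p1x; apply: ne12; apply/seteqP; split=> //; apply: Imin => //.
  move=> y [z [p0z [c yE]]]; rewrite -(subrK z y) yE.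
  apply: (submodD (M := S^o)); [exact: prime_submod | exact: prime_mulr | exact: le01].
(* The [n]-th symbolic power of [p1] modulo [p0]. *)
pose Q n : set S :=
  lsat (M := S^o) p1 (plus (M := S^o) p0 (ideal_pow p1 n)).
have p1id := prime_ideal P1.
have sumid n : is_submod (M := S^o) (plus (M := S^o) p0 (ideal_pow p1 n)).
  by apply: submod_plus; [exact: prime_submod | exact: ideal_pow_id].
have Qid n : is_submod (M := S^o) (Q n) by apply: submod_lsat.
have QS n y : Q n.+1 y -> Q n y.
  by apply: lsatS => z [w [p0w p1w]]; exists w; split=> //; apply: ideal_powS.
have Qsat n : saturated (M := S^o) p1 (Q n) by apply: saturated_lsat.
pose J n : set S :=
  lsat (M := S^o) p2 (plus (M := S^o) (Q n) (smul (M := S^o) x)).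
have Jid n : is_submod (M := S^o) (plus (M := S^o) (Q n) (smul (M := S^o) x)).
  exact/submod_plus/submod_smul.
have p0Q n y : p0 y -> Q n y.
  by move=> p0y; apply: lsatW => //; apply: plusl => //; apply: ideal_pow_id.
have chJ : sat_chain p2 I J.
  split=> [n|n|n y|n y].
  - exact: submod_lsat.
  - exact: saturated_lsat.
  - move=> [z [p0z xz]]; apply: lsatW => //; exists z; split=> //; exact: p0Q.
  - by apply: lsatS => z [w [Qw xw]]; exists w; split=> //; apply: QS.
have [n stab] := sat_chain_stable P2 Imin chJ.
(* Stability gives [t y = z + x c] with [z] in [Q n.+1]. As [x] is outside [p1] and [Q n] is
   saturated there, [c] lies in [Q n]; so [Q n = Q n.+1 + x Q n] at [p2], and Nakayama applies. *)
have QQ y : Q n y -> Q n.+1 y.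
  move=> Qy; suff [t [p2t Qt]] : lsat (M := S^o) p2 (Q n.+1) y.
    by apply: Qsat; exists t; split=> // /le12.
  apply: (nakayama (M := S^o) P2 (Qid n.+1) (Qid n) (fg_ideal noethS (Qid n))) Qy.
  move=> {}y Qy; have /(stab n y (leqnn n)) : J n y.
    by apply: lsatW => //; apply: plusl => //; apply: submod_smul.
  case=> t [p2t [z [Qz [c cE]]]]; exists t; split=> //; exists z; split=> //.
  rewrite cE; apply: imulZ => //; apply: Qsat; exists x; split=> //.
  rewrite -cE.
  exact: (submodB (M := S^o) (Qid n) (submodZ (M := S^o) t (Qid n) Qy) (QS _ _ Qz)).
(* A second use of Nakayama, now at [p1]: modulo [p0] the power [p1^n] equals [p1^(n+1)], so it
   vanishes and [p1] falls into [p0]. *)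
have qn0 : forall y, ideal_pow p1 n y -> lsat (M := S^o) p1 p0 y.
  apply: (@nakayama S S^o p1 p0 (ideal_pow p1 n)) => //.
  - exact: prime_submod.
  - exact: ideal_pow_id.
  - exact/fg_ideal/ideal_pow_id.
  move=> y yn; apply: QQ; apply: lsatW => //; apply: plusr => //.
  exact: prime_submod.
have p01 t y : ~ p1 t -> p0 (t *: (y : S^o)) -> p0 y.
  by move=> p1t /prime_mul; apply=> // /le01.
have {}qn0 y : ideal_pow p1 n y -> p0 y by case/qn0=> t [p1t]; apply: p01.
apply: ne01; apply/seteqP; split=> // y p1y.
have yn : ideal_pow p1 n (y ^+ n).
  elim: (n) => [//|k IH]; rewrite exprS.
  exact: (@imulZ S S^o p1 (ideal_pow p1 k)).
have := qn0 _ yn; elim: (n) => [|k IH]; first by case: (P0).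
by rewrite exprS; case: (P0) => _ _ p0M /p0M[//|/IH].
Qed.

(** Krull's theorem replaces the prime just below the top by one that contains [x]; that prime is
    the top of a shorter chain, to which induction applies. *)
Lemma chain_through (x : S) n (P : nat -> set S) : prime_chain n.+1 P -> P n.+1 x ->
  exists P', [/\ prime_chain n.+1 P', P' 0%N = P 0%N, P' n.+1 = P n.+1 & P' 1%N x].
Proof.
elim: n P => [|n IH] P [Ppr Plt] Px; first by exists P.
have [q [qpr lt0q ltq2 qx]] := principal_ideal_theorem (Ppr n (leqW (leqnSn n)))
  (Ppr n.+1 (leqnSn _)) (Ppr n.+2 (leqnn _)) (Plt n (leqnSn _)) (Plt n.+1 (leqnn _)) Px.
pose Q i := if (i <= n)%N then P i else q.
have [||P' [[P'pr P'lt] P'0 P'n P'1]] := IH Q.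
- split=> i; rewrite /Q; first by case: (leqP i n) => // le_in _; apply: Ppr; lia.
  rewrite ltnS => le_in; rewrite le_in; case: (ltnP i n) => [lt_in|le_ni].
    by apply: Plt; lia.
  by have -> : i = n by lia.
- by rewrite /Q ltnn.
exists (fun i => if (i <= n.+1)%N then P' i else P n.+2); split.
- split=> i.
    by case: (leqP i n.+1) => [le_i _|lt_i _]; [apply: P'pr | apply: Ppr].
  rewrite ltnS => le_in; rewrite le_in; case: (ltnP i n.+1) => [lt_in|le_ni].
    exact: P'lt.
  have -> : i = n.+1 by lia.
  by rewrite P'n /Q ltnn.
- by rewrite leq0n P'0.
- by rewrite ltnn.
- by [].
Qed.

End PrincipalIdealTheorem.

(** * Koszul homology *)

Section PairModule.
Variables (S : comPzRingType) (V W : lmodType S).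
Lemma pairZE (c : S) (v : V) (w : W) : c *: (v, w) = (c *: v, c *: w).
Proof. by []. Qed.
Lemma pairDE (v v' : V) (w w' : W) : (v, w) + (v', w') = (v + v', w + w').
Proof. by []. Qed.
End PairModule.

Section KoszulDef.
Variables (S : comPzRingType) (M : lmodType S).
Implicit Types (x : seq S) (U V : M -> Prop) (p : set S).

(* The total space of the Koszul complex of [x] with coefficients in [M], as an
   iterated mapping cone: [koszul (a :: x)] is the cone of [a] on [koszul x]. *)
Fixpoint koszul x : lmodType S :=
  if x is _ :: x' then (koszul x' * koszul x')%type else M.

Fixpoint kd x : koszul x -> koszul x :=
  match x return koszul x -> koszul x with
  | [::] => fun=> 0
  | a :: x' => fun z => (kd z.1 + a *: z.2, - kd z.2)
  end.

(** The grading is a predicate on the total space rather than a family of types. The second summand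
    of the cone is shifted by one, so it must vanish in degree 0. *)
Fixpoint kdeg x i : koszul x -> Prop :=
  match x return koszul x -> Prop with
  | [::] => fun z => if i is 0%N then True else z = 0
  | _ :: x' => fun z => kdeg i z.1 /\ if i is i'.+1 then kdeg i' z.2 else z.2 = 0
  end.

(** The subcomplex with coefficients in [U]. Working modulo it computes the Koszul complex of
    [M / U] without forming the quotient. *)
Fixpoint kin x U : koszul x -> Prop :=
  match x return koszul x -> Prop with
  | [::] => U
  | _ :: x' => fun z => kin U z.1 /\ kin U z.2
  end.

Lemma kd_linear x c (z w : koszul x) : kd (c *: z + w) = c *: kd z + kd w.
Proof.
elim: x z w => [|a x IH] z w /=; first by rewrite scaler0 addr0.
case: z w => z1 z2 [w1 w2]; rewrite !IH.
have -> : c *: (kd z1 + a *: z2, - kd z2) + (kd w1 + a *: w2, - kd w2) =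
  (c *: (kd z1 + a *: z2) + (kd w1 + a *: w2), c *: - kd z2 - kd w2) by [].
by congr (_, _); module_over S.
Qed.

Lemma kdD x (z w : koszul x) : kd (z + w) = kd z + kd w.
Proof. by have := kd_linear 1 z w; rewrite !scale1r. Qed.

Lemma kd0 x : kd (0 : koszul x) = 0.
Proof. by apply: (addrI (kd (0 : koszul x))); rewrite -kdD !addr0. Qed.

Lemma kdZ x c (z : koszul x) : kd (c *: z) = c *: kd z.
Proof. by have := kd_linear c z 0; rewrite kd0 !addr0. Qed.

Lemma kdN x (z : koszul x) : kd (- z) = - kd z.
Proof. by rewrite -scaleN1r kdZ scaleN1r. Qed.

Lemma kdB x (z w : koszul x) : kd (z - w) = kd z - kd w.
Proof. by rewrite kdD kdN. Qed.

Lemma kd_kd x (z : koszul x) : kd (kd z) = 0.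
Proof.
elim: x z => [|a x IH] z //=.
rewrite !(kdD, kdN, kdZ, IH); congr (_, _); last by rewrite oppr0 oppr0.
by rewrite add0r scalerN subrr.
Qed.

Lemma submod_pair (V W : lmodType S) (A : V -> Prop) (B : W -> Prop) :
  is_submod A -> is_submod B ->
  is_submod (M := (V * W)%type) (fun z => A z.1 /\ B z.2).
Proof.
move=> sA sB; split; first by split; apply: submod0.
- by move=> z w [? ?] [? ?]; split; apply: submodD.
- by move=> a z [? ?]; split; apply: submodZ.
Qed.

Lemma submod_kdeg x i : is_submod (@kdeg x i).
Proof.
elim: x i => [|a x IH] [|i] /=; last exact: submod_pair.
- exact: submod_setT.
- exact: submod_zero.
- exact: submod_pair (IH 0%N) (submod_zero _).
Qed.

Lemma submod_kin x U : is_submod U -> is_submod (@kin x U).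
Proof. by move=> sU; elim: x => [|a x IH] //=; apply: submod_pair. Qed.

Lemma kin_mono x U V (z : koszul x) : (forall y, U y -> V y) -> kin U z -> kin V z.
Proof. by move=> UV; elim: x z => [|a x IH] z /=; [apply: UV | case=> /IH ? /IH]. Qed.

Lemma kin_eq0 x (z : koszul x) : kin (fun m => m = 0) z <-> z = 0.
Proof.
split=> [|->]; last exact: submod0 (submod_kin x (submod_zero M)).
by elim: x z => [|a x IH] //= [z w] /= [/IH -> /IH ->].
Qed.

Lemma kin_kd x U (z : koszul x) : is_submod U -> kin U z -> kin U (kd z).
Proof.
move=> sU; elim: x z => [|a x IH] z /=; first by move=> _; apply: submod0.
have sK := submod_kin x sU; case=> U1 U2; split.
  by apply: submodD => //; [apply: IH | apply: submodZ].
by apply: submodN => //; apply: IH.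
Qed.

Lemma kdeg0_kd x (z : koszul x) : kdeg 0 z -> kd z = 0.
Proof.
elim: x z => [|a x IH] //= [z w] /= [/IH -> ->].
by rewrite kd0 oppr0 scaler0 addr0.
Qed.

Lemma kdegS_kd x i (z : koszul x) : kdeg i.+1 z -> kdeg i (kd z).
Proof.
elim: x i z => [|a x IH] i z /=; first by case: i.
case=> d1 d2; split.
  by apply: (submodD (submod_kdeg x i)); [apply: IH | apply: submodZ (submod_kdeg x i) d2].
case: i d1 d2 => [|i] d1 d2; first by rewrite kdeg0_kd ?oppr0.
by apply: (submodN (submod_kdeg x i)); apply: IH.
Qed.

Lemma kdeg_gt_size x i (z : koszul x) : (size x < i)%N -> kdeg i z -> z = 0.
Proof.
elim: x i z => [|a x IH] [|i] //= [z w] /=.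
rewrite ltnS => lt_i [d1 d2].
by rewrite (IH _ _ (leqW lt_i) d1) (IH _ _ lt_i d2).
Qed.

Lemma kin_lsat p x U (z : koszul x) : is_prime p -> is_submod U ->
  kin (lsat p U) z <-> lsat p (kin U) z.
Proof.
move=> pp sU; split; last first.
  elim: x z => [|a x IH] z //= [t [pt [U1 U2]]].
  by split; apply: IH; exists t.
elim: x z => [|a x IH] z //= [/IH[t [pt U1]] /IH[u [pu U2]]].
have sK := submod_kin x sU; exists (u * t); split; first exact: primeM.
split; rewrite /= ?[u * t]mulrC -scalerA; last exact: submodZ.
by rewrite scalerA mulrC -scalerA; apply: submodZ.
Qed.

Lemma kin_plus_smul x U a i (z : koszul x) : is_submod U -> kdeg i z ->
  kin (plus U (smul a)) z -> exists e, kdeg i e /\ kin U (z - a *: e).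
Proof.
move=> sU; elim: x i z => [|b x IH] i z /=.
  case: i => [_|i ->]; last first.
    by exists 0; split=> //; rewrite scaler0 subrr; apply: submod0.
  by case=> y [Uy [e zy]]; exists e; split=> //; rewrite -zy subKr.
case=> d1 d2 [/IH-/(_ _ d1)[e1 [de1 Ue1]] k2].
case: i d1 d2 de1 => [|i] d1 d2 de1.
  exists (e1, 0); split=> //=; split=> //.
  by rewrite d2 scaler0 subr0; apply: submod0 (submod_kin x sU).
have [e2 [de2 Ue2]] := IH _ _ d2 k2.
by exists (e1, e2).
Qed.

Lemma kin_regular x U a (z : koszul x) :
  (forall y, U (a *: y) -> U y) -> kin U (a *: z) -> kin U z.
Proof. by move=> reg; elim: x z => [|b x IH] z /=; [apply: reg | case=> /IH ? /IH]. Qed.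

(* Multiplication by an element of the ideal of [x] is null-homotopic. *)
Lemma koszul_homotopy x a : span (M := S^o) x a ->
  exists h : koszul x -> koszul x,
  [/\ forall c z w, h (c *: z + w) = c *: h z + h w,
      forall U z, is_submod U -> kin U z -> kin U (h z),
      forall i z, kdeg i z -> kdeg i.+1 (h z) &
      forall z, a *: z = kd (h z) + h (kd z)].
Proof.
elim: x a => [|b x IH] a /=.
  move=> ->; exists (fun=> 0); split=> [c z w|U z sU _|i z _|z] //=.
  - by rewrite scaler0 addr0.
  - exact: submod0.
  - by rewrite scale0r addr0.
case=> c /IH[h [hL hU hdeg hE]].
have h0 : h 0 = 0.
  have := hL 1 0 0; rewrite !scale1r addr0 => hh.
  by apply: (addrI (h 0)); rewrite addr0.
have hN z : h (- z) = - h z by rewrite -[- z]addr0 -scaleN1r hL h0 addr0 scaleN1r.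
(* [h] is a homotopy for [a - c * b] on the tail. The entry [c *: z.1] supplies the missing [c * b],
   and the sign of [h z.2] matches the sign of the cone differential. *)
exists (fun z => (h z.1, c *: z.1 - h z.2)); split=> /=.
- move=> k [z1 z2] [w1 w2]; rewrite /= !hL.
  have -> : k *: (h z1, c *: z1 - h z2) + (h w1, c *: w1 - h w2) =
    (k *: h z1 + h w1, k *: (c *: z1 - h z2) + (c *: w1 - h w2)) by [].
  by congr (_, _); module_over S.
- move=> U z sU [U1 U2]; split; first exact: hU.
  have sK := submod_kin x sU; apply: submodB => //; last exact: hU.
  exact: submodZ.
- move=> i z [d1 d2]; split; first exact: hdeg.
  apply: (submodB (submod_kdeg x i)); first exact: submodZ (submod_kdeg x i) d1.
  case: i d1 d2 => [|i] d1 d2; last exact: hdeg.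
  by rewrite d2 h0; apply: submod0 (submod_kdeg x 0%N).
- case=> z w /=; have := hE z; have := hE w.
  rewrite pairDE pairZE kdB kdZ [kd z + b *: w]addrC hL hN => hw hz.
  congr (_, _).
    have -> : a *: z = (a - c * b) *: z + (c * b) *: z by module_over S.
    by rewrite [in LHS]hz; module_over S.
  have -> : a *: w = (a - c * b) *: w + (c * b) *: w by module_over S.
  by rewrite [in LHS]hw; module_over S.
Qed.
End KoszulDef.

Section KoszulMap.
Variables (S : comPzRingType) (x : seq S).

Section OneMap.
Variables (M N : lmodType S) (g : {linear M -> N}).

Fixpoint kmap (x : seq S) : koszul M x -> koszul N x :=
  match x return koszul M x -> koszul N x with
  | [::] => g
  | _ :: x' => fun z => (kmap z.1, kmap z.2)
  end.

Lemma kmap_linear y c (z w : koszul M y) :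
  kmap (c *: z + w) = c *: kmap z + kmap w.
Proof.
elim: y z w => [|a y IH] z w /=; first exact: linearP.
by rewrite !IH.
Qed.

Lemma kmapD y (z w : koszul M y) : kmap (z + w) = kmap z + kmap w.
Proof. by have := kmap_linear 1 z w; rewrite !scale1r. Qed.
Lemma kmap0 y : kmap (0 : koszul M y) = 0.
Proof. by apply: (addrI (kmap (0 : koszul M y))); rewrite -kmapD !addr0. Qed.
Lemma kmapZ y c (z : koszul M y) : kmap (c *: z) = c *: kmap z.
Proof. by have := kmap_linear c z 0; rewrite kmap0 !addr0. Qed.
Lemma kmapN y (z : koszul M y) : kmap (- z) = - kmap z.
Proof. by rewrite -scaleN1r kmapZ scaleN1r. Qed.
Lemma kmapB y (z w : koszul M y) : kmap (z - w) = kmap z - kmap w.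
Proof. by rewrite kmapD kmapN. Qed.

Lemma kmap_kd y (z : koszul M y) : kmap (kd z) = kd (kmap z).
Proof.
elim: y z => [|a y IH] z /=; first exact: linear0.
by rewrite kmapD kmapN kmapZ !IH.
Qed.

Lemma kmap_kdeg y i (z : koszul M y) : kdeg i z -> kdeg i (kmap z).
Proof.
elim: y i z => [|a y IH] i z /=; first by case: i => [|i] // ->; apply: linear0.
case=> d1 d2; split; first exact: IH.
by case: i d1 d2 => [|i] d1 d2; [rewrite d2; apply: kmap0 | apply: IH].
Qed.

Lemma kin_kmap y U (z : koszul M y) : kin U (kmap z) <-> kin (fun m => U (g m)) z.
Proof.
elim: y z => [//|a y IH] z /=.
by split=> -[/IH ? /IH ?].
Qed.

Lemma kmap_lift y i (z : koszul N y) (V : M -> Prop) U : V 0 ->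
  (forall n, U n -> exists m, V m /\ g m = n) -> kdeg i z -> kin U z ->
  exists w : koszul M y, [/\ kdeg i w, kin V w & kmap w = z].
Proof.
move=> V0 gU; elim: y i z => [|a y IH] i z /=.
  case: i => [_ /gU[m [Vm <-]]|i -> _]; first by exists m.
  by exists 0; split=> //; apply: linear0.
case: z => z1 z2 /= [d1 d2] [/(IH _ _ d1)[w1 [dw1 Vw1 w1E]] Uz2].
case: i d1 d2 dw1 => [|i] d1 d2 dw1.
  exists (w1, 0); split=> //=.
    split=> //; elim: (y) => [|b y' IHy] //=; split=> //.
  by rewrite w1E kmap0 d2.
have [w2 [dw2 Vw2 w2E]] := IH _ _ d2 Uz2.
by exists (w1, w2); split=> //=; rewrite w1E w2E.
Qed.
End OneMap.

Lemma kmap_sum (M : lmodType S) n (g : 'I_n -> {linear M -> M}) y (z : koszul M y) :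
  (forall m, m = \sum_i g i m) -> z = \sum_i kmap (g i) z.
Proof.
move=> gE; elim: y z => [|a y IH] z /=; first exact: gE.
rewrite [LHS]surjective_pairing {1}(IH z.1) {1}(IH z.2).
elim/big_rec3: _ => [//|i u v w _ <-].
by [].
Qed.

End KoszulMap.

Section KoszulVanishing.
Variables (S : comPzRingType) (p : set S) (x : seq S).
Hypothesis pp : is_prime p.

(** This is the vanishing at [p] of the Koszul homology of [x] on [M / U] in degree [i]. *)
Definition kvanish (M : lmodType S) i (U : M -> Prop) : Prop :=
  forall z : koszul M x, kdeg i z -> kin U (kd z) ->
  exists t w, [/\ ~ p t, kdeg i.+1 w & kin U (t *: z - kd w)].

Lemma kvanish_gt (M : lmodType S) i (U : M -> Prop) :
  is_submod U -> (size x < i)%N -> kvanish i U.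
Proof.
move=> sU lt_i z dz _; exists 1, 0; split; first by case: pp.
  exact: submod0 (submod_kdeg _ _ _).
rewrite (kdeg_gt_size lt_i dz) scaler0 kd0 subrr.
exact: submod0 (submod_kin _ sU).
Qed.

Section RegularElement.
Variables (M : lmodType S) (U : M -> Prop) (a : S).
Hypothesis sU : is_submod U.
Hypothesis aU : forall y, U (a *: y) -> U y.

Let U' := lsat p (plus U (smul a)).

Let sP : is_submod (plus U (smul (M := M) a)).
Proof. exact/submod_plus/submod_smul. Qed.

Let kin_smul (z : koszul M x) : kin (plus U (smul a)) (a *: z).
Proof.
elim: (x) z => [|b y IH] z /=; last by split; apply: IH.
by apply: plusr => //; exists z.
Qed.

(** In the long exact sequence of multiplication by [a], this multiplication is zero on homology
    because [a] lies in the ideal of [x] at [p]. Hence the connecting map from degree [i.+1] of the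
    quotient onto degree [i] is surjective. *)
Lemma kvanish_regular i :
  lsat (M := S^o) p (span (M := S^o) x) a -> kvanish i.+1 U' -> kvanish i U.
Proof.
move=> [s [ps sa]] van c dc Udc; have sK := submod_kin x sU.
have [h [hL hU hdeg hE]] := koszul_homotopy M sa.
have hcE : kd (h c) = (s * a) *: c - h (kd c) by rewrite (hE c) addrK.
(* The chain [h c] has boundary [a *: (s *: c)] modulo [U]: it is a cycle modulo [a] whose image
   under the connecting map is the class of [s *: c]. *)
have [||t [w [pt dw /(kin_lsat _ pp sP)[u [pu Uw]]]]] := van (h c).
- exact: hdeg.
- have -> : kd (h c) = - h (kd c) + a *: (s *: c) by rewrite hcE; module_over S.
  apply: kin_mono (_ : kin (plus U (smul a)) _) => [y|]; first exact: lsatW.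
  apply: submodD (submod_kin x sP) _ _; last exact: kin_smul.
  apply: submodN (submod_kin x sP) _.
  apply: kin_mono (_ : kin U _); last exact: hU.
  by move=> y; apply/plusl/submod_smul.
have [|e [de Ue]] := kin_plus_smul (i := i.+1) sU _ Uw.
  apply: submodZ (submod_kdeg _ _ _) _; apply: submodB (submod_kdeg _ _ _) _ _.
    by apply: submodZ (submod_kdeg _ _ _) _; apply: hdeg.
  exact: kdegS_kd.
exists (u * t * s), e; split=> //; first by do 2!apply: primeM => //.
apply: (kin_regular aU).
have -> : a *: ((u * t * s) *: c - kd e) =
    kd (u *: (t *: h c - kd w) - a *: e) + (u * t) *: h (kd c).
  by rewrite !(kdB, kdZ) kd_kd hcE; module_over S.
apply: submodD => //; first exact: kin_kd.
by apply: submodZ => //; apply: hU.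
Qed.

(** The homology of the quotient by [a] sits in the long exact sequence between the two groups
    assumed to vanish. *)
Lemma kvanish_quotient i : kvanish i U -> kvanish i.+1 U -> kvanish i.+1 U'.
Proof.
move=> van vanS c dc /(kin_lsat _ pp sP)[s [ps Uc]]; have sK := submod_kin x sU.
have [|e [de Ue]] := kin_plus_smul (i := i) sU _ Uc.
  by apply: submodZ (submod_kdeg _ _ _) _; apply: kdegS_kd.
have [|t [w [pt dw Uw]]] := van e de.
  apply: (kin_regular aU); rewrite -kdZ.
  have -> : kd (a *: e) = - kd (s *: kd c - a *: e).
    by rewrite kdB [kd (s *: _)]kdZ kd_kd scaler0 sub0r opprK.
  by apply: submodN => //; apply: kin_kd.
have [||u [w' [pu dw' Uw']]] := vanS ((t * s) *: c - a *: w).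
- apply: submodB (submod_kdeg _ _ _) _ _; exact: submodZ (submod_kdeg _ _ _) _.
- have -> : kd ((t * s) *: c - a *: w) =
      t *: (s *: kd c - a *: e) + a *: (t *: e - kd w).
    by rewrite kdB !kdZ; module_over S.
  by apply: submodD => //; apply: submodZ.
exists (u * (t * s)), w'; split=> //; first by do 2!apply: primeM => //.
apply: kin_mono (_ : kin (plus U (smul a)) _) => [y|]; first exact: lsatW.
have -> : (u * (t * s)) *: c - kd w' =
    u *: ((t * s) *: c - a *: w) - kd w' + a *: (u *: w) by module_over S.
apply: submodD (submod_kin x sP) _ _; last exact: kin_smul.
by apply: kin_mono Uw' => y; apply/plusl/submod_smul.
Qed.
End RegularElement.

Fixpoint ktop (M : lmodType S) (y : seq S) (m : M) : koszul M y :=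
  match y return koszul M y with [::] => m | _ :: y' => (0, ktop y' m) end.

Lemma kdeg_ktop (M : lmodType S) y (m : M) : kdeg (size y) (ktop y m).
Proof. by elim: y => //= a y IH; split=> //; apply: submod0 (submod_kdeg _ _ _). Qed.

Lemma kin_ktop (M : lmodType S) y (m : M) U : kin U (ktop y m) -> U m.
Proof. by elim: y => //= a y IH [_ /IH]. Qed.

Lemma kin_ktopI (M : lmodType S) y (m : M) U : is_submod U -> U m -> kin U (ktop y m).
Proof.
move=> sU Um; elim: y => //= a y IH; split=> //; exact: submod0 (submod_kin _ sU).
Qed.

Lemma ktopZ (M : lmodType S) y a (m : M) : ktop y (a *: m) = a *: ktop y m.
Proof.
elim: y => //= b y ->.
have -> : a *: (0 : koszul M y, ktop y m) = (a *: 0, a *: ktop y m) by [].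
by rewrite scaler0.
Qed.

(* The top Koszul homology is the socle. *)
Lemma kvanish_socle (M : lmodType S) (U : M -> Prop) m :
  is_submod U -> saturated p U -> kvanish (size x) U ->
  (forall a, a \in x -> U (a *: m)) -> U m.
Proof.
move=> sU satU van Uxm; have [||t [w [pt dw]]] := van (ktop x m).
- exact: kdeg_ktop.
- elim: (x) Uxm => [|a y IH] Uym /=; first exact: submod0.
  have sK := submod_kin y sU.
  rewrite kd0 add0r -ktopZ; split; first by apply: kin_ktopI => //; apply/Uym/mem_head.
  by apply: submodN => //; apply: IH => b yb; apply: Uym; rewrite inE yb orbT.
rewrite (kdeg_gt_size (ltnSn _) dw) kd0 subr0 -ktopZ => /kin_ktop.
exact: saturatedZ satU pt.
Qed.

(** The working form of being finitely generated and projective. *)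
Definition dual_basis (M : lmodType S) : Prop :=
  exists n (y : 'I_n -> M) (phi : 'I_n -> {linear M -> S^o}),
    forall m, m = \sum_i (phi i m : S) *: y i.

Definition scale_by (M : lmodType S) (y : M) (a : S^o) : M := (a : S) *: y.
Lemma scale_by_is_linear (M : lmodType S) (y : M) : linear (scale_by y).
Proof. by move=> c a b; rewrite /scale_by scalerDl scalerA. Qed.
HB.instance Definition _ (M : lmodType S) (y : M) :=
  GRing.isLinear.Build S S^o M _ (scale_by y) (scale_by_is_linear y).

(** The identity of [M] is a finite sum of maps through the ring, so a cycle is a sum of images of
    cycles over the ring, and finitely many multipliers combine. *)
Lemma kvanish_dual_basis (M : lmodType S) i :
  kvanish i (fun a : S^o => a = 0) -> dual_basis M ->
  kvanish i (fun m : M => m = 0).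
Proof.
move=> van [n [y [phi yphi]]] z dz kz; have sZ := submod_zero M.
pose g j : {linear M -> M} := scale_by (y j) \o phi j.
have gz : z = \sum_j kmap (g j) z by apply: kmap_sum.
suff bnd (r : seq 'I_n) : exists t w, [/\ ~ p t, kdeg i.+1 w &
    t *: (\sum_(j <- r) kmap (g j) z) = kd w].
  have [t [w [pt dw tw]]] := bnd (index_enum 'I_n); exists t, w; split=> //.
  rewrite {1}gz tw subrr; exact: submod0 (submod_kin _ sZ).
elim: r => [|j r [t [w [pt dw tw]]]].
  exists 1, 0; split; first by case: pp.
    exact: submod0 (submod_kdeg _ _ _).
  by rewrite big_nil scaler0 kd0.
have [||u [w' [pu dw' uw']]] := van (kmap (phi j) z).
- exact: kmap_kdeg.
- rewrite -kmap_kd; apply/kin_eq0; rewrite (iffLR (kin_eq0 _) kz).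
  exact: kmap0.
exists (u * t), (t *: kmap (scale_by (y j)) w' + u *: w); split.
- exact: primeM.
- apply: submodD (submod_kdeg _ _ _) _ _; apply: submodZ (submod_kdeg _ _ _) _ => //.
  exact: kmap_kdeg.
have gj : kmap (g j) z = kmap (scale_by (y j)) (kmap (phi j) z).
  by elim: (x) (z) => [|a y' IH] v //=; rewrite !IH.
rewrite big_cons kdD !kdZ -kmap_kd -tw gj.
have -> : kd w' = u *: kmap (phi j) z by apply/esym/subr0_eq/kin_eq0.
by rewrite kmapZ; module_over S.
Qed.

(* [C] is the cokernel of an injection [nu : e N -> M] with image [U], for an
   idempotent [e] of the module [N]. *)
Lemma kvanish_coker (N M : lmodType S) (nu : {linear N -> M}) (e : {linear N -> N})
    (U : M -> Prop) i :
  is_submod U -> (forall n, U (nu n)) -> (forall m, U m -> exists n, nu n = m) ->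
  (forall n, nu (e n) = nu n) -> (forall n, nu n = 0 -> e n = 0) ->
  kvanish i (fun n : N => n = 0) -> kvanish i.+1 (fun m : M => m = 0) ->
  kvanish i.+1 (lsat p U).
Proof.
move=> sU nuU Unu nue nuI van vanS z dz /(kin_lsat _ pp sU)[s [ps Uz]].
have [||v [dv _ vE]] := kmap_lift (V := fun=> True) (g := nu) (i := i) I _ _ Uz.
- by move=> m /Unu[n <-]; exists n.
- by apply: submodZ (submod_kdeg _ _ _) _; apply: kdegS_kd.
have nuev : kmap nu (kmap e v) = s *: kd z.
  rewrite -vE; elim: (x) (v) => [|a y IH] w /=; [exact: nue | by rewrite !IH].
have [||t [w [pt dw tw]]] := van (kmap e v).
- exact: kmap_kdeg.
- rewrite -kmap_kd; apply/kin_kmap.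
  apply: (kin_mono (U := fun n => nu n = 0)) => //; apply/(kin_kmap nu (fun m => m = 0)).
  by apply/kin_eq0; rewrite kmap_kd vE kdZ kd_kd scaler0.
move/kin_eq0/subr0_eq in tw.
have [||u [w' [pu dw' uw']]] := vanS ((t * s) *: z - kmap nu w).
- apply: submodB (submod_kdeg _ _ _) _ _; first exact: submodZ (submod_kdeg _ _ _) _.
  exact: kmap_kdeg.
- apply/kin_eq0; rewrite kdB kdZ -kmap_kd -tw kmapZ nuev.
  by rewrite scalerA subrr.
exists (u * (t * s)), w'; split=> //; first by do 2!apply: primeM => //.
have -> : (u * (t * s)) *: z - kd w' = u *: kmap nu w.
  move/kin_eq0/subr0_eq in uw'; rewrite -uw'; module_over S.
apply/(kin_lsat _ pp sU)/lsatW => //; apply: submodZ (submod_kin _ sU) _.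
apply/kin_kmap; elim: (x) (w) => [|a y IH] v' //=.
Qed.

(* The long exact sequence for a submodule [K] of [Q]. *)
Lemma kvanish_sub (Q : lmodType S) (K : Q -> Prop) i :
  is_submod K -> kvanish i (fun q : Q => q = 0) -> kvanish i.+1 (lsat p K) ->
  forall z : koszul Q x, kdeg i z -> kin K z -> kd z = 0 ->
  exists t w, [/\ ~ p t, kdeg i.+1 w, kin K w & t *: z = kd w].
Proof.
move=> sK van vanS z dz Kz z0.
have [|t [w [pt dw /kin_eq0/subr0_eq tw]]] := van z dz; first exact/kin_eq0.
have [|s [w' [ps dw' /(kin_lsat _ pp sK)[u [pu Kw]]]]] := vanS w dw.
  rewrite -tw; apply/(kin_lsat _ pp sK)/lsatW => //.
  exact: submodZ (submod_kin _ sK) _.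
exists (u * s * t), (u *: (s *: w - kd w')); split=> //.
- by do 2!apply: primeM => //.
- apply: submodZ (submod_kdeg _ _ _) _; apply: submodB (submod_kdeg _ _ _) _ _.
    exact: submodZ (submod_kdeg _ _ _) _.
  exact: kdegS_kd.
- by rewrite kdZ kdB kd_kd kdZ subr0 -tw !scalerA.
Qed.
End KoszulVanishing.

(** * Regular sequences *)

Section RegularParameters.
Variables (S : comPzRingType) (p : set S) (x : seq S).
Hypotheses (noethS : noetherian S) (pp : is_prime p).
Hypothesis xp : forall a, a \in x -> p a.
Hypothesis px : forall a, p a -> lsat (M := S^o) p (span (M := S^o) x) a.

Lemma span_rcons (M : lmodType S) (s : seq M) g y :
  span (rcons s g) y <-> exists a, span s (y - a *: g).
Proof.
elim: s y => [|h s IH] y /=; first by split=> -[a ?]; exists a.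
split=> [[a /IH[b sy]]|[b [a sy]]].
  exists b, a; suff -> : y - b *: g - a *: h = y - a *: h - b *: g by [].
  by module_over S.
exists a; apply/IH; exists b.
suff -> : y - a *: h - b *: g = y - b *: g - a *: h by [].
by module_over S.
Qed.

Let U k : set S := lsat (M := S^o) p (span (M := S^o) (take k x)).

Let U_id k : is_submod (M := S^o) (U k).
Proof. exact/submod_lsat/submod_span. Qed.

Let US k : (k < size x)%N ->
  U k.+1 = lsat (M := S^o) p (plus (M := S^o) (U k) (smul (M := S^o) x`_k)).
Proof.
move=> lt_k; apply/predeqP => y; rewrite /U (take_nth 0 lt_k); split.
  apply: lsatS => z /span_rcons[a sz]; exists (z - a *: (x`_k : S^o)); split.
    exact: lsatW.
  by exists a; rewrite subKr /GRing.scale /= mulrC.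
move=> uy; apply: lsat_lsat => //; move: uy; apply: lsatS => z [w [[t [pt sw]] [b zw]]].
exists t; split=> //; apply/span_rcons; exists (t * b).
suff -> : t *: (z : S^o) - (t * b) *: (x`_k : S^o) = t *: (w : S^o) by [].
by rewrite -[z : S^o](subrK w) zw /GRing.scale /=; ring.
Qed.

(** Such a chain witnesses that killing [k] parameters lowers the dimension at [p] by at most
    [k]. *)
Definition ends_chain k (P : nat -> set S) : Prop :=
  [/\ prime_chain (size x - k) P, P (size x - k)%N = p &
      forall a, a \in take k x -> P 0%N a].

(** Once the second member contains the next parameter, dropping the bottom member trades one step
    of the chain for one more parameter. *)
Let ends_chainS k P : (k < size x)%N -> ends_chain k P ->
  exists Q, ends_chain k.+1 Q /\ (P 0%N `<` Q 0%N)%classic.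
Proof.
move=> lt_k [chP Ptop Pk]; rewrite -(subnSK lt_k) in chP Ptop.
have [|Q [[Qpr Qlt] Q0 Qtop Q1]] := chain_through (x := x`_k) noethS chP.
  by rewrite Ptop; apply/xp/mem_nth.
exists (fun i => Q i.+1); split; last by rewrite -Q0; apply: Qlt.
split; [split=> i le_i|by rewrite Qtop Ptop|].
- by apply: Qpr.
- by apply: Qlt.
- move=> a; rewrite (take_nth 0 lt_k) mem_rcons inE => /predU1P[->//|/Pk P0a].
  by have [+ _] := Qlt 0%N (ltn0Sn _); apply; rewrite Q0.
Qed.

(* Descending induction on [k]: by chain modification [P 0] lies below the ideal
   [U k.+1], so [P 0 = U k + x_k P 0] and Nakayama's lemma applies. *)
Let ends_chainE k P : (k <= size x)%N -> ends_chain k P -> P 0%N = U k.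
Proof.
move=> le_k chP; have subU : forall a, P 0%N a -> U k a; last first.
  apply/predeqP => a; split=> [/subU//|[t [pt st]]].
  case: chP => -[Ppr Plt] Ptop Pk; have P0 := Ppr 0%N (leq0n _).
  have P0t : ~ P 0%N t.
    move=> P0t; apply: pt; rewrite -Ptop.
    suff H : forall i, (i <= size x - k)%N -> P i t by apply: H.
    by elim=> // i IH lt_i; have [+ _] := Plt i lt_i; apply; apply: IH; apply: ltnW.
  apply: (prime_mul P0 _ P0t); apply: (span_sub (M := S^o) (s := take k x)) st => //.
  exact: prime_submod.
move: {2}(size x - k)%N (erefl (size x - k)%N) => m; elim: m k le_k P chP.
  move=> k le_k P [chP Ptop Pk] mk a; rewrite mk in Ptop; rewrite Ptop => /px.
  by rewrite /U take_oversize //; lia.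
move=> m IH k le_k P chP mk a; have lt_k : (k < size x)%N by lia.
have [Q [chQ [le_PQ nle_QP]]] := ends_chainS lt_k chP.
have QU y : Q 0%N y -> U k.+1 y by apply: IH => //; lia.
case: chP => -[Ppr Plt] Ptop Pk; have P0 := Ppr 0%N (leq0n _).
have Pp y : P 0%N y -> p y.
  move=> P0y; rewrite -Ptop.
  suff H : forall i, (i <= size x - k)%N -> P i y by apply: H.
  by elim=> // i IHi lt_i; have [+ _] := Plt i lt_i; apply; apply: IHi; apply: ltnW.
have spanP y : span (M := S^o) (take k x) y -> P 0%N y.
  exact: (span_sub (M := S^o) (prime_submod P0)).
(* Otherwise [P 0] would contain all the first [k.+1] parameters, hence [Q 0], against the strict
   inclusion. *)
have nP0x : ~ P 0%N x`_k.
  move=> P0x; apply: nle_QP => y /QU[t [pt]].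
  rewrite (take_nth 0 lt_k) => /span_rcons[b /spanP sy].
  apply: (prime_mul P0 (x := t)); last by move/Pp.
  rewrite -[t * y](subrK (b * x`_k)).
  by apply: (submodD (M := S^o) (prime_submod P0)) => //; apply: prime_mull.
apply: (nakayama (M := S^o) pp (submod_span _) (prime_submod P0)).
  exact/fg_ideal/prime_ideal.
move=> y P0y; have /QU[t [pt]] := le_PQ y P0y.
rewrite (take_nth 0 lt_k) => /span_rcons[b sy].
exists t; split=> //; exists (t *: (y : S^o) - b *: (x`_k : S^o)); split=> //.
rewrite subKr; have -> : b *: (x`_k : S^o) = x`_k *: (b : S^o) by apply: mulrC.
apply: imulZ; first exact/xp/mem_nth.
have P0bx : P 0%N (x`_k * b).
  have -> : x`_k * b = t * y - (t *: (y : S^o) - b *: (x`_k : S^o)).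
    by rewrite /GRing.scale /=; ring.
  apply: (submodB (M := S^o) (prime_submod P0)); last exact: spanP.
  exact: prime_mull.
exact: prime_mul P0bx nP0x.
Qed.

Let ends_chain_ex P k : ends_chain 0 P -> (k <= size x)%N -> exists Q, ends_chain k Q.
Proof.
move=> chP; elim: k => [|k IH] le_k; first by exists P.
have [Q chQ] := IH (ltnW le_k); have [Q' [chQ' _]] := ends_chainS le_k chQ.
by exists Q'.
Qed.

(** Each [U k] is prime, being the bottom of a chain, and does not contain the next parameter, since
    [U k] is strictly below [U k.+1]. So that parameter is regular modulo [U k], and vanishing
    descends from degrees above [size x], where it is trivial. *)
Lemma regular_parameters (P : nat -> set S) i :
  prime_chain (size x) P -> P (size x) = p ->
  kvanish p x i.+1 (lsat (M := S^o) p (fun a : S^o => a = 0)).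
Proof.
move=> chP Ptop.
have ch0 : ends_chain 0 P by split; rewrite ?subn0 ?take0.
suff van k : (k <= size x)%N -> forall j, (k < j)%N -> kvanish p x j (U k : S^o -> Prop).
  have <- : (U 0 : S^o -> Prop) = lsat (M := S^o) p (fun a : S^o => a = 0).
    by rewrite /U take0.
  exact: van.
move: {2}(size x - k)%N (erefl (size x - k)%N) => m; elim: m k => [|m IH] k mk le_k j lt_j.
  by apply: kvanish_gt => //; lia.
have lt_k : (k < size x)%N by lia.
have [Q chQ] := ends_chain_ex ch0 le_k; have QE := ends_chainE le_k chQ.
have [Q' [chQ' [_ nle]]] := ends_chainS lt_k chQ.
have QE' := ends_chainE lt_k chQ'.
have Upr : is_prime (U k) by rewrite -QE; case: chQ => -[Qpr _] _ _; apply: Qpr.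
apply: (@kvanish_regular S p x pp S^o (U k) x`_k (U_id k)).
- move=> y Uxy; apply: (prime_mul Upr Uxy) => Ux; apply: nle; rewrite QE QE' US // => y'.
  case=> t [pt [z [Uz [c zc]]]]; apply: saturated_lsat => //; exists t; split=> //.
  rewrite -[t *: _](subrK z) zc; apply: (submodD (M := S^o) (U_id k)) => //.
  exact: prime_mulr.
- by apply: px; apply/xp/mem_nth.
- by rewrite -US //; apply: IH; lia.
Qed.
End RegularParameters.

(** * Associated primes and prime avoidance *)

Section AssociatedPrimes.
Variables (S : comPzRingType) (noethS : noetherian S) (M : lmodType S).
Variables (U : M -> Prop).
Hypothesis sU : is_submod U.

Definition colon (q : set S) (m : M) : set S := fun a => lsat q U (a *: m).

Lemma colon_id q m : is_prime q -> is_ideal (colon q m).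
Proof.
move=> Q; have sL := submod_lsat Q sU; split; rewrite /colon.
- by rewrite scale0r; apply: submod0.
- by move=> a b ? ?; rewrite scalerDl; apply: submodD.
- by move=> a b ?; rewrite -scalerA; apply: submodZ.
Qed.

(** A maximal annihilator of a nonzero element is prime. The maximality clause is kept because it
    turns an inclusion of two such annihilators into an equality. *)
Lemma associated_prime q m0 : is_prime q -> ~ lsat q U m0 ->
  exists m, [/\ is_prime (colon q m), ~ lsat q U m,
                forall a, colon q m0 a -> colon q m a &
                forall m', ~ lsat q U m' -> (forall a, colon q m a -> colon q m' a) ->
                           forall a, colon q m' a -> colon q m a].
Proof.
move=> Q nm0; have sL := submod_lsat Q sU.
pose F (I : set S) := exists m, [/\ I = colon q m, ~ lsat q U m &
                                    forall a, colon q m0 a -> I a].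
have [||_ [[m [-> nm m0m]] mmax]] := @noeth_max S noethS F.
- by move=> _ [m [-> _ _]]; apply: colon_id.
- by exists (colon q m0), m0.
have {}mmax m' : ~ lsat q U m' -> (forall a, colon q m a -> colon q m' a) ->
    forall a, colon q m' a -> colon q m a.
  move=> nm' mm'; apply: mmax => //; exists m'; split=> // a /m0m; exact: mm'.
exists m; split=> //; split; first exact: colon_id.
  by rewrite /colon scale1r.
move=> a b cab; have [ca|nca] := pselect (colon q m a); [by left|right].
apply: (mmax (a *: m)) => // [c cm|]; last by rewrite /colon scalerA mulrC.
by rewrite /colon scalerA mulrC -scalerA; apply: submodZ.
Qed.
End AssociatedPrimes.

Section PrimeAvoidance.
Variables (S : comPzRingType) (T : eqType) (c : T -> set S) (I : set S).
Hypothesis Iid : is_ideal I.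

Lemma prime_avoidance (s : seq T) : (forall g, g \in s -> is_prime (c g)) ->
  (forall g, g \in s -> exists a, I a /\ ~ c g a) ->
  exists a, I a /\ forall g, g \in s -> ~ c g a.
Proof.
have [n] := ubnP (size s); elim: n s => // n IH [|g s] /=.
  by move=> _ _ _; exists 0; split=> //; case: Iid.
rewrite ltnS => le_n cpr Iav.
have cg := cpr g (mem_head _ _); have [i [Ii ngi]] := Iav g (mem_head _ _).
have [[h [sh hg]]|noh] := pselect (exists h, h \in s /\ forall a, c h a -> c g a).
  have sub h' : h' \in g :: rem h s -> h' \in g :: s.
    by rewrite !inE => /predU1P[->|/mem_rem ->]; rewrite ?eqxx ?orbT.
  have [||| a [Ia av]] := IH (g :: rem h s).
  - by rewrite /= size_rem //; case: (s) sh le_n => //= ? ? _; lia.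
  - by move=> h' /sub; apply: cpr.
  - by move=> h' /sub; apply: Iav.
  exists a; split=> // h'; rewrite inE; have [-> _|nh] := eqVneq h' g.
    exact/av/mem_head.
  have [->|nhh] := eqVneq h' h; first by move=> _ /hg; apply/av/mem_head.
  move=> /= sh'; apply: av; rewrite inE; apply/orP; right.
  exact: rem_mem.
have [||| a [Ia av]] := IH s => //.
- by move=> h sh; apply: cpr; rewrite inE sh orbT.
- by move=> h sh; apply: Iav; rewrite inE sh orbT.
have [cga|] := pselect (c g a); last first.
  by exists a; split=> // h; rewrite inE => /predU1P[->//|]; apply: av.
(* [b] is the product of [i] with one element of each [c h] outside [c g]; it stays outside because
   [c g] is prime. *)
have [b [Ib ngb bs]] : exists b, [/\ I b, ~ c g b & forall h, h \in s -> c h b].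
  have {av IH le_n Iav} cs : forall h, h \in s -> is_prime (c h).
    by move=> h sh; apply: cpr; rewrite inE sh orbT.
  elim: s noh cs {cpr} => [|h s IHs] noh cs; first by exists i.
  have [||b [Ib ngb bs]] := IHs.
  - by move=> [h' [sh' hg]]; apply: noh; exists h'; rewrite inE sh' orbT.
  - by move=> h' sh'; apply: cs; rewrite inE sh' orbT.
  have [e [che nge]] : exists e, c h e /\ ~ c g e.
    apply: contrapT => noe; apply: noh; exists h; rewrite mem_head; split=> // e che.
    by apply: contrapT => nge; apply: noe; exists e.
  exists (e * b); split.
  - by case: Iid => _ _; apply.
  - by move/(prime_mul cg)/(_ nge).
  - move=> h'; rewrite inE => /predU1P[->|sh'].
      by apply: prime_mulr => //; apply/cs/mem_head.
    by apply: prime_mull (bs _ sh'); apply: cs; rewrite inE sh' orbT.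
exists (a + b); split; first by case: Iid => _ ID _; apply: ID.
move=> h; rewrite inE => /predU1P[->|sh] cab.
  apply: ngb; rewrite -(addrK a b) [b + a]addrC.
  exact: (submodB (M := S^o) (prime_submod cg)).
apply: (av h sh); rewrite -(addrK b a).
apply: (submodB (M := S^o)) (bs h sh) => //.
by apply: prime_submod; apply: cpr; rewrite inE sh orbT.
Qed.
End PrimeAvoidance.

(** * Depth at a prime and Koszul homology *)

Section LocalDepth.
Variables (S : comPzRingType) (noethS : noetherian S) (p : set S).
Hypothesis pp : is_prime p.
Variable M : lmodType S.
Implicit Types (U : M -> Prop).

(* Regularity at [p] of a sequence on the module [M / U]. *)
Fixpoint lregular U (a : seq S) : Prop :=
  if a is b :: a' then
    (forall y, U (b *: y) -> U y) /\ lregular (lsat p (plus U (smul b))) a'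
  else exists y, ~ U y.

Lemma submod_quo U b : is_submod U -> is_submod (lsat p (plus U (smul b))).
Proof. by move=> sU; apply/submod_lsat/submod_plus/submod_smul. Qed.

Lemma imul_setT (T : M -> Prop) m : imul (fun=> True) T m ->
  exists s, (forall g, g \in s -> T g) /\ span s m.
Proof.
elim=> {m} [|a w z _ Tw _ [s [sT sz]]]; first by exists [::].
exists (w :: s); split; first by move=> g; rewrite inE => /predU1P[->|/sT].
by exists a; rewrite addrC addKr.
Qed.

(** Zero divisors on [M / U] lie in maximal annihilators of nonzero elements. Up to inclusion
    finitely many of these matter, and none contains [p] since there is no socle; prime avoidance
    gives a regular element of [p]. *)
Lemma exists_regular U (s : seq M) : is_submod U -> saturated p U ->
  (forall m, span s m) ->
  (forall m, (forall a, p a -> U (a *: m)) -> U m) ->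
  exists b, p b /\ forall y, U (b *: y) -> U y.
Proof.
move=> sU satU sM nosoc; have satE m : lsat p U m -> U m by apply: satU.
pose maxann m := [/\ is_prime (colon U p m), ~ U m &
  forall m', ~ U m' -> (forall a, colon U p m a -> colon U p m' a) ->
             forall a, colon U p m' a -> colon U p m a].
have zero_div b : ~ (forall y, U (b *: y) -> U y) -> exists m, maxann m /\ colon U p m b.
  move=> /existsNP[y /not_implyP[Uby nUy]].
  have [|m [mpr nm ym mmax]] := associated_prime noethS sU pp (m0 := y).
    by move/satE.
  exists m; split; last by apply: ym; apply: lsatW.
  split=> //; first by move=> Um; apply: nm; apply: lsatW.
  by move=> m' nm'; apply: mmax => /satE.
(* The elements with a maximal annihilator generate a finitely generated submodule, and its
   generators can be taken among them. *)
have [t [tmax tspan]] : exists t, (forall g, g \in t -> maxann g) /\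
    forall m, maxann m -> span t m.
  pose W := imul (fun=> True) (fun m => maxann m).
  have sW : is_submod W.
    split; [exact: imul0 | exact: imulD |].
    move=> b m; elim=> {m} [|a w z _ Tw _ IH]; first by rewrite scaler0; apply: imul0.
    by rewrite scalerDr scalerA; apply: imulZD.
  have [r [rW Wr]] := fg_submodule noethS sW (fun m _ => sM m).
  have [t [tmax rt]] : exists t, (forall g, g \in t -> maxann g) /\
      forall h, h \in r -> span t h.
    elim: r rW {Wr} => [|h r IH] rW; first by exists [::].
    have [t [tmax rt]] := IH (fun g rg => rW g (mem_behead (s := h :: r) rg)).
    have [t' [t'max ht']] := imul_setT (rW h (mem_head _ _)).
    exists (t' ++ t); split; first by move=> g; rewrite mem_cat => /orP[/t'max|/tmax].
    move=> g; rewrite inE => /predU1P[->|/rt]; [exact: span_catl | exact: span_catr].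
  exists t; split=> // m mm; apply: (span_sub (submod_span t) rt); apply: Wr.
  by rewrite -[m]scale1r; apply: imulZ.
apply: contrapT => noreg.
have [||a [pa av]] := @prime_avoidance S M (colon U p) p (prime_ideal pp) t.
- by move=> g /tmax[].
- move=> g /tmax[gpr nUg _]; apply: contrapT => nog; apply: nUg; apply: nosoc => a pa.
  by apply: satE; apply: contrapT => nga; apply: nog; exists a.
have [m [mmax ma]] : exists m, maxann m /\ colon U p m a.
  by apply: zero_div => reg; apply: noreg; exists a.
(* As [m] lies in the span of [t], its annihilator contains the intersection of those of [t]; being
   prime, it contains one of them. *)
have [g [tg gm]] : exists g, g \in t /\ forall b, colon U p g b -> colon U p m b.
  have [mpr _ _] := mmax.
  have : forall b, (forall g, g \in t -> colon U p g b) -> colon U p m b.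
    move=> b tb.
    apply: (span_sub (s := t) (U := fun m => lsat p U (b *: m))) => //.
      have sL := submod_lsat pp sU; split=> [|y z Uy Uz|c y Uy].
      - by rewrite scaler0; apply: submod0.
      - by rewrite scalerDr; apply: submodD.
      - by rewrite scalerA mulrC -scalerA; apply: submodZ.
    exact: tspan.
  move=> tm; apply: contrapT => nog; move: tm.
  have tid g : is_ideal (colon U p g) := colon_id sU g pp.
  elim: (t) nog => [|g r IH] nog tm.
    have [_ m1 _] := mpr; apply: m1; exact: tm.
  apply: IH => [[h [rh hm]]|b rb].
    by apply: nog; exists h; rewrite inE rh orbT.
  have [e [ge nme]] : exists e, colon U p g e /\ ~ colon U p m e.
    apply: contrapT => noe; apply: nog; exists g; rewrite mem_head; split=> // e ge.
    by apply: contrapT => nme; apply: noe; exists e.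
  apply: (prime_mul mpr _ nme); apply: tm => h; rewrite inE => /predU1P[->|/rb hb].
    by rewrite mulrC; case: (tid g) => _ _; apply.
  by case: (tid h) => _ _; apply.
have [gpr nUg gmax] := tmax g tg.
by apply: (av g tg); apply: (gmax m) => //; case: mmax.
Qed.

Variable x : seq S.
Hypothesis xp : forall a, a \in x -> p a.
Hypothesis px : forall a, p a -> lsat (M := S^o) p (span (M := S^o) x) a.

(** Each regular element lowers by one the first degree of vanishing, starting from the degrees
    above [size x]. *)
Lemma kvanish_lregular U (a : seq S) i : is_submod U ->
  (forall b, b \in a -> p b) -> lregular U a -> (size x < i + size a)%N ->
  kvanish p x i U.
Proof.
elim: a U i => [|b a IH] U i sU ap /=.
  by rewrite addn0 => _ lt_i; apply: kvanish_gt.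
move=> [reg rega] lt_i; apply: (kvanish_regular pp sU reg).
  exact/px/ap/mem_head.
apply: IH => //; [exact: submod_quo | | lia].
by move=> c ac; apply: ap; rewrite inE ac orbT.
Qed.

(** Vanishing in the top degree excludes a socle, hence gives a regular element of [p]. Dividing by
    it costs one degree of vanishing and, by Nakayama, leaves a nonzero module. *)
Lemma exists_lregular U (s : seq M) n : (forall m, span s m) ->
  is_submod U -> saturated p U -> (exists y, ~ U y) -> (n <= size x)%N ->
  (forall i, (size x < i + n)%N -> kvanish p x i U) ->
  exists a, [/\ size a = n, forall b, b \in a -> p b & lregular U a].
Proof.
move=> sM; elim: n U => [|n IH] U sU satU [y nUy] le_n van.
  by exists [::]; split=> //; exists y.
have [b [pb reg]] : exists b, p b /\ forall y, U (b *: y) -> U y.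
  apply: (exists_regular sU satU sM) => m pm.
  apply: (kvanish_socle sU satU (van (size x) _)); first by lia.
  by move=> a /xp; apply: pm.
have [|||||a [sa ap rega]] := IH (lsat p (plus U (smul b))).
- exact: submod_quo.
- exact: saturated_lsat.
- apply: contrapT => noy; apply: nUy; apply: satU.
  apply: (nakayama pp sU (submod_setT M)) => //; first by exists s.
  move=> z _; have [t [pt [w [Uw [v wv]]]]] : lsat p (plus U (smul b)) z.
    by apply: contrapT => nz; apply: noy; exists z.
  by exists t; split=> //; exists w; split=> //; rewrite wv; apply: imulZ.
- exact: ltnW.
- move=> [|i] lt_i; first lia.
  by apply: (kvanish_quotient pp sU reg); apply: van; lia.
exists (b :: a); split=> //=; first by rewrite sa.
by move=> c; rewrite inE => /predU1P[->|/ap].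
Qed.

(** The reason that depth is at most dimension. The bottom prime of the chain for the quotient by
    [b] contains [b]; an associated prime of [M / U] inside it cannot, [b] being regular, and so
    prolongs the chain downwards. *)
Lemma lregular_chain U (a : seq S) : is_submod U -> saturated p U ->
  (forall b, b \in a -> p b) -> lregular U a ->
  exists P, [/\ prime_chain (size a) P, forall b, P (size a) b -> p b,
     exists m, forall t, ~ P 0%N t -> ~ U (t *: m) &
     forall b, (forall m, U (b *: m)) -> P 0%N b].
Proof.
have ass q U' m0 : is_submod U' -> is_prime q -> (forall t, ~ q t -> ~ U' (t *: m0)) ->
    exists P, [/\ is_prime P, forall b, P b -> q b,
      exists m, forall t, ~ P t -> ~ U' (t *: m),
      forall b, (forall m, U' (b *: m)) -> P b &
      forall b, (forall y, U' (b *: y) -> U' y) -> ~ P b].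
  move=> sU' Q qm0; have [|m [mpr nm _ _]] := associated_prime noethS sU' Q (m0 := m0).
    by move=> [t [qt Ut]]; apply: (qm0 t).
  exists (colon U' q m); split=> //.
  - move=> b [t [qt Ubm]]; apply: contrapT => qb; apply: nm; exists (t * b).
    by split; [exact: primeM | rewrite -scalerA].
  - by exists m => t Pt Utm; apply: Pt; apply: lsatW.
  - by move=> b Ub; apply: lsatW.
  - move=> b reg [t [qt Utb]]; apply: nm; exists t; split=> //; apply: reg.
    by rewrite scalerA mulrC -scalerA.
elim: a U => [|b a IH] U sU satU ap /=.
  move=> [y nUy]; have [|P [Ppr Pp Pm Pa _]] := ass p U y sU pp.
    by move=> t pt Ut; apply: nUy; apply: saturatedZ satU pt Ut.
  by exists (fun=> P); split=> //; split=> // i; rewrite ltn0.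
move=> [reg rega]; have [|||P [[Ppr Plt] Ptop [m Pm] Pa]] := IH _ _ _ _ rega.
- exact: submod_quo.
- exact: saturated_lsat.
- by move=> c ac; apply: ap; rewrite inE ac orbT.
have UU y : U y -> lsat p (plus U (smul b)) y.
  by move=> Uy; apply: lsatW => //; apply: plusl => //; apply: submod_smul.
have [|Q [Qpr QP Qm Qa Qb]] := ass (P 0%N) U m sU (Ppr 0%N (leq0n _)).
  by move=> t Pt /UU; apply: Pm.
have Pb : P 0%N b.
  apply: Pa => y; apply: lsatW => //; apply: plusr => //; by exists y.
exists (fun i => if i is i'.+1 then P i' else Q); split=> //.
split=> [[|i]|[|i]] //; first by apply: Ppr.
  by move=> _; split=> // PQ; apply: (Qb b reg); apply: PQ.
exact: Plt.
Qed.
End LocalDepth.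

Local Notation frac := Defs.frac.

(** * Localizations *)

Section LocalizationTheory.
Variables (S : comPzRingType) (P : primeIdeal S).

Lemma denom_ex (t : S) : ~ prime_set P t -> exists t' : denom P, val t' = t.
Proof. by move=> Pt; exists (mkdenom Pt). Qed.

Lemma frac_eq0 (N : lmodType S) (y : N) (t : denom P) :
  frac y t = 0 <-> exists u : denom P, val u *: y = 0.
Proof.
split=> [/fracP[u]|[u uy]].
  by rewrite scaler0 subr0 scale1r => uy; exists u.
by apply/fracP; exists u; rewrite scaler0 subr0 scale1r.
Qed.

Lemma fracN (N : lmodType S) (y : N) (t : denom P) : - frac y t = frac (- y) t.
Proof. exact: loc_oppE. Qed.

Lemma frac_add (N : lmodType S) (y z : N) (s t : denom P) :
  frac y s + frac z t = frac (val t *: y + val s *: z) (denomM s t).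
Proof. exact: loc_addE. Qed.

Lemma frac_scale (N : lmodType S) (a : S) (y : N) (s t : denom P) :
  (frac (a : S^o) s : loc_ring P) *: frac y t = frac (a *: y) (denomM s t).
Proof. exact: loc_actE. Qed.

Lemma frac_mul (a b : S) (s t : denom P) :
  (frac (a : S^o) s : loc_ring P) * (frac (b : S^o) t : loc_ring P)
  = (frac (a * b : S^o) (denomM s t) : loc_ring P).
Proof. exact: (loc_actE a s (b : S^o) t). Qed.

Lemma frac_one : (1 : loc_ring P) = frac (1 : S^o) (denom1 P).
Proof. by []. Qed.

Lemma frac_unit (t : denom P) (s : denom P) :
  (frac (val s : S^o) t : loc_ring P) * (frac (val t : S^o) s : loc_ring P) = 1.
Proof.
rewrite frac_mul frac_one; apply/fracP; exists (denom1 P).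
rewrite /= !scale1r; apply/eqP; rewrite subr_eq0; apply/eqP.
by rewrite /GRing.scale /= mulr1 mulrC.
Qed.

Definition loc_max : set (loc_ring P) :=
  fun X => exists (a : S) (t : denom P), X = frac (a : S^o) t /\ prime_set P a.

Lemma frac_loc_max (a : S) (t : denom P) :
  loc_max (frac (a : S^o) t) <-> prime_set P a.
Proof.
have Ppr := prime_setP P.
split=> [[b [s [/fracP[u ub] Pb]]]|Pa]; last by exists a, t.
apply: contrapT => Pa; apply: (primeM Ppr (primeM Ppr (@denomP _ _ u) (@denomP _ _ s)) Pa).
have -> : val u * val s * a = val u * (val t * b).
  apply/eqP; rewrite -subr_eq0 -mulrA -mulrBr; apply/eqP; exact: ub.
by apply: prime_mull => //; apply: prime_mull.
Qed.

Lemma local_loc_ring : local_ring loc_max.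
Proof.
have Ppr := prime_setP P; have Psub := prime_submod Ppr.
have ideal : is_ideal loc_max.
  split.
  - by exists 0, (denom1 P); split=> //; case: Psub.
  - elim/frac_ind=> a s; elim/frac_ind=> b t /frac_loc_max Pa /frac_loc_max Pb.
    rewrite (frac_add (N := S^o)); apply/frac_loc_max.
    by apply: (submodD Psub); apply: prime_mull.
  - elim/frac_ind=> a s; elim/frac_ind=> b t /frac_loc_max Pb.
    by rewrite frac_mul; apply/frac_loc_max; apply: prime_mull.
have proper : ~ loc_max 1.
  by rewrite frac_one => /frac_loc_max; case: Ppr.
have sub (J : set (loc_ring P)) : is_ideal J -> ~ J 1 -> (J `<=` loc_max)%classic.
  move=> [_ _ JM] J1; elim/frac_ind=> a s Ja; apply/frac_loc_max.
  apply: contrapT => /denom_ex[t tE]; apply: J1.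
  by rewrite -(frac_unit t s) tE; apply: JM.
split; first by split=> // J Jid J1 maxJ; apply/seteqP; split=> //; apply: sub.
by move=> m [mid m1 mmax]; apply/esym/mmax => //; apply: sub.
Qed.

Lemma local_ring_unique (m : set (loc_ring P)) : local_ring m -> m = loc_max.
Proof. by case=> _ muniq; apply/esym/muniq; case: local_loc_ring. Qed.

Lemma frac_sum (N : lmodType S) n (c : 'I_n -> N) (t : denom P) :
  \sum_i frac (c i) t = frac (\sum_i c i) t.
Proof.
apply: (big_rec2 (fun y z => y = frac z t)).
  by apply/esym/frac_eq0; exists (denom1 P); rewrite scaler0.
by move=> i y z _ ->; rewrite fracD.
Qed.

Lemma loc_common n (X : 'I_n -> loc_ring P) :
  exists (c : 'I_n -> S) (t : denom P), forall i, X i = frac (c i : S^o) t.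
Proof.
elim: n X => [|n IH] X; first by exists (fun=> 0), (denom1 P) => -[].
have [c [t cE]] := IH (fun i => X (lift ord0 i)).
have [a [s XE]] : exists (a : S) s, X ord0 = frac (a : S^o) s.
  by elim/frac_ind: (X ord0) => a s; exists a, s.
exists (fun i => if unlift ord0 i is Some j then val s * c j else val t * a), (denomM s t).
move=> i; case: unliftP => [j ->|->].
  by rewrite cE; apply/esym; exact: (frac_expand (c j : S^o) t s).
rewrite XE -(frac_expand (a : S^o) s t); congr (frac _ _).
by apply: val_inj; rewrite /= mulrC.
Qed.

Lemma loc_max_generators d (g : 'I_d -> loc_ring P) : generated_by loc_max g ->
  exists x : seq S, [/\ size x = d, forall a, a \in x -> prime_set P a &
    forall a, prime_set P a -> lsat (M := S^o) (prime_set P) (span (M := S^o) x) a].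
Proof.
move=> gen; have [x [t xE]] := loc_common g.
exists [seq x i | i <- enum 'I_d]; split.
- by rewrite size_map size_enum_ord.
- move=> _ /mapP[i _ ->]; apply/(frac_loc_max _ t); rewrite -xE; apply/gen.
  exists (fun j => if j == i then 1 else 0); rewrite (bigD1 i) //= eqxx mul1r.
  by rewrite big1 ?addr0 // => j /negPf ->; rewrite mul0r.
- move=> a /(frac_loc_max a (denom1 P))/gen[c]; have [b [s bE]] := loc_common c.
  under eq_bigr => i _ do rewrite bE xE frac_mul.
  rewrite (frac_sum (N := S^o)) => /fracP[u /= ua].
  exists (val u * (val s * val t)); split.
    have Ppr := prime_setP P.
    exact: (primeM Ppr (@denomP _ _ u) (primeM Ppr (@denomP _ _ s) (@denomP _ _ t))).
  apply/(spanP (M := S^o)); exists (fun i => val u * b i).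
  have -> : (val u * (val s * val t)) *: (a : S^o) = val u * (val s * val t * a).
    by rewrite /GRing.scale /= !mulrA.
  have := ua; rewrite scale1r scalerBr => /subr0_eq.
  rewrite {1 2}/GRing.scale /= => ->.
  rewrite {1}/GRing.scale /= mulr_sumr; apply: eq_bigr => i _.
  by rewrite /GRing.scale /= mulrA.
Qed.
End LocalizationTheory.

Lemma chain_le (S : comPzRingType) n (P : nat -> set S) i j b :
  prime_chain n P -> (i <= j)%N -> (j <= n)%N -> P i b -> P j b.
Proof.
case=> _ Plt; elim: j => [|j IH]; first by rewrite leqn0 => /eqP->.
rewrite leq_eqVlt => /predU1P[->//|lt_i] lt_j Pb.
by have [+ _] := Plt j lt_j; apply; apply: IH => //; apply: ltnW.
Qed.

(** * Localizations of a quotient ring and of its modules, read over the base ring *)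

Section LocalizationTransfer.
Variables (R S : comPzRingType) (rho : {rmorphism R -> S}) (P : primeIdeal S).
Hypothesis rho_surj : forall s, exists r, rho r = s.

Definition contr (q : set S) : set R := fun r => q (rho r).
Local Notation p := (contr (prime_set P)).

Lemma contr_prime (q : set S) : is_prime q -> is_prime (contr q).
Proof.
case=> -[q0 qD qM] q1 qpr; split; rewrite /contr ?rmorph1 //; last first.
  by move=> x y; rewrite rmorphM; apply: qpr.
split; first by rewrite rmorph0.
- by move=> x y ? ?; rewrite rmorphD; apply: qD.
- by move=> a x ?; rewrite rmorphM; apply: qM.
Qed.

Let pp : is_prime p := contr_prime (prime_setP P).

Lemma lift_denom (t : denom P) : exists r, rho r = val t /\ ~ p r.
Proof.
by have [r rt] := rho_surj (val t); exists r; rewrite /contr rt; split=> //; apply: denomP.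
Qed.

Lemma denom_of r : ~ p r -> exists t : denom P, val t = rho r.
Proof. exact: denom_ex. Qed.

Lemma loc_chainE n (Q : nat -> set (loc_ring P)) : prime_chain n Q ->
  exists P', [/\ prime_chain n P', forall b, rho b = 0 -> P' 0%N b &
                 forall b, P' n b -> p b].
Proof.
case=> Qpr Qlt; pose fr r : loc_ring P := frac (rho r : S^o) (denom1 P).
have frM x y : fr (x * y) = fr x * fr y.
  rewrite /fr frac_mul rmorphM; apply/fracP; exists (denom1 P).
  by rewrite /= mulr1 subrr scaler0.
have frD x y : fr (x + y) = fr x + fr y by rewrite /fr rmorphD fracD.
have fr0 x : rho x = 0 -> fr x = 0.
  by rewrite /fr => ->; apply/frac_eq0; exists (denom1 P); rewrite scaler0.
have fr1 : fr 1 = 1 by rewrite /fr rmorph1 frac_one.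
exists (fun i r => Q i (fr r)); split.
- split=> i le_i.
    case: (Qpr i le_i) => -[q0 qD qM] q1 qpr; split; rewrite ?fr1 //; last first.
      by move=> x y; rewrite frM; apply: qpr.
    split; first by rewrite fr0 ?rmorph0.
    + by move=> x y ? ?; rewrite frD; apply: qD.
    + by move=> a x ?; rewrite frM; apply: qM.
  have [le_Q nle_Q] := Qlt i le_i; split; first by move=> x; apply: le_Q.
  move=> sub; apply: nle_Q; elim/frac_ind=> a t Qa.
  have [r rE] := rho_surj a.
  have fE : frac (a : S^o) t = (frac (1 : S^o) t : loc_ring P) * fr r.
    rewrite /fr frac_mul rE; apply/fracP; exists (denom1 P).
    by rewrite /= mul1r mulr1 subrr scaler0.
  rewrite fE; case: (Qpr i (ltnW le_i)) => -[_ _ qM] _ _; apply: (qM); apply: sub.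
  have -> : fr r = (frac (val t : S^o) (denom1 P) : loc_ring P) * frac (a : S^o) t.
    rewrite fE mulrA frac_mul /fr frac_mul; apply/fracP; exists (denom1 P).
    rewrite /= /GRing.scale /=; ring.
  by case: (Qpr i.+1 le_i) => -[_ _ qM'] _ _; apply: qM'.
- by move=> b /fr0 ->; case: (Qpr 0%N (leq0n _)) => -[].
- move=> b Qb; apply: contrapT => /denom_of[t tE].
  case: (Qpr n (leqnn _)) => -[_ _ qM] q1 _; apply: q1.
  by rewrite -(frac_unit t (denom1 P)); apply: (qM); rewrite tE.
Qed.

Lemma frac_rho_eq a b (s t : denom P) (q : set R) : is_prime q ->
  (forall r, rho r = 0 -> q r) -> (forall r, q r -> p r) ->
  frac (rho a : S^o) s = frac (rho b : S^o) t -> q a -> q b.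
Proof.
move=> Q qker qp /fracP[u uab] qa; have [u0 [uE pu]] := lift_denom u.
have [s0 [sE ps]] := lift_denom s; have [t0 [tE pt]] := lift_denom t.
have qid := prime_submod Q.
apply: (prime_mul Q (x := u0 * s0)); last by move/qp/(primeM pp pu).
have -> : u0 * s0 * b = (u0 * t0) * a - u0 * (t0 * a - s0 * b) by ring.
apply: (submodB (M := R^o) qid); first exact: prime_mull.
by apply: qker; rewrite rmorphM rmorphB !rmorphM uE sE tE.
Qed.

Lemma chain_loc n (P' : nat -> set R) : prime_chain n P' ->
  (forall b, rho b = 0 -> P' 0%N b) -> (forall b, P' n b -> p b) ->
  exists Q : nat -> set (loc_ring P), prime_chain n Q.
Proof.
move=> chP ker0 top; have [Ppr Plt] := chP.
have keri i : (i <= n)%N -> forall b, rho b = 0 -> P' i b.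
  by move=> le_i b /ker0; apply: (chain_le chP).
have lep i : (i <= n)%N -> forall b, P' i b -> p b.
  by move=> le_i b Pb; apply/top/(chain_le chP le_i).
pose Q i : set (loc_ring P) :=
  fun X => exists b t, X = frac (rho b : S^o) t /\ P' i b.
have QP i b t : (i <= n)%N -> Q i (frac (rho b : S^o) t) -> P' i b.
  move=> le_i [c [s [fE Pc]]].
  exact: (frac_rho_eq (Ppr i le_i) (keri i le_i) (lep i le_i) (esym fE) Pc).
have rep (X : loc_ring P) : exists b t, X = frac (rho b : S^o) t.
  by elim/frac_ind: X => a t; have [b <-] := rho_surj a; exists b, t.
exists Q; split=> i le_i.
  have Pi := Ppr i le_i; have Psub := prime_submod Pi; split; last first.
  - move=> X Y; have [a [s ->]] := rep X; have [b [t ->]] := rep Y.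
    rewrite frac_mul -rmorphM => /(QP i _ _ le_i); case: (Pi) => _ _ PM /PM.
    by case=> ?; [left; exists a, s | right; exists b, t].
  - rewrite frac_one -(rmorph1 rho) => /(QP i _ _ le_i).
    by case: (Pi).
  split.
  - exists 0, (denom1 P); split; last by case: Psub.
    by apply/esym/frac_eq0; exists (denom1 P); rewrite rmorph0 scaler0.
  - move=> _ _ [a [s [-> Pa]]] [b [t [-> Pb]]].
    have [s0 [sE _]] := lift_denom s; have [t0 [tE _]] := lift_denom t.
    exists (t0 * a + s0 * b), (denomM s t); split.
      by rewrite (frac_add (N := S^o)) rmorphD !rmorphM sE tE.
    by apply: (submodD (M := R^o) Psub); apply: prime_mull.
  - move=> X _ [b [t [-> Pb]]]; have [a [s ->]] := rep X.
    exists (a * b), (denomM s t); rewrite frac_mul rmorphM; split=> //.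
    exact: prime_mull.
have [le_P nle_P] := Plt i le_i; split; first by move=> _ [b [t [-> /le_P Pb]]]; exists b, t.
move=> sub; apply: nle_P => b Pb.
by apply: (QP i b (denom1 P) (ltnW le_i)); apply: sub; exists b, (denom1 P).
Qed.

(** For [q] the contraction of [P], these are the chains of primes of the localization of [S] at
    [P], pulled back to [R]. *)
Definition chains_to (q : set R) n : Prop := exists P', [/\ prime_chain n P',
  forall b, rho b = 0 -> P' 0%N b & forall b, P' n b -> q b].

Lemma krull_dim_loc d : krull_dim (loc_ring P) d <->
  chains_to p d /\ forall n, chains_to p n -> (n <= d)%N.
Proof.
split=> [[[Q /loc_chainE[P' chP]] bnd]|[[P' [chP ker top]] bnd]].
  split; first by exists P'.
  by move=> n [P'' [ch ker top]]; have [Q' /bnd] := chain_loc ch ker top.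
split; first exact: chain_loc chP ker top.
by move=> n Q /loc_chainE[P'' ch]; apply: bnd; exists P''.
Qed.

Section Modules.
Variables (M : lmodType R) (N : lmodType S) (pi : {linear M -> (restr rho N : lmodType R)}).
Hypothesis pi_surj : forall y, exists m, pi m = y.

Let U : M -> Prop := lsat p (fun m => pi m = 0).

Let sker : is_submod (fun m => pi m = 0).
Proof.
split=> [|m m' mE m'E|a m mE]; first exact: linear0.
  by rewrite linearD mE m'E addr0.
by rewrite linearZ_LR mE scaler0.
Qed.

Lemma pi_scale a m : (pi (a *: m) : N) = rho a *: (pi m : N).
Proof. exact: linearZ_LR. Qed.

Lemma frac_pi_eq0 m (t : denom P) : frac (pi m : N) t = 0 <-> U m.
Proof.
rewrite frac_eq0; split=> [[u um]|[u0 [/denom_of[u uE] um]]].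
  have [u0 [uE pu]] := lift_denom u; exists u0; split=> //.
  by rewrite pi_scale uE.
by exists u; rewrite uE -pi_scale.
Qed.

Lemma loc_mod_eq0 : (forall X : loc_mod P N, X = 0) <-> forall m, U m.
Proof.
split=> [N0 m|UM]; first exact/(frac_pi_eq0 m (denom1 P)).
elim/frac_ind=> y t; have [m mE] := pi_surj y.
by have /(frac_pi_eq0 m t) := UM m; rewrite mE.
Qed.

Lemma seq_submod_cons (A : comPzRingType) (L : lmodType A) c (s : seq A) (X : L) :
  seq_submod (c :: s) X <-> exists Y, seq_submod s (X - c *: Y).
Proof.
split=> [[y XE]|[Y [y XE]]].
  exists (y ord0), (fun i => y (lift ord0 i)).
  by rewrite XE big_ord_recl /= addrC addKr.
exists (fun i => if unlift ord0 i is Some j then y j else Y).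
rewrite big_ord_recl unlift_none /= -[LHS](subrK (c *: Y)) XE addrC; congr (_ + _).
by apply: eq_bigr => i _; rewrite liftK.
Qed.

Lemma seq_submod_rcons (A : comPzRingType) (L : lmodType A) c (s : seq A) (X : L) :
  seq_submod (rcons s c) X <-> exists Y, seq_submod s (X - c *: Y).
Proof.
elim: s X => [|b s IH] X; first exact: seq_submod_cons.
rewrite /= seq_submod_cons; split=> [[Y /IH[Z sZ]]|[Z /seq_submod_cons[Y sY]]].
  exists Z; apply/seq_submod_cons; exists Y.
  by have -> : X - c *: Z - b *: Y = X - b *: Y - c *: Z by module_over A.
exists Y; apply/IH; exists Z.
by have -> : X - b *: Y - c *: Z = X - c *: Z - b *: Y by module_over A.
Qed.

Fixpoint lquo (V : M -> Prop) (a : seq R) : M -> Prop :=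
  if a is b :: a' then lquo (lsat p (plus V (smul b))) a' else V.

Lemma lquo_rcons V a b : lquo V (rcons a b) = lsat p (plus (lquo V a) (smul b)).
Proof. by elim: a V => //= c a IH V. Qed.

Lemma lregularP V (a : seq R) : lregular p V a <->
  (forall i, (i < size a)%N -> forall y, lquo V (take i a) (a`_i *: y) ->
     lquo V (take i a) y) /\ exists y, ~ lquo V a y.
Proof.
elim: a V => [|b a IH] V /=; first by split=> [?|[]].
rewrite IH; split=> [[reg [rega nV]]|[reg nV]].
  by split=> // -[|i]; [move=> _ y; apply: reg | apply: rega].
split; first exact: (reg 0%N).
by split=> // i lt_i; apply: (reg i.+1).
Qed.

Definition fracs (z : seq (R * denom P)) : seq (loc_ring P) :=
  [seq frac (rho w.1 : S^o) w.2 | w <- z].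
Definition nums (z : seq (R * denom P)) : seq R := [seq w.1 | w <- z].

Lemma submod_lquo V a : is_submod V -> is_submod (lquo V a).
Proof. by elim: a V => //= b a IH V sV; apply/IH/submod_quo. Qed.

Lemma seq_submod_fracs z m (t : denom P) :
  seq_submod (fracs z) (frac (pi m : N) t) <-> lquo U (nums z) m.
Proof.
elim/last_ind: z m t => [|z [b r] IH] m t.
  apply: (iff_trans _ (frac_pi_eq0 m t)); rewrite /seq_submod; split=> [[y ->]|->].
    by rewrite big_ord0.
  by exists (fun=> 0); rewrite big_ord0.
rewrite /fracs /nums !map_rcons lquo_rcons seq_submod_rcons /=.
have sL : is_submod (lquo U (nums z)) := submod_lquo _ (submod_lsat pp sker).
split=> [[]|[u0 [pu [m1 [Lm1 [y m1E]]]]]].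
  elim/frac_ind=> n w; have [y <-] := pi_surj n.
  rewrite frac_scale fracN frac_add.
  have [r0 [rE pr]] := lift_denom r; have [w0 [wE pw]] := lift_denom w.
  have [t0 [tE pt]] := lift_denom t.
  have -> : (val (denomM r w) *: (pi m : N) + val t *: - (rho b *: (pi y : N))) =
            pi ((r0 * w0) *: m - (t0 * b) *: y) :> N.
    by rewrite linearB /= !pi_scale !rmorphM rE wE tE scalerN scalerA.
  move/IH => Lm; exists (r0 * w0); split; first exact: primeM.
  exists ((r0 * w0) *: m - (t0 * b) *: y); split=> //.
  by exists (t0 *: y); module_over R.
have [u uE] := denom_of pu; have [r0 [rE pr]] := lift_denom r.
exists (frac (rho r0 *: (pi y : N)) (denomM u t)).
rewrite frac_scale fracN.
have -> : frac (pi m : N) t = frac (val r *: (val u *: (pi m : N))) (denomM r (denomM u t)).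
  by rewrite frac_expand frac_expand.
rewrite fracD.
have -> : val r *: (val u *: (pi m : N)) + - (rho b *: (rho r0 *: (pi y : N))) =
          pi (r0 *: m1) :> N.
  have -> : m1 = u0 *: m - b *: y by rewrite -m1E subKr.
  rewrite pi_scale linearB /= !pi_scale uE rE scalerBr !scalerA.
  by rewrite [rho b * _]mulrC.
by apply/IH; apply: submodZ.
Qed.

(** Denominators are units, so the regularity of a sequence of fractions depends only on the
    numerators, and numerators lift to [R]. *)
Lemma regular_in_loc n :
  (exists s, [/\ size s = n, forall i, (i < n)%N -> loc_max s`_i &
                 regular_seq (loc_mod P N) s]) <->
  (exists a, [/\ size a = n, forall b, b \in a -> p b & lregular p U a]).
Proof.
have reg_iff z : regular_seq (loc_mod P N) (fracs z) <-> lregular p U (nums z).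
  rewrite lregularP /regular_seq /fracs /nums !size_map.
  have step i m (t : denom P) : (i < size z)%N ->
      (seq_submod (take i (fracs z)) ((fracs z)`_i *: frac (pi m : N) t) <->
       lquo U (take i (nums z)) ((nums z)`_i *: m)) /\
      (seq_submod (take i (fracs z)) (frac (pi m : N) t) <-> lquo U (take i (nums z)) m).
    move=> lt_i; have z0 : R * denom P := (0, denom1 P).
    rewrite /fracs /nums -!map_take (nth_map z0) // (nth_map z0) // frac_scale -pi_scale.
    by split; apply: seq_submod_fracs.
  split=> [[reg [X nX]]|[reg [m nm]]]; split.
  - move=> i lt_i m; have [e1 e2] := step i m (denom1 P) lt_i.
    by move/e1/(reg i lt_i)/e2.
  - elim/frac_ind: X nX => y t; have [m <-] := pi_surj y => nm.
    by exists m => /(seq_submod_fracs z m t).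
  - move=> i lt_i; elim/frac_ind=> y t; have [m' <-] := pi_surj y.
    by have [e1 e2] := step i m' t lt_i; move/e1/(reg i lt_i)/e2.
  - by exists (frac (pi m : N) (denom1 P)) => /seq_submod_fracs.
have size_fracs z : size (fracs z) = size (nums z) by rewrite !size_map.
split=> [[s [sn sm sreg]]|[a [an ap areg]]].
  have [z zE] : exists z, s = fracs z.
    elim: s {sn sm sreg} => [|X s [z ->]]; first by exists [::].
    elim/frac_ind: X => a t; have [r <-] := rho_surj a.
    by exists ((r, t) :: z).
  exists (nums z); split; rewrite -?size_fracs -?zE //.
    move=> b /(nthP 0)[i]; rewrite -size_fracs -zE sn => lt_i <-.
    have := sm i lt_i; rewrite zE /fracs /nums.
    have lt_z : (i < size z)%N by move: lt_i; rewrite -sn zE size_map.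
    have z0 : R * denom P := (0, denom1 P).
    by rewrite (nth_map z0) // (nth_map z0) // => /frac_loc_max.
  by apply/reg_iff; rewrite -zE.
pose z := [seq (b, denom1 P) | b <- a].
have zE : nums z = a by rewrite /nums -map_comp map_id.
exists (fracs z); split; first by rewrite size_fracs zE.
  move=> i lt_i; rewrite /fracs -map_comp (nth_map 0) ?an //=.
  by apply/frac_loc_max/ap/mem_nth; rewrite an.
by apply/reg_iff; rewrite zE.
Qed.

Definition local_depth (V : M -> Prop) (q : set R) d : Prop :=
  let regular_in n :=
    exists a : seq R, [/\ size a = n, forall b, b \in a -> q b & lregular q V a] in
  regular_in d /\ forall n, regular_in n -> (n <= d)%N.

Lemma local_mcm_loc : local_mcm (loc_mod P N) <->
  (forall m, U m) \/ exists d, [/\ chains_to p d, forall n, chains_to p n -> (n <= d)%N &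
                                    local_depth U p d].
Proof.
have depthE d : depth (loc_mod P N) (@loc_max S P) d <-> local_depth U p d.
  rewrite /depth /local_depth; split=> -[/regular_in_loc reg bnd]; split=> // n.
    by move/regular_in_loc/bnd.
  by move/regular_in_loc/bnd.
split=> [[m [/local_ring_unique -> [N0|[d [/krull_dim_loc[ch bnd] /depthE dep]]]]]|].
- by left; apply/loc_mod_eq0.
- by right; exists d.
move=> h; exists (@loc_max S P); split; first exact: local_loc_ring.
case: h => [/loc_mod_eq0 N0|[d [ch bnd /depthE dep]]]; first by left.
by right; exists d; split=> //; apply/krull_dim_loc.
Qed.
End Modules.
End LocalizationTransfer.

(** * Finitely generated projective modules *)

Lemma linear_ex (R : pzRingType) (U V : lmodType R) (g : U -> V) :
  linear g -> exists h : {linear U -> V}, forall x, h x = g x.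
Proof.
by move=> gl; exists (HB.pack_for {linear U -> V} g (GRing.isLinear.Build _ _ _ _ g gl)).
Qed.

Section LinComb.
Variables (S : comPzRingType) (Q : lmodType S) (r : nat) (k : 'I_r -> Q).

Definition lincomb (c : {ffun 'I_r -> S^o}) : Q := \sum_i (c i : S) *: k i.

Lemma lincomb_is_linear : linear lincomb.
Proof.
move=> a b c; rewrite /lincomb scaler_sumr -big_split; apply: eq_bigr => i _.
by rewrite !ffunE /= scalerDl scalerA.
Qed.
HB.instance Definition _ := GRing.isLinear.Build S {ffun 'I_r -> S^o} Q _
  lincomb lincomb_is_linear.

Definition unit_ffun (i : 'I_r) : {ffun 'I_r -> S^o} := [ffun j => (j == i)%:R].

Lemma lincomb_unit i : lincomb (unit_ffun i) = k i.
Proof.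
rewrite /lincomb (bigD1 i) //= ffunE eqxx scale1r big1 ?addr0 // => j /negPf ne.
by rewrite ffunE ne scale0r.
Qed.
End LinComb.

Lemma ffun_unitE (S : comPzRingType) r (c : {ffun 'I_r -> S^o}) :
  c = \sum_i (c i : S) *: unit_ffun S i.
Proof.
apply/ffunP=> j; rewrite sum_ffunE (bigD1 j) //= !ffunE eqxx big1 ?addr0.
  by rewrite /GRing.scale /= mulr1.
by move=> i /negPf ne; rewrite !ffunE eq_sym ne scaler0.
Qed.

Section DualBases.
Variable S : comPzRingType.

(* Multiplication by [s] on [L] factors through a free module of finite rank. *)
Definition factors (L : lmodType S) (s : S) : Prop :=
  exists n (y : 'I_n -> L) (phi : 'I_n -> {linear L -> S^o}),
    forall m, s *: m = \sum_i (phi i m : S) *: y i.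

Lemma factors1 L : factors L 1 <-> dual_basis L.
Proof.
by split=> -[n [y [phi yphi]]]; exists n, y, phi => m; rewrite -yphi scale1r.
Qed.

Lemma factors_id L : is_ideal (factors L).
Proof.
split.
- by exists 0%N, (fun=> 0), (fun=> \0) => m; rewrite big_ord0 scale0r.
- move=> s t [n [y [phi yphi]]] [n' [y' [phi' yphi']]].
  exists (n + n')%N, (fun i => match split i with inl j => y j | inr j => y' j end).
  exists (fun i => match split i with inl j => phi j | inr j => phi' j end) => m.
  rewrite scalerDl yphi yphi' big_split_ord; congr (_ + _); apply: eq_bigr => i _.
    by rewrite (unsplitK (inl i)).
  by rewrite (unsplitK (inr i)).
- move=> a s [n [y [phi yphi]]]; exists n, (fun i => a *: y i), phi => m.
  rewrite -scalerA yphi scaler_sumr; apply: eq_bigr => i _; module_over S.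
Qed.

Lemma dual_basis_free n : dual_basis ({ffun 'I_n -> S^o} : lmodType S).
Proof.
have coord_linear i : linear (fun c : {ffun 'I_n -> S^o} => c i : S^o).
  by move=> a c d; rewrite !ffunE.
exists n, (@unit_ffun S n), (fun i => HB.pack_for {linear {ffun 'I_n -> S^o} -> S^o}
  (fun c : {ffun 'I_n -> S^o} => c i : S^o)
  (GRing.isLinear.Build S {ffun 'I_n -> S^o} S^o _ _ (coord_linear i))).
exact: ffun_unitE.
Qed.

Lemma dual_basis_projective (L : lmodType S) : dual_basis L -> projective L.
Proof.
move=> [n [y [phi yphi]]] M N q h qsurj.
pose m i := sval (cid (qsurj (h (y i)))).
have mE i : q (m i) = h (y i) by rewrite /m; case: cid.
pose l (v : L) : M := \sum_i (phi i v : S) *: m i.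
have ll : linear l.
  move=> a v w; rewrite /l scaler_sumr -big_split; apply: eq_bigr => i _.
  by rewrite linearP /= scalerDl scalerA.
exists (HB.pack_for {linear L -> M} l (GRing.isLinear.Build _ _ _ _ l ll)) => v /=.
rewrite /l linear_sum [in RHS](yphi v) linear_sum; apply: eq_bigr => i _.
by rewrite !linearZ_LR mE.
Qed.

Lemma dual_basis_fin_gen (L : lmodType S) : dual_basis L -> fin_gen L.
Proof. by move=> [n [y [phi yphi]]]; exists n, y => v; exists (fun i => phi i v). Qed.

Lemma projective_dual_basis (L : lmodType S) : fin_gen L -> projective L -> dual_basis L.
Proof.
move=> [n [g gL]] proj.
have [|l lE] := proj _ _ (lincomb g : {linear {ffun 'I_n -> S^o} -> L}) idfun.
  move=> v; have [c ->] := gL v; exists [ffun i => c i].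
  by rewrite /= /lincomb; apply: eq_bigr => i _; rewrite ffunE.
have coord_linear i : linear (fun v => l v i : S^o).
  by move=> a v w; rewrite linearP !ffunE.
exists n, g, (fun i => HB.pack_for {linear L -> S^o} (fun v => l v i : S^o)
  (GRing.isLinear.Build S L S^o _ _ (coord_linear i))) => v.
by rewrite -[LHS]/(idfun v) -lE.
Qed.

Lemma fin_gen_span (L : lmodType S) : fin_gen L -> exists s : seq L, forall m, span s m.
Proof.
by move=> [n [g gL]]; exists [seq g i | i <- enum 'I_n] => m; apply/spanP/gL.
Qed.

Lemma dual_basis_prod (L L' : lmodType S) : dual_basis L -> dual_basis L' ->
  dual_basis (L * L')%type.
Proof.
move=> [n [y [phi yphi]]] [n' [y' [phi' yphi']]].
exists (n + n')%N.
exists (fun i => match split i with inl j => (y j, 0) | inr j => (0, y' j) end).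
exists (fun i => match split i return {linear (L * L')%type -> S^o} with
  | inl j => phi j \o fst | inr j => phi' j \o snd end).
move=> [m m'].
have inL_linear : linear (fun v : L => (v, 0 : L')).
  by move=> a u v; rewrite pairZE pairDE scaler0 addr0.
have inR_linear : linear (fun v : L' => (0 : L, v)).
  by move=> a u v; rewrite pairZE pairDE scaler0 addr0.
pose inL := HB.pack_for {linear L -> (L * L')%type} (fun v : L => (v, 0 : L'))
  (GRing.isLinear.Build S L (L * L')%type _ _ inL_linear).
pose inR := HB.pack_for {linear L' -> (L * L')%type} (fun v : L' => (0 : L, v))
  (GRing.isLinear.Build S L' (L * L')%type _ _ inR_linear).
rewrite big_split_ord /=.
rewrite [LHS](_ : _ = inL m + inR m'); last by rewrite /= pairDE addr0 add0r.
rewrite {1}(yphi m) {1}(yphi' m') !linear_sum; congr (_ + _); apply: eq_bigr => i _.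
  by rewrite (unsplitK (inl i)) linearZ_LR.
by rewrite (unsplitK (inr i)) linearZ_LR.
Qed.
End DualBases.

Section KerModule.
Variables (S : pzRingType) (V W : lmodType S) (g : {linear V -> W}).

Definition kerp : {pred V} := fun v => g v == 0.
Lemma kerp_closed : submod_closed kerp.
Proof.
split; first by apply/eqP/linear0.
move=> a v w /eqP gv /eqP gw; apply/eqP.
by rewrite linearP gv gw scaler0 addr0.
Qed.
HB.instance Definition _ := GRing.isSubmodClosed.Build S V kerp kerp_closed.

Definition ker_mod : Type := {v : V | kerp v}.
HB.instance Definition _ := SubChoice.on ker_mod.
HB.instance Definition _ := [SubChoice_isSubLmodule of ker_mod by <:].

Definition ker_val : ker_mod -> V := val.
Lemma ker_val_is_linear : linear ker_val.
Proof. by []. Qed.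
HB.instance Definition _ := GRing.isLinear.Build S ker_mod V _ ker_val ker_val_is_linear.

Lemma ker_valP (y : ker_mod) : g (ker_val y) = 0.
Proof. by apply/eqP; exact: (valP y). Qed.

Lemma ker_val_inj : injective ker_val. Proof. exact: val_inj. Qed.

Lemma ker_mod_of v : g v = 0 -> exists y : ker_mod, ker_val y = v.
Proof. by move=> /eqP gv; exists (Sub v gv); apply: SubK. Qed.
End KerModule.

(** * Boundaries of Koszul one-chains *)

Section KoszulOneCycles.
Variables (S : comPzRingType) (M : lmodType S).

(** The submodule [x V], in the recursive shape of the boundary of a one-chain with coefficients in
    [V]. *)
Fixpoint smuls (V : M -> Prop) (x : seq S) : M -> Prop :=
  if x is a :: x' then fun m => exists y, V y /\ smuls V x' (m - a *: y)
  else fun m => m = 0.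

Lemma submod_smuls V x : is_submod V -> is_submod (smuls V x).
Proof.
move=> sV; elim: x => [|a x IH] /=; first exact: submod_zero.
split.
- by exists 0; split; [|rewrite scaler0 subrr]; apply: submod0.
- move=> m m' [y [Vy sy]] [y' [Vy' sy']]; exists (y + y'); split; first exact: submodD.
  have -> : m + m' - a *: (y + y') = (m - a *: y) + (m' - a *: y') by module_over S.
  exact: submodD.
- move=> c m [y [Vy sy]]; exists (c *: y); split; first exact: submodZ.
  have -> : c *: m - a *: (c *: y) = c *: (m - a *: y) by module_over S.
  exact: submodZ.
Qed.

Lemma smuls_imul (p : set S) V x m :
  (forall a, a \in x -> p a) -> smuls V x m -> imul p V m.
Proof.
elim: x m => [|a x IH] m xp /=; first by move=> ->; apply: imul0.
move=> [y [Vy /IH H]]; rewrite -(subrK (a *: y) m) addrC; apply: imulZD => //.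
  exact/xp/mem_head.
by apply: H => b xb; apply: xp; rewrite inE xb orbT.
Qed.

Lemma span_smuls V x a y : is_submod V -> V y -> span (M := S^o) x a ->
  smuls V x (a *: y).
Proof.
move=> sV Vy; elim: x a => [|b x IH] a /=; first by move=> ->; rewrite scale0r.
move=> [c /IH sy]; exists (c *: y); split; first exact: submodZ.
suff <- : (a - c *: (b : S^o)) *: y = a *: y - b *: (c *: y) by [].
by rewrite scalerBl scalerA [b * c]mulrC.
Qed.

Fixpoint kbot (x : seq S) (m : M) : koszul M x :=
  match x return koszul M x with [::] => m | _ :: x' => (kbot x' m, 0) end.

Lemma kbotB x m m' : kbot x (m - m') = kbot x m - kbot x m'.
Proof.
elim: x => //= a x ->.
have -> : (kbot x m, 0 : koszul M x) - (kbot x m', 0) = (kbot x m - kbot x m', 0 - 0) by [].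
by rewrite subrr.
Qed.

Lemma kbotZ x c m : kbot x (c *: m) = c *: kbot x m.
Proof.
elim: x => //= a x ->.
have -> : c *: (kbot x m, 0 : koszul M x) = (c *: kbot x m, c *: 0) by [].
by rewrite scaler0.
Qed.

Lemma kbot0 x : kbot x 0 = 0.
Proof. by rewrite -[0 in LHS](scale0r 0) kbotZ scale0r. Qed.

Lemma kdeg_kbot x m : kdeg 0 (kbot x m).
Proof. by elim: x => //= a x IH; split. Qed.

Lemma kdeg0_kbot x V (z : koszul M x) : kdeg 0 z -> kin V z ->
  exists y, V y /\ z = kbot x y.
Proof.
elim: x z => [|a x IH] z /=; first by exists z.
by case: z => z1 z2 /= [/IH d1 ->] [/d1[y [Vy ->]] _]; exists y.
Qed.

Lemma kin_kbot x V y : V 0 -> V y -> kin V (kbot x y).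
Proof.
move=> V0 Vy; elim: x => //= a x IH; split=> //.
by elim: (x) => //= b x' IH'; split.
Qed.

Lemma boundary_smuls V x (b : koszul M x) m :
  kdeg 1 b -> kin V b -> kd b = kbot x m -> smuls V x m.
Proof.
elim: x b m => [|a x IH] b m /=; first by move=> _ _ <-.
case: b => b1 b2 /= [d1 d2] [V1 V2] [e1 _].
have [y [Vy b2E]] := kdeg0_kbot d2 V2; exists y; split=> //.
by apply: (IH b1) => //; rewrite kbotB kbotZ -b2E -e1 addrK.
Qed.

Lemma smuls_boundary V x m : is_submod V -> smuls V x m ->
  exists b : koszul M x, [/\ kdeg 1 b, kin V b & kd b = kbot x m].
Proof.
move=> sV; elim: x m => [|a x IH] m /=.
  by move=> ->; exists 0; split=> //; apply: submod0.
move=> [y [Vy /IH[b [d1 V1 bE]]]]; exists (b, kbot x y); split=> /=.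
- by split=> //; apply: kdeg_kbot.
- by split=> //; apply: kin_kbot => //; apply: submod0.
- by rewrite bE kbotB kbotZ subrK (kdeg0_kd (kdeg_kbot _ _)) oppr0.
Qed.
End KoszulOneCycles.

Lemma kmap_kbot (S : comPzRingType) (M N : lmodType S) (g : {linear M -> N}) x m :
  kmap g (kbot x m) = kbot x (g m).
Proof. by elim: x => //= a x ->; rewrite kmap0. Qed.

Lemma lsat0_free (R : idomainType) (p : set R) r (c : {ffun 'I_r -> R^o}) :
  is_prime p -> lsat p (fun c : {ffun 'I_r -> R^o} => c = 0) c -> c = 0.
Proof.
move=> [[p0 _ _] _ _] [t [pt /ffunP tc]]; apply/ffunP=> i; have := tc i; rewrite !ffunE.
move=> /eqP; rewrite /GRing.scale /= mulf_eq0 => /predU1P[t0|/eqP //].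
by case: pt; rewrite t0.
Qed.

Section MinimalGenerators.
Variables (R : idomainType) (p : set R) (x : seq R) (Q : lmodType R) (K : Q -> Prop).
Hypotheses (noethR : noetherian R) (pp : is_prime p).
Hypothesis xp : forall a, a \in x -> p a.
Hypothesis px : forall a, p a -> lsat (M := R^o) p (span (M := R^o) x) a.
Hypothesis sK : is_submod K.

Let image r (k : 'I_r -> Q) : Q -> Prop := fun q => exists c, lincomb k c = q.

Let submod_image r (k : 'I_r -> Q) : is_submod (image k).
Proof.
split; first by exists 0; apply: linear0.
- by move=> _ _ [c <-] [d <-]; exists (c + d); apply: linearD.
- by move=> a _ [c <-]; exists (a *: c); apply: linearZ_LR.
Qed.

Definition local_generators r (k : 'I_r -> Q) : Prop :=
  (forall i, K (k i)) /\ forall y, K y -> lsat p (image k) y.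

(** Take the least number of local generators: a relation with a coefficient outside [p] would
    eliminate one of them. *)
Lemma minimal_generators : fg_submod K -> exists r (k : 'I_r -> Q),
  local_generators k /\ forall c i, lincomb k c = 0 -> p (c i).
Proof.
move=> [s [sub_sK Ks]].
pose has r := exists k : 'I_r -> Q, local_generators k.
have ex : exists r, `[< has r >].
  exists (size s); apply/asboolP; exists (fun i => s`_i); split=> [i|y /Ks sy].
    exact/sub_sK/mem_nth.
  apply: lsatW => //; apply: (span_sub (submod_image _) _ sy) => g /(nthP 0)[i lt_i <-].
  by exists (unit_ffun R (Ordinal lt_i)); rewrite lincomb_unit.
case: (ex_minnP ex) => r /asboolP[k [kK kgen]] rmin; exists r, k; split=> // c i c0.
apply: contrapT => pc; case: r => [|r] in k kK kgen rmin c i c0 pc *; first by case: i pc.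
suff : (r.+1 <= r)%N by rewrite ltnn.
apply: rmin; apply/asboolP; exists (fun j => k (lift i j)); split=> [j|y Ky]; first exact: kK.
have [t [pt [b bE]]] := kgen y Ky; exists (c i * t); split; first exact: primeM.
(* [c i] times the expression of [t *: y], minus [b i] times the relation: the [i]-th coefficient
   cancels, at the price of the multiplier [c i * t]. *)
exists [ffun j => (c i : R) * b (lift i j) - b i * c (lift i j)].
have dE : lincomb k ((c i : R) *: b - (b i : R) *: c) = (c i * t) *: y.
  rewrite linearB !linearZ_LR /=; move: c0 bE => /= -> ->; module_over R.
rewrite -dE /lincomb (bigD1_ord i) //= !ffunE.
have -> : (c i : R) *: b i - (b i : R) *: c i = 0 :> R.
  by rewrite /GRing.scale /= mulrC subrr.
rewrite scale0r add0r; apply: eq_bigr => j _; by rewrite !ffunE.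
Qed.

(* The relations between minimal local generators form a submodule [L] of [p F].
   Lifting along the vanishing first Koszul homology of [K] shows [L = p L]. *)
Lemma locally_free : fg_submod K ->
  (forall z : koszul Q x, kdeg 1 z -> kin K z -> kd z = 0 ->
     exists t w, [/\ ~ p t, kdeg 2 w, kin K w & t *: z = kd w]) ->
  exists r (k : 'I_r -> Q), local_generators k /\ injective (lincomb k).
Proof.
move=> fgK H1; have [r [k [[kK kgen] cp]]] := minimal_generators fgK.
exists r, k; split=> //.
pose L (c : {ffun 'I_r -> R^o}) := lincomb k c = 0.
have sL : is_submod L.
  split=> [|c d cE dE|a c cE]; rewrite /L; first exact: linear0.
    by rewrite linearD /= cE dE addr0.
  by rewrite linearZ_LR /= cE scaler0.
have phiK c : K (lincomb k c).
  rewrite /lincomb; apply: big_ind => [|y z|i _]; [exact: submod0 | exact: submodD |].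
  exact: submodZ.
have fgL : fg_submod L.
  apply: (fg_submodule noethR (s := [seq unit_ffun R i | i <- enum 'I_r])) => // c _.
  by apply/spanP; exists c; apply: ffun_unitE.
have sT : is_submod (fun _ : {ffun 'I_r -> R^o} => True) := submod_setT _.
have sX := submod_smuls x sT.
suff L0 c : L c -> c = 0.
  by move=> c d cd; apply/subr0_eq/L0; rewrite /L linearB /= cd subrr.
move=> Lc; apply: (lsat0_free pp).
apply: (nakayama pp (submod_zero _) sL fgL) Lc => {}c Lc.
have [t [pt tc]] : lsat p (smuls (fun=> True) x) c.
  have sl := submod_lsat pp sX.
  rewrite [c]ffun_unitE; apply: big_ind => [|y z|i _]; [exact: submod0 | exact: submodD |].
  have [t [pt ti]] := px (cp c i Lc); exists t; split=> //.
  by rewrite scalerA; apply: span_smuls.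
(* [b] is a one-chain over the free module with boundary [t *: c]. Its image in [K] is a cycle,
   hence up to multipliers the boundary of some [w], which lifts to [w']. Subtracting the boundary
   of [w'] from the multiple of [b] leaves coefficients in [L] and the same boundary, so [c] lies in
   [p L] at [p]. *)
have [b [db _ bE]] := smuls_boundary sT tc.
have [|||t' [w [pt' dw Kw wE]]] := H1 (kmap (lincomb k) b).
- exact: kmap_kdeg.
- by apply/kin_kmap; elim: (x) (b) => [|a y IH] v //=.
- by rewrite -kmap_kd bE kmap_kbot linearZ_LR /= Lc scaler0 kbot0.
have [u [pu uw]] : lsat p (kin (image k)) w.
  apply/(kin_lsat _ pp (submod_image k)); apply: kin_mono Kw; exact: kgen.
have [||||w' [dw' _ w'E]] := @kmap_lift _ _ _ (lincomb k) x 2 (u *: w) (fun=> True) (image k).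
- by [].
- by move=> _ [d <-]; exists d.
- exact: submodZ (submod_kdeg _ _ _) dw.
- exact: uw.
exists (u * t' * t); split; first by do 2!apply: primeM => //.
exists 0; split=> //; rewrite subr0; apply: (smuls_imul xp).
apply: (boundary_smuls (b := (u * t') *: b - kd w')).
- apply: submodB (submod_kdeg _ _ _) _ _; first exact: submodZ (submod_kdeg _ _ _) db.
  exact: kdegS_kd.
- apply/(kin_kmap (lincomb k) (fun q => q = 0)); apply/kin_eq0.
  by rewrite kmapB kmapZ kmap_kd w'E kdZ -wE scalerA subrr.
- by rewrite kdB kdZ kd_kd subr0 bE -kbotZ scalerA.
Qed.
End MinimalGenerators.

(** * Hypersurfaces in regular domains *)

Section RegularDomain.
Variables (R : idomainType) (regR : regular_ring R).

Let noethR : noetherian R. Proof. by case: regR. Qed.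

(** The parameters are numerators of a system of generators of the maximal ideal of the local ring,
    as many as its dimension. *)
Lemma regular_local_parameters (p : set R) : is_prime p -> exists x : seq R,
  [/\ forall a, a \in x -> p a,
      forall a, p a -> lsat (M := R^o) p (span (M := R^o) x) a,
      exists P, prime_chain (size x) P /\ P (size x) = p &
      forall n P, prime_chain n P -> (forall b, P n b -> p b) -> (n <= size x)%N].
Proof.
move=> pp; pose P := PrimeIdeal pp.
have [_ [m [/local_ring_unique -> [d [dimd [g gen]]]]]] := (regR).2 P.
have [x [sx xp px]] := loc_max_generators gen.
have idsurj (s : R) : exists r, (idfun : {rmorphism R -> R}) r = s by exists s.
have [[Q [chQ _ topQ]] bnd] := (krull_dim_loc P idsurj d).1 dimd.
have le_d n Q' : prime_chain n Q' -> (forall b, Q' n b -> p b) -> (n <= d)%N.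
  move=> chQ' topQ'; apply: bnd; exists Q'; split=> // b b0.
  have -> : b = 0 by [].
  by case: chQ' => Qpr _; case: (Qpr 0%N (leq0n _)) => -[].
exists x; split=> //; last by rewrite sx.
exists Q; rewrite sx; split=> //; apply: contrapT => neq.
suff : (d.+1 <= d)%N by rewrite ltnn.
(* A longest chain ends at [p] itself; otherwise [p] could be appended to it. *)
apply: (le_d _ (fun i => if (i <= d)%N then Q i else p)); last by rewrite ltnn.
case: chQ => Qpr Qlt; split=> i.
  by case: (leqP i d) => [/Qpr|].
rewrite ltnS => le_i; rewrite le_i; case: (ltnP i d) => [|le_d']; first exact: Qlt.
have -> : i = d by lia.
split=> // sub; apply: neq; apply/seteqP; split=> //.
Qed.

Section AtPrime.
Variables (p : set R) (x : seq R).
Hypothesis pp : is_prime p.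
Hypothesis xp : forall a, a \in x -> p a.
Hypothesis px : forall a, p a -> lsat (M := R^o) p (span (M := R^o) x) a.
Hypothesis xchain : exists P, prime_chain (size x) P /\ P (size x) = p.

Lemma kvanish_domain i : kvanish p x i.+1 (fun a : R^o => a = 0).
Proof.
have [P [chP Ptop]] := xchain.
have := regular_parameters noethR pp xp px (i := i) chP Ptop.
suff -> : lsat (M := R^o) p (fun a : R^o => a = 0) = (fun a : R^o => a = 0) by [].
apply/predeqP => a; split=> [[t [pt /eqP]]|->]; last first.
  by apply: lsatW => //; apply: submod_zero.
rewrite /GRing.scale /= mulf_eq0 => /predU1P[t0|/eqP//].
by case: pt; rewrite t0; case: pp => -[].
Qed.
End AtPrime.

Variables (f : R) (f_neq0 : f != 0).
Local Notation S := (quot_ring f).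
Local Notation rho := (qproj f : {rmorphism R -> S}).

Lemma qproj_surj (s : S) : exists r, rho r = s.
Proof. by exists (repr s); apply: zprojK. Qed.

Lemma qproj_eq0 r : rho r = 0 <-> exists a, r = a * f.
Proof.
split=> [|[a ->]].
  rewrite -(rmorph0 rho) => /zprojP; rewrite subr0.
  elim=> {r} [|_ [b [c ->]]|r s _ [a ->] _ [b ->]].
  - by exists 0; rewrite mul0r.
  - by exists (b * c); rewrite mulrAC.
  - by exists (a - b); rewrite mulrBl.
rewrite -(rmorph0 rho); apply/zprojP; rewrite subr0; apply: zspan_gen.
by exists a, 1; rewrite mulr1.
Qed.

Lemma qproj_f : rho f = 0.
Proof. by apply/qproj_eq0; exists 1; rewrite mul1r. Qed.

Lemma ker_prime (P : set R) : is_prime P ->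
  ((forall b, rho b = 0 -> P b) <-> P f).
Proof.
move=> Ppr; split=> [|Pf b /qproj_eq0[a ->]]; first by apply; exact: qproj_f.
exact: prime_mull.
Qed.

Lemma zero_prime : is_prime (fun a : R => a = 0).
Proof.
split; first by split=> // [a b -> ->|a b ->]; rewrite ?addr0 ?mulr0.
  by move/eqP; rewrite oner_eq0.
by move=> a b /eqP; rewrite mulf_eq0 => /orP[]/eqP ?; [left|right].
Qed.

Lemma hypersurface_dim (p : set R) (x : seq R) : is_prime p -> p f ->
  (forall a, p a -> lsat (M := R^o) p (span (M := R^o) x) a) ->
  (exists P, prime_chain (size x) P /\ P (size x) = p) ->
  (forall n P, prime_chain n P -> (forall b, P n b -> p b) -> (n <= size x)%N) ->
  [/\ (0 < size x)%N, chains_to rho p (size x).-1 &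
      forall n, chains_to rho p n -> (n <= (size x).-1)%N].
Proof.
move=> pp pf px [P [chP Ptop]] bnd.
have x_gt0 : (0 < size x)%N.
  case: (x) px => // /(_ f pf)[t [pt /= /eqP]].
  rewrite /GRing.scale /= mulf_eq0 (negPf f_neq0) orbF => /eqP t0.
  by case: pt; rewrite t0; case: pp => -[].
split=> // [|n [Q [[Qpr Qlt] Q0 Qtop]]].
  rewrite -{1}(prednK x_gt0) in chP; rewrite -{1}(prednK x_gt0) in Ptop.
  have [|P' [[P'pr P'lt] P'0 P'top P'f]] := chain_through (x := f) noethR chP.
    by rewrite Ptop.
  exists (fun i => P' i.+1); split; last by rewrite P'top Ptop.
    by split=> i le_i; [apply: P'pr | apply: P'lt].
  by apply/ker_prime => //; apply: P'pr.
rewrite -ltnS prednK //.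
(* A chain of primes containing [f] is prolonged by the zero ideal, which is prime in a domain and
   differs from [Q 0] because [f] is not zero. *)
apply: (bnd _ (fun i => if i is i'.+1 then Q i' else fun a => a = 0)) => //.
split=> [[|i]|[|i]] //; [move=> _; exact: zero_prime | exact: Qpr | | exact: Qlt].
move=> _; have Q0pr := Qpr 0%N (leq0n _); split=> [a ->|sub].
  by case: Q0pr => -[].
have Q0f : Q 0%N f by apply/ker_prime.
by have /eqP := sub f Q0f; rewrite (negPf f_neq0).
Qed.

Section Coker.
Variables (M N : lmodType R) (nu : {linear N -> M}) (e : {linear N -> N}).
Variables (C : lmodType S) (pi : {linear M -> (restr rho C : lmodType R)}).
Hypotheses (dbM : dual_basis M) (dbN : dual_basis N).
Hypothesis pi_surj : forall y, exists m, pi m = y.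
Hypotheses (nu_pi : forall n, pi (nu n) = 0).
Hypothesis (pi_nu : forall m, pi m = 0 -> exists n, nu n = m).
Hypotheses (nue : forall n, nu (e n) = nu n) (nuI : forall n, nu n = 0 -> e n = 0).

(* The resolution of [C] by [N e -> M] makes its Koszul homology vanish from degree
   two on. *)
Lemma mcm_coker : max_cohen_macaulay C.
Proof.
have [s sM] := fin_gen_span (dual_basis_fin_gen dbM).
split.
  have [n [g gM]] := dual_basis_fin_gen dbM.
  exists n, (fun i => pi (g i) : C) => y; have [m <-] := pi_surj y.
  have [c ->] := gM m; exists (fun i => rho (c i)); rewrite linear_sum.
  by apply: eq_bigr => i _; apply: linearZ_LR.
move=> P; apply/(local_mcm_loc P qproj_surj pi_surj).
pose p := contr rho (prime_set P).
have pp : is_prime p := contr_prime rho (prime_setP P).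
have pf : p f by rewrite /p /contr qproj_f; case: (prime_setP P) => -[].
have [x [xp px xch bnd]] := regular_local_parameters pp.
have [x_gt0 chd bndS] := hypersurface_dim pp pf px xch bnd.
pose K m := pi m = 0.
have sK : is_submod K.
  split=> [|m m' mE m'E|a m mE]; rewrite /K; first exact: linear0.
    by rewrite linearD mE m'E addr0.
  by rewrite linearZ_LR mE scaler0.
have [|nN0] := pselect (forall m, lsat p K m); first by left.
right; exists (size x).-1; split=> //.
have van := kvanish_domain pp xp px xch.
have vanK i : kvanish p x i.+2 (lsat p K).
  apply: (kvanish_coker pp (nu := nu) (e := e)) => //.
  - exact: kvanish_dual_basis (van i) dbN.
  - exact: kvanish_dual_basis (van i.+1) dbM.
split.
  apply: (exists_lregular noethR pp xp sM (submod_lsat pp sK)).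
  - exact: saturated_lsat.
  - by apply/existsNP.
  - exact: leq_pred.
  (* For a sequence of length [(size x).-1] only the degrees from two on are asked for; degrees 0
     and 1 contradict the bound. *)
  - move=> [|[|i]] lt_i; last exact: vanK.
      by rewrite add0n ltnNge leq_pred in lt_i.
    by rewrite add1n prednK // ltnn in lt_i.
(* Depth is bounded by dimension: the chain found has a bottom that contains the annihilator of [C],
   so it is a chain over [R/(f)]. *)
move=> n [a [sa ap rega]]; apply: bndS.
have [|Q [chQ Qtop _ Qker]] := lregular_chain noethR pp (submod_lsat pp sK) _ ap rega.
  exact: saturated_lsat.
rewrite sa in chQ Qtop; exists Q; split=> // b b0; apply: Qker => m.
apply: lsatW => //; rewrite /K linearZ_LR.
by rewrite /GRing.scale /= /restr_scale b0 scale0r.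
Qed.
End Coker.

Section Kernel.
Variables (n : nat) (C : lmodType S).
Local Notation Q := {ffun 'I_n -> R^o}.
Variable pi : {linear Q -> (restr rho C : lmodType R)}.
Hypothesis pi_surj : forall y, exists m, pi m = y.
Hypothesis mcmC : max_cohen_macaulay C.
Local Notation L := (ker_mod pi).
Let K (q : Q) := pi q = 0.

(** If [s] kills the cokernel, multiplication by [s] on the kernel is the inclusion into the free
    module followed by [s], which lands back in the kernel. *)
Lemma factors_ann s : (forall q, K (s *: q)) -> factors (L : lmodType R) s.
Proof.
move=> sQ; have [r [y [phi yphi]]] := dual_basis_free R n.
have lift i : exists z : L, ker_val z = s *: y i by apply: ker_mod_of; apply: sQ.
exists r, (fun i => sval (cid (lift i))), (fun i => phi i \o ker_val (g := pi)) => m.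
apply: ker_val_inj; rewrite linearZ_LR linear_sum /= [in LHS](yphi (ker_val m)).
rewrite scaler_sumr; apply: eq_bigr => i _; rewrite linearZ_LR.
have zE : ker_val (sval (cid (lift i))) = s *: y i := svalP (cid (lift i)).
by rewrite [X in _ = _ *: X]zE /=; module_over R.
Qed.

Let sK : is_submod K.
Proof.
split=> [|m m' mE m'E|a m mE]; rewrite /K; first exact: linear0.
  by rewrite linearD mE m'E addr0.
by rewrite linearZ_LR mE scaler0.
Qed.

Let fgK : fg_submod K.
Proof.
have [s sQ] := fin_gen_span (dual_basis_fin_gen (dual_basis_free R n)).
exact: (fg_submodule noethR sK (fun q _ => sQ q)).
Qed.

Lemma factors_local (p : set R) : is_prime p ->
  exists s, ~ p s /\ factors (L : lmodType R) s.
Proof.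
(* If [f] is outside [p] it can serve as multiplier itself, since it kills [C]. *)
move=> pp; have [pf|npf] := pselect (p f); last first.
  exists f; split=> //; apply: factors_ann => q; rewrite /K linearZ_LR.
  by rewrite /GRing.scale /= /restr_scale qproj_f scale0r.
have fpr (r : R) : rho r = 0 -> p r by move: r; apply/ker_prime.
pose q (c : S) : Prop := exists r, rho r = c /\ p r.
have qE r : q (rho r) <-> p r.
  split=> [[r' [rr' pr']]|pr]; last by exists r.
  rewrite -(subrK r' r); apply: (submodD (M := R^o) (prime_submod pp)) => //.
  by apply: fpr; rewrite rmorphB rr' subrr.
have qpr : is_prime (q : set S).
  have [[p0 pD pM] p1 pMM] := pp; split; last first.
  - move=> c d; have [r <-] := qproj_surj c; have [r' <-] := qproj_surj d.
    by rewrite -rmorphM => /qE/pMM[?|?]; [left|right]; apply/qE.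
  - by rewrite -(rmorph1 rho) => /qE.
  split; first by rewrite -(rmorph0 rho); apply/qE.
  - move=> c d; have [r <-] := qproj_surj c; have [r' <-] := qproj_surj d.
    by move=> /qE ? /qE ?; rewrite -rmorphD; apply/qE/pD.
  - move=> c d; have [r <-] := qproj_surj c; have [r' <-] := qproj_surj d.
    by move=> /qE ?; rewrite -rmorphM; apply/qE/pM.
pose P := PrimeIdeal qpr.
have pE : contr rho (prime_set P) = p by apply/predeqP => r; apply: qE.
have /(local_mcm_loc P qproj_surj pi_surj) := mcmC.2 P; rewrite pE => mcm.
have [x [xp px xch bnd]] := regular_local_parameters pp.
have [x_gt0 chd bndS] := hypersurface_dim pp pf px xch bnd.
(* If [C] vanishes at [p], one multiplier carries all generators of the free module into the
   kernel. *)
case: mcm => [UK|[d [chd' bnd' [[a [sa ap rega]] _]]]].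
  have sT := submod_setT Q.
  have [s sQ] := fin_gen_span (dual_basis_fin_gen (dual_basis_free R n)).
  have fgT : fg_submod (fun _ : Q => True) by exists s.
  have [t [pt tK]] := fg_lsat pp sK fgT (fun q _ => UK q).
  by exists t; split=> //; apply: factors_ann => q'; apply: tK.
have dE : d = (size x).-1 by apply/eqP; rewrite eqn_leq bndS ?bnd'.
(* A regular sequence of length [(size x).-1] gives vanishing exactly from degree two on. *)
have van2 : kvanish p x 2 (lsat p K).
  apply: (kvanish_lregular pp px (submod_lsat pp sK) ap rega).
  by rewrite sa dE add2n prednK.
have van1 : kvanish p x 1 (fun q : Q => q = 0).
  exact: (kvanish_dual_basis pp (kvanish_domain pp xp px xch (i := 0%N)) (dual_basis_free R n)).
have [r [k [[kK kgen] kinj]]] :=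
  locally_free noethR pp xp px sK fgK (kvanish_sub pp sK van1 van2).
have sim : is_submod (fun q => exists c, lincomb k c = q).
  split; first by exists 0; apply: linear0.
  - by move=> _ _ [c <-] [c' <-]; exists (c + c'); apply: linearD.
  - by move=> b _ [c <-]; exists (b *: c); apply: linearZ_LR.
have [s [ps sk]] := fg_lsat pp sim fgK kgen; exists s; split=> //.
have coefP (m : L) : exists c, lincomb k c = s *: ker_val m.
  by apply: sk; apply: ker_valP.
(* The coordinates are chosen, but unique by injectivity of [lincomb k]; their linearity rests on
   this. *)
pose coef m := sval (cid (coefP m)).
have coefE m : lincomb k (coef m) = s *: ker_val m by rewrite /coef; case: cid.
have coef_linear i : linear (fun m => coef m i : R^o).
  move=> b m m'; suff -> : coef (b *: m + m') = b *: coef m + coef m' by rewrite !ffunE.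
  apply: kinj; rewrite coefE !linearP /= !coefE; module_over R.
have lift i : exists z : L, ker_val z = k i by apply: ker_mod_of; apply: kK.
exists r, (fun i => sval (cid (lift i))), (fun i => HB.pack_for {linear L -> R^o}
  (fun m => coef m i : R^o) (GRing.isLinear.Build R L R^o _ _ (coef_linear i))) => m.
apply: ker_val_inj; rewrite linearZ_LR /= -coefE linear_sum; apply: eq_bigr => i _.
have zE : ker_val (sval (cid (lift i))) = k i := svalP (cid (lift i)).
by rewrite linearZ_LR [X in _ = _ *: X]zE.
Qed.

(* The other half of Auslander-Buchsbaum: a first syzygy of a maximal
   Cohen-Macaulay module over [R/(f)] is projective. *)
Lemma ker_dual_basis : dual_basis (L : lmodType R).
Proof.
apply/factors1; apply: contrapT => nf1.
have [p [pp fp]] := exists_maximal noethR (factors_id L) nf1.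
by have [s [ps /fp]] := factors_local pp.
Qed.
End Kernel.
End RegularDomain.

(** * Modules over the quiver algebra *)

Section Equivalence.
Variables (C D : category) (F : functor C D).

Lemma equivalence_of_full_faithful :
  (forall X Y (g : mor (F X) (F Y)), exists h : mor X Y, heq (fmap F h) g) ->
  (forall X Y (g h : mor X Y), heq (fmap F g) (fmap F h) -> heq g h) ->
  (forall Y : D, exists (X : C) (i : mor (F X) Y) (j : mor Y (F X)),
     heq (mcomp i j) (idm Y) /\ heq (mcomp j i) (idm (F X))) ->
  is_equivalence F.
Proof.
move=> full faith ess.
pose ob Y := sval (cid (ess Y)).
pose i Y : mor (F (ob Y)) Y := sval (cid (svalP (cid (ess Y)))).
pose j Y : mor Y (F (ob Y)) := sval (cid (svalP (cid (svalP (cid (ess Y)))))).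
have ij Y : heq (mcomp (i Y) (j Y)) (idm Y).
  by case: (svalP (cid (svalP (cid (svalP (cid (ess Y))))))).
have ji Y : heq (mcomp (j Y) (i Y)) (idm (F (ob Y))).
  by case: (svalP (cid (svalP (cid (svalP (cid (ess Y))))))).
pose pre X Y (g : mor (F X) (F Y)) : mor X Y := sval (cid (full X Y g)).
have preE X Y (g : mor (F X) (F Y)) : heq (fmap F (pre X Y g)) g.
  exact: svalP (cid (full X Y g)).
have cancelij X Y (g : mor X Y) : heq (mcomp (i Y) (mcomp (j Y) g)) g.
  eapply heq_trans; [apply (Defs.compA _ _ _)|].
  by apply: heq_trans (comp_heq (ij Y) (heq_refl g)) (comp1m _).
have cancelji X Y (g : mor X (F (ob Y))) : heq (mcomp (j Y) (mcomp (i Y) g)) g.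
  eapply heq_trans; [apply (Defs.compA _ _ _)|].
  by apply: heq_trans (comp_heq (ji Y) (heq_refl g)) (comp1m _).
pose tr X Y (g : mor X Y) : mor (F (ob X)) (F (ob Y)) := mcomp (j Y) (mcomp g (i X)).
have Gheq X Y (g h : mor X Y) : heq g h -> heq (pre _ _ (tr X Y g)) (pre _ _ (tr X Y h)).
  move=> gh; apply: faith; eapply heq_trans; [apply (preE _ _ _)|].
  eapply heq_trans; [|apply (heq_sym (preE _ _ _))].
  exact: (comp_heq (heq_refl _) (comp_heq gh (heq_refl _))).
have Gid X : heq (pre _ _ (tr X X (idm X))) (idm (ob X)).
  apply: faith; eapply heq_trans; [apply (preE _ _ _)|].
  eapply heq_trans; [|apply (heq_sym (fmap_id F _))].
  eapply heq_trans; [|apply (ji X)].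
  exact: (comp_heq (heq_refl _) (comp1m _)).
have Gcomp X Y Z (g : mor Y Z) (h : mor X Y) :
    heq (pre _ _ (tr X Z (mcomp g h))) (mcomp (pre _ _ (tr Y Z g)) (pre _ _ (tr X Y h))).
  apply: faith; eapply heq_trans; [apply (preE _ _ _)|].
  eapply heq_trans; [|apply (heq_sym (fmap_comp F _ _))].
  eapply heq_trans; [|apply (heq_sym (comp_heq (preE _ _ _) (preE _ _ _)))].
  eapply heq_trans; [|apply (Defs.compA _ _ _)].
  apply: (comp_heq (heq_refl _)).
  eapply heq_trans; [|apply (Defs.compA _ _ _)].
  eapply heq_trans; [apply (heq_sym (Defs.compA _ _ _))|].
  exact: (comp_heq (heq_refl _) (heq_sym (cancelij _ _ _))).
pose G : functor D C := @Functor D C ob (fun X Y g => pre _ _ (tr X Y g)) Gheq Gid Gcomp.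
exists G; split.
- exists (fun X => pre (ob (F X)) X (i (F X))), (fun X => pre X (ob (F X)) (j (F X))).
  split=> [X|X|X Y g].
  + apply: faith; eapply heq_trans; [apply (fmap_comp F _ _)|].
    eapply heq_trans; [apply (comp_heq (preE _ _ _) (preE _ _ _))|].
    exact: (heq_trans (ji _) (heq_sym (fmap_id F _))).
  + apply: faith; eapply heq_trans; [apply (fmap_comp F _ _)|].
    eapply heq_trans; [apply (comp_heq (preE _ _ _) (preE _ _ _))|].
    exact: (heq_trans (ij _) (heq_sym (fmap_id F _))).
  + apply: faith; eapply heq_trans; [apply (fmap_comp F _ _)|].
    eapply heq_trans; [apply (comp_heq (preE _ _ _) (preE _ _ _))|].
    eapply heq_trans; [apply (cancelij _ _ _)|].
    eapply heq_trans; [|apply (heq_sym (fmap_comp F _ _))].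
    exact: (comp_heq (heq_refl _) (heq_sym (preE _ _ _))).
- exists i, j; split=> [X|X|X Y g]; [exact: ji | exact: ij |].
  eapply heq_trans; [apply (comp_heq (heq_refl _) (preE _ _ _))|].
  exact: cancelij.
Qed.
End Equivalence.

(** * Right modules over B as R-modules with operators *)

Section QuiverModules.
Variables (R : comNzRingType) (f : R).
Local Notation B := (quiver_alg f).
Local Notation Quiver := (Defs.Quiver f).
Local Notation ep := (e_plus f).
Local Notation em := (e_minus f).
Local Notation u := (arrow_u f).
Local Notation v := (arrow_v f).
Local Notation base M := (restr (quiver_base f) M : lmodType R).

Section Action.
Variable M : lmodType B^c.

(** Right multiplication by [b] as an operator over [R]. Composites reverse the order, so [u] maps
    the plus part to the minus part and [v] maps it back. *)
Definition act (b : B) (m : base M) : base M := (b : B^c) *: (m : M).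

Lemma base_scaleE r (m : base M) : r *: m = act (Quiver r r 0 0) m.
Proof.
have -> : Quiver r r 0 0 = r *: (1 : B) by rewrite quiver_1E quiver_scaleE mulr1 mulr0.
by [].
Qed.

Lemma actM b c m : act c (act b m) = act (b * c) m.
Proof. exact: (@scalerA B^c M c b m). Qed.

Lemma act_is_linear b : linear (act b).
Proof.
move=> r m n; rewrite !base_scaleE.
have -> : act b (act (Quiver r r 0 0) m + n) = act b (act (Quiver r r 0 0) m) + act b n.
  exact: (@scalerDr B^c M b).
congr (_ + _); rewrite !actM; congr act; case: b => b1 b2 b3 b4; rewrite !quiver_mulE.
by congr Quiver; ring.
Qed.
HB.instance Definition _ b := GRing.isLinear.Build R (base M) (base M) _ (act b)
  (act_is_linear b).

Lemma actDl b c m : act (b + c) m = act b m + act c m.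
Proof. exact: (@scalerDl B^c M m b c). Qed.

Lemma act0l m : act 0 m = 0. Proof. exact: (@scale0r B^c M m). Qed.

Lemma act1 m : act 1 m = m. Proof. exact: (@scale1r B^c M m). Qed.

Lemma actE a b c d m : act (Quiver a b c d) m =
  a *: act ep m + b *: act em m + c *: act u m + d *: act v m.
Proof.
rewrite !base_scaleE !actM !quiver_mulE -!actDl !quiver_addE.
by congr act; congr Quiver; ring.
Qed.
End Action.
End QuiverModules.

Section ActionRelations.
Variables (R : comNzRingType) (f : R) (M : lmodType (quiver_alg f)^c).
Local Notation Quiver := (Defs.Quiver f).
Local Notation ep := (e_plus f).
Local Notation em := (e_minus f).
Local Notation u := (arrow_u f).
Local Notation v := (arrow_v f).
Implicit Type m : restr (quiver_base f) M.

Local Ltac act_eq :=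
  rewrite ?base_scaleE ?actM; congr act; rewrite !quiver_mulE; congr Quiver; ring.
Local Ltac act_eq0 m :=
  rewrite -(act0l m); act_eq.

Lemma act_pp m : act ep (act ep m) = act ep m. Proof. act_eq. Qed.
Lemma act_mm m : act em (act em m) = act em m. Proof. act_eq. Qed.
Lemma act_pm m : act em (act ep m) = 0. Proof. act_eq0 m. Qed.
Lemma act_mp m : act ep (act em m) = 0. Proof. act_eq0 m. Qed.
Lemma act_pu m : act u (act ep m) = act u m. Proof. act_eq. Qed.
Lemma act_um m : act em (act u m) = act u m. Proof. act_eq. Qed.
Lemma act_mu m : act u (act em m) = 0. Proof. act_eq0 m. Qed.
Lemma act_up m : act ep (act u m) = 0. Proof. act_eq0 m. Qed.
Lemma act_mv m : act v (act em m) = act v m. Proof. act_eq. Qed.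
Lemma act_vp m : act ep (act v m) = act v m. Proof. act_eq. Qed.
Lemma act_pv m : act v (act ep m) = 0. Proof. act_eq0 m. Qed.
Lemma act_vm m : act em (act v m) = 0. Proof. act_eq0 m. Qed.
Lemma act_uu m : act u (act u m) = 0. Proof. act_eq0 m. Qed.
Lemma act_vv m : act v (act v m) = 0. Proof. act_eq0 m. Qed.
Lemma act_uv m : act v (act u m) = f *: act ep m. Proof. act_eq. Qed.
Lemma act_vu m : act u (act v m) = f *: act em m. Proof. act_eq. Qed.
Lemma act_p_m m : act ep m + act em m = m.
Proof.
rewrite -[RHS](act1 m) -actDl; congr act; rewrite quiver_addE quiver_1E.
by congr Quiver; ring.
Qed.
End ActionRelations.

Definition act_rels := (act_pp, act_mm, act_pm, act_mp, act_pu, act_um, act_mu, act_up,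
  act_mv, act_vp, act_pv, act_vm, act_uu, act_vv, act_uv, act_vu).

Section QuiverLinear.
Variables (R : comNzRingType) (f : R) (M N : lmodType (quiver_alg f)^c).
Local Notation base := (restr (quiver_base f)).

Lemma quiver_linear (h : {linear base M -> base N}) :
  (forall m, h (act (e_plus f) m) = act (e_plus f) (h m)) ->
  (forall m, h (act (arrow_u f) m) = act (arrow_u f) (h m)) ->
  (forall m, h (act (arrow_v f) m) = act (arrow_v f) (h m)) ->
  exists g : {linear M -> N}, forall m, g m = h m.
Proof.
move=> hp hu hv.
have hm m : h (act (e_minus f) m) = act (e_minus f) (h m).
  by apply: (addrI (h (act (e_plus f) m))); rewrite -linearD act_p_m hp act_p_m.
have hD m n : h (m + n) = h m + h n by apply: linearD.
have hZ r m : h (r *: m) = r *: h m by apply: linearZ_LR.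
have hact b m : h (act b m) = act b (h m).
  by case: b => b1 b2 b3 b4; rewrite (actE b1 b2 b3 b4 m) (actE b1 b2 b3 b4 (h m));
     rewrite !hD !hZ hp hm hu hv.
have hl : linear (h : M -> N).
  move=> b m m'; apply: etrans (hD (act b m) m') _.
  by rewrite hact.
by exists (HB.pack_for {linear M -> N} (h : M -> N) (GRing.isLinear.Build _ _ _ _ _ hl)).
Qed.

Variable g : {linear M -> N}.
Definition base_map : base M -> base N := g.
Lemma base_map_is_linear : linear base_map.
Proof. by move=> r m m'; rewrite /base_map !base_scaleE [LHS](linearP g). Qed.
HB.instance Definition _ :=
  GRing.isLinear.Build R (base M) (base N) _ base_map base_map_is_linear.
Lemma base_map_act b m : base_map (act b m) = act b (base_map m).
Proof. exact: (linearZ_LR g). Qed.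
End QuiverLinear.

(** The value of [i_star_quot] on [M]. The name anticipates its description as the cokernel of [v]
    from the minus part to the plus part. *)
Definition coker_v (R : comNzRingType) (f : R) (M : lmodType (quiver_alg f)^c) :
    lmodType (quot_ring f) :=
  restr (quot_map (f := f)) (ext_mod (qproj (e_minus f)) M).

(** * The quotient map from M to its image under i^* *)

Section Projection.
Variables (R : comNzRingType) (f : R) (M : lmodType (quiver_alg f)^c).
Local Notation B := (quiver_alg f).
Local Notation Quiver := (Defs.Quiver f).
Local Notation ep := (e_plus f).
Local Notation em := (e_minus f).
Local Notation u := (arrow_u f).
Local Notation v := (arrow_v f).
Local Notation base M := (restr (quiver_base f) M : lmodType R).
Local Notation BeB := (quot_ring em).
Local Notation C := (coker_v M).
Local Notation resC := (restr (qproj f) C : lmodType R).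

Definition btens (m : base M) (c : BeB) : ext_mod (qproj em) M :=
  tens (m : M) (c : bimod (qproj em)).

Definition proj_C (m : base M) : resC := btens m 1.

Let tens_scale (X : ext_mod (qproj em) M) (r : R) :
  ((qproj f r) *: (X : C) : ext_mod (qproj em) M) =
  (qproj em (quiver_base f r) : BeB^c) *: X.
Proof. by rewrite -quot_mapE. Qed.

Lemma proj_C_is_linear : linear proj_C.
Proof.
move=> r m m'; apply: etrans (tensDl _ _ _) _; congr (_ + _).
apply: etrans (tensM _ _ _) _; symmetry.
apply: etrans (tens_scale _ _) _; apply: etrans (ext_scaleE _ _ _) _.
by congr tens; rewrite /rmul mul1r; apply/esym/mulr1.
Qed.
HB.instance Definition _ := GRing.isLinear.Build R (base M) resC _
  proj_C proj_C_is_linear.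

Lemma proj_CD (m n : base M) : proj_C (m + n) = proj_C m + proj_C n.
Proof. exact: tensDl. Qed.

Lemma tens_proj (m : base M) (b : B) :
  btens m (qproj em b) = proj_C (act b m).
Proof.
have -> : btens m (qproj em b) = tens (m : M) (b *: ((1 : BeB) : bimod (qproj em))).
  by congr tens; apply/esym/mulr1.
exact: (esym (tensM b (m : M) ((1 : BeB) : bimod (qproj em)))).
Qed.

Lemma proj_C_surj y : exists m, proj_C m = y.
Proof.
elim/tensor_ind: y => [|x y [m <-] [n <-]|m c].
- by exists 0; apply: linear0.
- by exists (m - n); apply: linearB.
- by elim/qproj_ind: c => b; exists (act b m); exact: (esym (tens_proj m b)).
Qed.

(** This is the submodule [M e_- B], since [e_- B] is spanned over [R] by [e_-] and [v]. *)
Definition minus_part (m : base M) : Prop := exists y1 y2, m = act em y1 + act v y2.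

Lemma minus_partB m n : minus_part m -> minus_part n -> minus_part (m - n).
Proof.
move=> [y1 [y2 ->]] [z1 [z2 ->]]; exists (y1 - z1), (y2 - z2).
by rewrite !linearB /= opprD addrACA.
Qed.

Lemma minus_part_em (b : B) m : minus_part (act b (act em m)).
Proof.
case: b => b1 b2 b3 b4; exists (b2 *: m), (b4 *: m).
by rewrite (actE b1 b2 b3 b4) !act_rels !scaler0 add0r addr0 !linearZ_LR.
Qed.

Lemma minus_part_sandwich (b c : B) m : minus_part (act (b * em * c) m).
Proof. by rewrite -!actM; apply: minus_part_em. Qed.

(** Acts through chosen representatives of classes of B/Be_-B, hence respects the tensor relations
    only up to [minus_part]. This is enough to detect which elements become zero in the tensor
    product. *)
Let lift_free : {freeg (M * BeB)%type / int} -> zmodule M :=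
  fglift (fun z => act (repr z.2) z.1 : zmodule M).

Let lift_freeB D E : lift_free (D - E) = lift_free D - lift_free E.
Proof. exact: lift_is_additive. Qed.

Let lift_freeU x y : lift_free << (x, y) >> = act (repr y) x.
Proof. by rewrite /lift_free liftU scale1r. Qed.

Let sandwich_minus (b : B) m : zspan (sandwich em) b -> minus_part (act b m).
Proof.
elim=> {b} [|_ [b [c ->]]|b c _ IHb _ IHc].
- by rewrite act0l; exists 0, 0; rewrite !linear0 addr0.
- exact: minus_part_sandwich.
- have -> : act (b - c) m = act b m - act c m by exact: (@scalerBl B^c M b c m).
  exact: minus_partB.
Qed.

Lemma proj_C_eq0 m : proj_C m = 0 <-> minus_part m.
Proof.
have tens0 x : btens x 0 = 0.
  by apply: (addrI (btens x 0)); rewrite -[LHS]tensDr !addr0.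
have sandwich0 b : zspan (sandwich em) b -> qproj em b = 0.
  by move=> sb; rewrite -(raddf0 (qproj em)); apply/zprojP; rewrite subr0.
split=> [|[y1 [y2 ->]]]; last first.
  have act0 (b : B) y : sandwich em b -> proj_C (act b y) = 0.
    move=> sb; apply: etrans (esym (tens_proj y b)) _.
    rewrite (sandwich0 b (zspan_gen sb)); exact: tens0.
  rewrite proj_CD (act0 em y1) ?(act0 v y2) ?addr0 //.
  - by exists em, v; rewrite !quiver_mulE; congr Quiver; ring.
  - by exists em, em; rewrite !quiver_mulE; congr Quiver; ring.
move=> m0; have {m0} : zspan (tensor_rel (M := M) (N := bimod (qproj em)))
    (<< (m : M, (1 : BeB) : bimod (qproj em)) >> - 0).
  by apply/zprojP; rewrite raddf0; apply: m0.
rewrite subr0 => mrel; suff lift_minus D : zspan (tensor_rel (M := M) (N := bimod (qproj em))) D ->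
    minus_part (lift_free D).
  have := lift_minus _ mrel; rewrite lift_freeU => m1.
  (* The representative of the class of 1 need not be 1, but differs from it by an element of
     Be_-B. *)
  have m2 : minus_part (act (repr (1 : BeB) - 1) m).
    by apply: sandwich_minus; apply: (zproj_repr (sandwich em) 1).
  have -> : m = act (repr (1 : BeB)) m - act (repr (1 : BeB) - 1) m.
    have -> : act (repr (1 : BeB) - 1) m = act (repr (1 : BeB)) m - act 1 m.
      exact: (@scalerBl B^c M).
    by rewrite act1 subKr.
  exact: minus_partB.
elim=> {D} [|D|D E _ IHD _ IHE].
- exists 0, 0; rewrite !linear0 addr0.
  by have := lift_freeB 0 0; rewrite !subrr.
- case=> [x x' y|x y y'|b x y]; rewrite !lift_freeB !lift_freeU.
  + have -> : act (repr y) (x + x') - act (repr y) x - act (repr y) x' = 0 :> M.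
      by rewrite linearD addrAC addrK subrr.
    by exists 0, 0; rewrite !linear0 addr0.
  + have -> : act (repr (y + y')) x - act (repr y) x - act (repr y') x =
        act (repr (y + y') - (repr y + repr y')) x :> M.
      rewrite -addrA -opprD -actDl; apply: esym; exact: (@scalerBl B^c M).
    apply: sandwich_minus; apply/(zprojP (sandwich em)).
    by rewrite raddfD /= !zprojK.
  + have -> : act (repr y) (act b x) - act (repr (b *: y)) x =
        act (b * repr y - repr (b *: y)) x :> M.
      rewrite actM; apply: esym; exact: (@scalerBl B^c M).
    apply: sandwich_minus; apply/(zprojP (sandwich em)).
    rewrite zprojK; apply: (etrans (qprojM em b (repr y))).
    by rewrite /qproj zprojK.
- by rewrite lift_freeB; apply: minus_partB.
Qed.

(* The same map, with its values in [coker_v M] as an [R/(f)]-module. *)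
Definition coker_proj (m : base M) : C := proj_C m.

Lemma coker_projZ r m : coker_proj (r *: m) = qproj f r *: coker_proj m.
Proof. exact: (linearZ_LR proj_C). Qed.
Lemma coker_projD m n : coker_proj (m + n) = coker_proj m + coker_proj n.
Proof. exact: proj_CD. Qed.
Lemma coker_proj_surj y : exists m, coker_proj m = y.
Proof. exact: proj_C_surj. Qed.
Lemma coker_proj_eq0 m : coker_proj m = 0 <-> minus_part m.
Proof. exact: proj_C_eq0. Qed.
End Projection.

Section ProjectionMap.
Variables (R : comNzRingType) (f : R) (M N : lmodType (quiver_alg f)^c).
Variable g : {linear M -> N}.

Lemma i_star_proj m :
  fmap (i_star_quot f) (g : mor (c := modcat _) M N) (coker_proj m) =
  coker_proj (base_map g m).
Proof.
pose one : bimod (qproj (e_minus f)) := (1 : quot_ring (e_minus f)).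
by have := ext_mapE g (m : M) one.
Qed.
End ProjectionMap.

Lemma dual_basis_torsion_free (R : idomainType) (L : lmodType R) (a : R) (m : L) :
  dual_basis L -> a != 0 -> a *: m = 0 -> m = 0.
Proof.
move=> [n [y [phi yphi]]] a0 am; rewrite (yphi m) big1 // => i _.
have /eqP := linear0 (phi i); rewrite -am linearZ_LR /= mulf_eq0 (negPf a0) /=.
by move/eqP->; rewrite scale0r.
Qed.

Section CMQuiver.
Variables (R : idomainType) (f : R).
Hypothesis f_neq0 : f != 0.
Local Notation B := (quiver_alg f).
Local Notation ep := (e_plus f).
Local Notation em := (e_minus f).
Local Notation u := (arrow_u f).
Local Notation v := (arrow_v f).
Local Notation base M := (restr (quiver_base f) M : lmodType R).
Local Notation C M := (coker_v M).

Section OneModule.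
Variable M : lmodType B^c.
Hypothesis CM_M : is_CM_quiver M.

Lemma dual_basis_CM : dual_basis (base M).
Proof. by case: CM_M => fg pr; apply: projective_dual_basis. Qed.

(** On the minus part [v] followed by [u] is multiplication by [f], and projective modules over a
    domain are torsion-free. *)
Lemma act_v_inj (m : base M) : act v m = 0 -> act em m = 0.
Proof.
move=> vm; apply: (dual_basis_torsion_free dual_basis_CM f_neq0).
by rewrite -act_vu vm linear0.
Qed.

(** The source is the square of the whole of [M], for which a dual basis is known; [minus_proj] is
    the idempotent that cuts out the two copies of [M e_-] on which this map is injective. *)
Definition minus_incl (n : (base M * base M)%type) : base M := act em n.1 + act v n.2.
Lemma minus_incl_is_linear : linear minus_incl.
Proof.
move=> r [a b] [a' b']; rewrite /minus_incl !linearP /=; module_over R.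
Qed.
HB.instance Definition _ := GRing.isLinear.Build R (base M * base M)%type (base M) _
  minus_incl minus_incl_is_linear.

Definition minus_proj (n : (base M * base M)%type) : (base M * base M)%type :=
  (act em n.1, act em n.2).
Lemma minus_proj_is_linear : linear minus_proj.
Proof. by move=> r [a b] [a' b']; rewrite /minus_proj /= !linearP. Qed.
HB.instance Definition _ := GRing.isLinear.Build R (base M * base M)%type
  (base M * base M)%type _ minus_proj minus_proj_is_linear.

Lemma i_star_mcm : regular_ring R -> is_mcm (i_star_quot f M).
Proof.
move=> regR.
apply: (mcm_coker regR f_neq0 (nu := minus_incl) (e := minus_proj) (pi := @proj_C R f M)).
- exact: dual_basis_CM.
- exact: dual_basis_prod dual_basis_CM dual_basis_CM.
- exact: proj_C_surj.
- by move=> n; apply/proj_C_eq0; exists n.1, n.2.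
- by move=> m /proj_C_eq0[y1 [y2 ->]]; exists (y1, y2).
- by move=> n; rewrite /= /minus_incl act_mm act_mv.
- move=> [a b] /= ab; rewrite /minus_proj /=.
  have {}ab : act em a + act v b = 0 := ab.
  have ma : act em a = 0.
    by have := congr1 (act em) ab; rewrite linearD /= act_mm act_vm addr0 linear0.
  by move: ab; rewrite ma add0r => /act_v_inj ->.
Qed.
End OneModule.

Section TwoModules.
Variables (M N : lmodType B^c).
Hypotheses (CM_M : is_CM_quiver M) (CM_N : is_CM_quiver N).

Lemma act_v_eq (y z : base N) : act v y = act v z -> act em y = act em z.
Proof.
move=> yz; apply/subr0_eq; rewrite -linearB; apply: (act_v_inj CM_N).
by rewrite linearB /= yz subrr.
Qed.

(* On the plus part [g] is a lift of [g0] over [R]; on the minus part it is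
   then determined, since [v] is injective on [N e_-]. *)
Lemma i_star_full (g0 : {linear C M -> C N}) :
  exists g : {linear M -> N}, forall m, coker_proj (base_map g m) = g0 (coker_proj m).
Proof.
have [_ proj] := CM_M.
have g0_linear : linear (fun m : base M =>
    g0 (coker_proj m) : (restr (qproj f) (C N) : lmodType R)).
  move=> r m m'; rewrite coker_projD coker_projZ.
  rewrite (linearD g0); congr (_ + _).
  exact: (linearZ_LR g0).
have [g0L g0E] := linear_ex g0_linear.
have [lam lamE] := proj _ _ (@proj_C R f N : {linear _ -> _}) g0L (@proj_C_surj R f N).
have {}lamE x : coker_proj (lam x) = g0 (coker_proj x).
  by apply: etrans (lamE x) _; apply: g0E.
have proj_em (K : lmodType B^c) (x : base K) : coker_proj (act em x) = 0.
  by apply/coker_proj_eq0; exists x, 0; rewrite linear0 addr0.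
have proj_ep (K : lmodType B^c) (x : base K) : coker_proj (act ep x) = coker_proj x.
  by rewrite -[in RHS](act_p_m x) [RHS]coker_projD proj_em addr0.
have proj_v (K : lmodType B^c) (x : base K) : coker_proj (act v x) = 0.
  by apply/coker_proj_eq0; exists 0, x; rewrite linear0 add0r.
pose gp x := act ep (lam (act ep x)).
have gpC x : coker_proj (gp x) = g0 (coker_proj x).
  rewrite (proj_ep N).
  rewrite lamE.
  by rewrite (proj_ep M).
(* The lift preserves the image of [v]: on it the class in the cokernel is zero, and the component
   in the plus part of an element of [N e_- B] is a value of [v]. *)
have gpv x : exists y, act em y = y /\ act v y = gp (act v x).
  have /coker_proj_eq0[y1 [y2 e]] : coker_proj (gp (act v x)) = 0.
    by rewrite gpC proj_v; apply: (linear0 g0).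
  exists (act em y2); rewrite act_mm act_mv; split=> //.
  have -> : gp (act v x) = act ep (gp (act v x)) by rewrite /gp act_pp.
  by rewrite e linearD /= act_mp act_vp add0r.
have uniq (y z : base N) : act em y = y -> act em z = z -> act v y = act v z -> y = z.
  by move=> ye ze /act_v_eq; rewrite ye ze.
pose gm x := sval (cid (gpv x)).
have gm_em x : act em (gm x) = gm x by case: (svalP (cid (gpv x))).
have gm_v x : act v (gm x) = gp (act v x) by case: (svalP (cid (gpv x))).
have gpL : linear gp by move=> r x y; rewrite /gp !linearP.
have [gp' gpE] := linear_ex gpL.
have gmL : linear gm.
  move=> r x y; apply: uniq; rewrite ?gm_em //; first by rewrite linearP /= !gm_em.
  by rewrite linearP /= !gm_v linearP /= gpL.
have hL : linear (fun x => gp x + gm x).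
  by move=> r x y; rewrite gpL gmL; module_over R.
have [h hE] := linear_ex hL.
have gm0 x : act v x = 0 -> gm x = 0.
  move=> vx; apply: uniq; rewrite ?gm_em ?linear0 //.
  by rewrite gm_v vx /gp !linear0.
have gp_em x : gp (act em x) = 0 by rewrite /gp act_mp !linear0.
have gp_ep x : gp (act ep x) = gp x by rewrite /gp act_pp.
have ep_gp x : act ep (gp x) = gp x by rewrite /gp act_pp.
have em_gp x : act em (gp x) = 0 by rewrite /gp act_pm.
have ep_gm x : act ep (gm x) = 0 by rewrite -gm_em act_mp.
have [||| g gE] := @quiver_linear R f M N h.
- move=> x; rewrite !hE linearD /= gp_ep ep_gp ep_gm gm0 //.
  by rewrite act_pv.
- have u_gm y : act u (gm y) = 0 by rewrite -gm_em act_mu.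
  move=> x; rewrite !hE linearD /= u_gm addr0.
  have -> : gp (act u x) = 0 by rewrite /gp act_up !linear0.
  rewrite add0r; apply: uniq; rewrite ?gm_em ?act_um //.
  rewrite gm_v act_uv act_uv ep_gp -gpE linearZ_LR gpE gp_ep //.
- move=> x; rewrite !hE linearD /= gm_v.
  rewrite (gm0 (act v x)) ?act_vv // addr0.
  by rewrite -{1}ep_gp act_pv add0r.
exists g => x; rewrite /base_map gE hE.
by rewrite coker_projD gpC -gm_em proj_em addr0.
Qed.

(** The difference [k] sends the plus part into the image of [v], so it lifts to a map [hh] into
    [N e_-]. Applying the functionals of a dual basis of [N] to [hh] gives the coordinates of a
    factorization through a power of [e_-B]. *)
Lemma i_star_faithful (g h : {linear M -> N}) :
  (forall m, coker_proj (base_map g m) = coker_proj (base_map h m)) ->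
  add_ideal (right_ideal em) (g \- h).
Proof.
move=> gh; pose k := base_map (g \- h : {linear M -> N}).
have kE x : k x = base_map g x - base_map h x by [].
have k_act b x : k (act b x) = act b (k x) by apply: base_map_act.
have kL : linear k by move=> r x y; apply: (linearP (base_map (g \- h : {linear M -> N}))).
have hhP x : exists y, act em y = y /\ act v y = k (act ep x).
  have /coker_proj_eq0[y1 [y2 e]] : coker_proj (k (act ep x)) = 0.
    apply: (addIr (coker_proj (base_map h (act ep x)))).
    by rewrite -coker_projD add0r kE subrK gh.
  exists (act em y2); rewrite act_mm act_mv; split=> //.
  have -> : k (act ep x) = act ep (k (act ep x)) by rewrite -k_act act_pp.
  by rewrite e linearD /= act_mp act_vp add0r.
have uniq (y z : base N) : act em y = y -> act em z = z -> act v y = act v z -> y = z.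
  by move=> ye ze /act_v_eq; rewrite ye ze.
pose hh x := sval (cid (hhP x)).
have hh_em x : act em (hh x) = hh x by case: (svalP (cid (hhP x))).
have hh_v x : act v (hh x) = k (act ep x) by case: (svalP (cid (hhP x))).
have hhL : linear hh.
  move=> r x y; apply: uniq; rewrite ?hh_em //; first by rewrite linearP /= !hh_em.
  by rewrite linearP /= !hh_v linearP /= kL.
have [hl hlE] := linear_ex hhL.
(* Both components of [k] are governed by [hh]: on the minus part, [k] is [hh] after [v], because
   [v] is injective there. *)
have kx x : k x = act v (hh x) + hh (act v x).
  rewrite -{1}(act_p_m x) -[act ep x]scale1r kL scale1r hh_v; congr (_ + _).
  apply: uniq; rewrite ?hh_em //; first by rewrite -k_act act_mm.
  by rewrite hh_v act_vp -k_act act_mv.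
have hh0 x : k (act ep x) = 0 -> hh x = 0.
  by move=> kx0; apply: uniq; rewrite ?hh_em ?linear0 // hh_v kx0.
have [n [y [phi yphi]]] := dual_basis_CM CM_N.
pose L := right_ideal em.
have mem_L (b c : R) : right_idealp em (Defs.Quiver f 0 b 0 c).
  apply/asboolP; exists (Defs.Quiver f 0 b 0 c); rewrite !quiver_mulE.
  by congr Defs.Quiver; ring.
(* The two nonzero coordinates refer to the basis [e_-], [v] of [e_-B]. Right multiplication sends
   [hh (act v x)] along [e_-] and [hh x] along [v], as in the formula for [k]. *)
pose a (x : base M) : base {ffun 'I_n -> L} :=
  [ffun j => Sub (Defs.Quiver f 0 (phi j (hh (act v x))) 0 (phi j (hh x))) (mem_L _ _) : L].
pose b (w : {ffun 'I_n -> L}) : N := \sum_j act (val (w j) : B) (act em (y j)).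
have act_val (c : B) (w : base {ffun 'I_n -> L}) j :
    val ((act c w : {ffun 'I_n -> L}) j) = (val ((w : {ffun 'I_n -> L}) j) : B) * c.
  by rewrite /act ffunE.
have add_val (w w' : {ffun 'I_n -> L}) j :
    val ((w + w') j) = (val (w j) : B) + (val (w' j) : B).
  by rewrite ffunE.
have a_val x j : val ((a x : {ffun 'I_n -> L}) j) =
    Defs.Quiver f 0 (phi j (hh (act v x))) 0 (phi j (hh x)).
  by rewrite ffunE SubK.
have hh_p x : hh (act ep x) = hh x by apply: uniq; rewrite ?hh_em // !hh_v act_pp.
have hh_u x : hh (act u x) = 0 
  by apply: hh0; rewrite act_up; apply: (linear0 (base_map (g \- h : {linear M -> N}))).
have aL : linear a.
  move=> r x x'; apply/ffunP=> j; apply: val_inj.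
  rewrite (add_val _ (a x')) (base_scaleE r (a x)) act_val !a_val.
  rewrite (linearP (@act R f M v)) /= !hhL !(linearP (phi j)) /= quiver_mulE quiver_addE.
  by congr Defs.Quiver; rewrite /GRing.scale /=; ring.
have [a' a'E] := linear_ex aL.
have hh0' : hh 0 = 0 by have := linear0 hl; rewrite hlE.
have [||| ag agE] := @quiver_linear R f M ({ffun 'I_n -> L} : lmodType B^c) a'.
- move=> x; rewrite !a'E; apply/ffunP=> j; apply: val_inj.
  rewrite act_val !a_val hh_p act_pv hh0' linear0 quiver_mulE.
  by congr Defs.Quiver; ring.
- move=> x; rewrite !a'E; apply/ffunP=> j; apply: val_inj.
  rewrite act_val !a_val hh_u act_uv linear0 -(hlE (f *: _)) linearZ_LR /= hlE hh_p.
  rewrite linearZ_LR quiver_mulE /=.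
  by congr Defs.Quiver; rewrite /GRing.scale /=; ring.
- move=> x; rewrite !a'E; apply/ffunP=> j; apply: val_inj.
  rewrite act_val !a_val act_vv hh0' linear0 quiver_mulE.
  by congr Defs.Quiver; ring.
have bL : linear b.
  move=> c w w'; rewrite /b scaler_sumr -big_split; apply: eq_bigr => j _.
  rewrite add_val actDl; congr (_ + _).
  have -> : val ((c *: w) j) = (val (w j) : B) * (c : B) by apply: (act_val c w j).
  exact: (esym (actM _ _ _)).
have [bg bgE] := linear_ex bL.
exists {ffun 'I_n -> L}, n, ag, bg; split; last first.
  move=> x; rewrite bgE /b; apply: etrans (kx x) _.
  have -> : act v (hh x) + hh (act v x) =
      act v (\sum_j (phi j (hh x) : R) *: y j) +
      act em (\sum_j (phi j (hh (act v x)) : R) *: y j).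
    by rewrite -!yphi hh_em.
  rewrite !linear_sum -big_split; apply: eq_bigr => j _ /=.
  rewrite agE a'E a_val (actE 0 _ 0 _ (act em (y j))) act_mm act_mv !linearZ_LR /=.
  by module_over R.
exists {ffun 'I_0 -> L}, fst; exists (fun w => (w, 0)) => [[w z]|w] //=.
by congr (_, _); apply/ffunP=> -[].
Qed.

End TwoModules.

Definition minus_gen (K : lmodType B^c) (x : K) : Prop :=
  exists (b : B) (y : K), x = (b : B^c) *: ((em : B^c) *: y).

Lemma minus_gen_map (K K' : lmodType B^c) (t : {linear K -> K'}) x :
  zspan (@minus_gen K) x -> zspan (@minus_gen K') (t x).
Proof.
apply: zspan_morph => _ [c [y ->]]; apply: zspan_gen; exists c, (t y).
apply: (etrans (linearZ_LR t (c : B^c) _)); congr (_ *: _); exact: (linearZ_LR t).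
Qed.

(** Each coordinate is [e_-] times itself, so the power is generated by copies of [e_-], on which
    [e_-] acts as the identity. *)
Lemma minus_gen_power n (w : {ffun 'I_n -> right_ideal em}) :
  zspan (@minus_gen {ffun 'I_n -> right_ideal em}) w.
Proof.
have em_L : right_idealp em em by apply/asboolP; exists 1; rewrite mulr1.
pose e0 : right_ideal em := Sub (em : (B^c)^o) em_L.
have -> : w = \sum_i ((val (w i) : B) : B^c) *: ((em : B^c) *:
    [ffun j => if j == i then e0 else 0]).
  apply/ffunP=> j; rewrite sum_ffunE (bigD1 j) //= big1 => [|i /negPf ij].
    rewrite addr0 !ffunE eqxx; apply: val_inj.
    have /asboolP[b bE] := valP (w j).
    have -> : val ((val (w j) : B^c) *: ((em : B^c) *: e0)) = em * em * (val (w j) : B) :> B.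
      by [].
    rewrite bE; apply: esym.
    have ee : em * em = em by rewrite quiver_mulE; congr Defs.Quiver; ring.
    by rewrite ee mulrA ee.
  by rewrite !ffunE eq_sym ij !scaler0.
apply: big_ind => [|x y|i _]; first exact: zspan0.
  move=> zx zy; rewrite -[y]opprK; apply: zspanB => //.
  by rewrite -sub0r; apply: zspanB => //; apply: zspan0.
by apply: zspan_gen; do 2 eexists.
Qed.

Lemma minus_gen_coker (K : lmodType B^c) (x : base K) :
  zspan (@minus_gen K) x -> coker_proj x = 0.
Proof.
move=> zx; apply/coker_proj_eq0; elim: zx => {x} [|_ [b [y ->]]|x y _ IHx _ IHy].
- by exists 0, 0; rewrite !linear0 addr0.
- exact: (minus_part_em b (y : base K)).
- exact: (minus_partB IHx IHy).
Qed.

(* [e_-B] is generated by [e_-], which [i^*] kills. *)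
Lemma i_star_ideal_eq (M N : lmodType B^c) (g h : {linear M -> N}) (m : base M) :
  add_ideal (right_ideal em) (g \- h) ->
  coker_proj (base_map g m) = coker_proj (base_map h m).
Proof.
move=> [P [n [a [b [[Q [i [j ij ji]]] gE]]]]].
have jL : linear j.
  by move=> c x y; apply: (can_inj ij); rewrite ji linearP /= !ji.
have [j' j'E] := linear_ex jL.
have zP w : zspan (@minus_gen P) w.
  have -> : w = (fst \o j') (i (w, 0)) by rewrite /= j'E ij.
  exact/minus_gen_map/minus_gen_power.
have -> : base_map g m = (b (a m) : base N) + base_map h m by rewrite -gE subrK.
by rewrite coker_projD (minus_gen_coker (minus_gen_map b (zP (a m)))) add0r.
Qed.
End CMQuiver.

(** * Modules built from matrix factorizations *)

Section MatrixFactorization.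
Variables (R : comNzRingType) (f : R) (V V' : lmodType R).
Variables (up : {linear V -> V'}) (down : {linear V' -> V}).
Hypotheses (down_up : forall q, down (up q) = f *: q).
Hypothesis (up_down : forall l, up (down l) = f *: l).
Local Notation B := (quiver_alg f).

(* The right [B]-module with [M e_+ = V] and [M e_- = V'], on which [u] and [v]
   act as [up] and [down]. *)
Definition mf_mod of (forall q, down (up q) = f *: q) & (forall l, up (down l) = f *: l) :
  Type := (V * V')%type.
Local Notation mf := (mf_mod down_up up_down).
HB.instance Definition _ := GRing.Zmodule.on mf.

Definition mf_scale (b : B^c) (x : mf) : mf :=
  let: Quiver b1 b2 b3 b4 := (b : B) in
  (b1 *: x.1 + b4 *: down x.2, b2 *: x.2 + b3 *: up x.1).

Let up_lin a b q l : up (a *: q + b *: down l) = a *: up q + b *: (f *: l).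
Proof. by rewrite linearP linearZ_LR /= up_down. Qed.
Let down_lin a b q l : down (a *: l + b *: up q) = a *: down l + b *: (f *: q).
Proof. by rewrite linearP linearZ_LR /= down_up. Qed.

Lemma mf_scaleA a b x : mf_scale a (mf_scale b x) = mf_scale (a * b) x.
Proof.
case: x a b => q l [a1 a2 a3 a4] [b1 b2 b3 b4].
rewrite /mf_scale /= up_lin down_lin; congr (_, _); module_over R.
Qed.
Lemma mf_scale1 : left_id 1 mf_scale.
Proof. by move=> [q l]; rewrite /mf_scale /= !scale1r !scale0r !addr0. Qed.
Lemma mf_scaleDr : right_distributive mf_scale +%R.
Proof.
move=> [a1 a2 a3 a4] [q l] [q' l'].
have -> : ((q, l) : mf) + (q', l') = (q + q', l + l') by [].
rewrite /mf_scale /= !linearD /= [RHS]pairDE; congr (_, _); module_over R.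
Qed.
Lemma mf_scaleDl x : {morph mf_scale^~ x : a b / a + b}.
Proof.
move=> [a1 a2 a3 a4] [b1 b2 b3 b4]; case: x => q l; rewrite /mf_scale /=.
rewrite [RHS]pairDE; congr (_, _); module_over R.
Qed.
HB.instance Definition _ := GRing.Zmodule_isLmodule.Build B^c mf
  mf_scaleA mf_scale1 mf_scaleDr mf_scaleDl.

Local Notation base := (restr (quiver_base f) (mf : lmodType B^c) : lmodType R).

Lemma mf_act (b : B) (x : base) : act b x = mf_scale b x.
Proof. by []. Qed.

Definition mf_pair (x : (V * V')%type) : base := x.
Lemma mf_pair_is_linear : linear mf_pair.
Proof.
move=> r [q l] x; congr (_ + _); rewrite base_scaleE mf_act /mf_scale /=.
by rewrite !scale0r !addr0.
Qed.
HB.instance Definition _ := GRing.isLinear.Build R (V * V')%type base _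
  mf_pair mf_pair_is_linear.

Lemma mf_dual_basis : dual_basis V -> dual_basis V' -> dual_basis base.
Proof.
move=> dV dV'; have [n [y [phi yphi]]] := dual_basis_prod dV dV'.
have phiL i : linear (fun x : base => phi i (x : (V * V')%type) : R^o).
  move=> r x x'; apply: etrans _ (linearP (phi i) r x x'); congr (phi i _).
  exact: esym (mf_pair_is_linear r x x').
exists n, (fun i => mf_pair (y i)), (fun i => sval (cid (linear_ex (phiL i)))) => x.
rewrite [LHS](congr1 mf_pair (yphi x)) linear_sum; apply: eq_bigr => i _.
by rewrite (svalP (cid (linear_ex (phiL i)))) linearZ_LR.
Qed.

Lemma mf_CM : dual_basis V -> dual_basis V' -> is_CM_quiver (mf : lmodType B^c).
Proof.
move=> dV dV'; have db := mf_dual_basis dV dV'.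
by split; [apply: dual_basis_fin_gen | apply: dual_basis_projective].
Qed.

Lemma mf_coker_eq0 (q : V) (l : V') :
  coker_proj ((q, l) : base) = 0 <-> exists l', down l' = q.
Proof.
rewrite coker_proj_eq0; split=> [[[y1 y2] [[z1 z2]]]|[l' <-]].
  rewrite !mf_act /mf_scale /= => -[-> _]; exists z2.
  by rewrite !scale0r scale1r !add0r.
exists ((0, l) : base), ((0, l') : base); rewrite !mf_act /mf_scale /=.
by rewrite [RHS]pairDE; congr (_, _); module_over R.
Qed.
End MatrixFactorization.

(** Two quotients of [M] with the same kernel. Surjectivity of [rho] lets linearity over [S] be
    checked on scalars from [R]. *)
Lemma surjection_iso (R S : pzRingType) (rho : {rmorphism R -> S}) (M : lmodType R)
    (C D : lmodType S) (g : M -> C) (h : M -> D) :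
  (forall c, exists r, rho r = c) ->
  (forall r x y, g (r *: x + y) = rho r *: g x + g y) ->
  (forall r x y, h (r *: x + y) = rho r *: h x + h y) ->
  (forall y, exists x, g x = y) -> (forall y, exists x, h x = y) ->
  (forall x, g x = 0 <-> h x = 0) ->
  exists (a : {linear C -> D}) (b : {linear D -> C}),
    (forall y, a (b y) = y) /\ (forall y, b (a y) = y).
Proof.
move=> rho_surj gL hL gS hS gh.
have aux (C' D' : lmodType S) (g' : M -> C') (h' : M -> D') :
    (forall r x y, g' (r *: x + y) = rho r *: g' x + g' y) ->
    (forall r x y, h' (r *: x + y) = rho r *: h' x + h' y) ->
    (forall y, exists x, g' x = y) -> (forall x, g' x = 0 -> h' x = 0) ->
    exists a : {linear C' -> D'}, forall x, a (g' x) = h' x.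
  move=> g'L h'L g'S g'h'; pose a y := h' (sval (cid (g'S y))).
  have aE x : a (g' x) = h' x.
    rewrite /a; case: cid => z /= zx; apply/subr0_eq.
    have h'B s t : h' s - h' t = h' (- 1 *: t + s).
      by rewrite h'L rmorphN1 scaleN1r addrC.
    rewrite h'B; apply: g'h'; rewrite g'L rmorphN1 scaleN1r zx addNr //.
  have aL : linear a.
    move=> c y y'; have [r <-] := rho_surj c; have [x <-] := g'S y.
    by have [x' <-] := g'S y'; rewrite -g'L !aE h'L.
  by have [a' a'E] := linear_ex aL; exists a' => x; rewrite a'E aE.
have [a aE] := aux C D g h gL hL gS (fun x => (gh x).1).
have [b bE] := aux D C h g hL gL hS (fun x => (gh x).2).
exists a, b; split=> y.
  by have [x <-] := hS y; rewrite bE aE.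
by have [x <-] := gS y; rewrite aE bE.
Qed.

(** Injective because the [e_+] coefficient of an element of Be_-B is a multiple of [f]; surjective
    because [e_-], [u] and [v] lie in Be_-B. *)
Lemma quot_map_bijective (R : comNzRingType) (f : R) : bijective (quot_map (f := f)).
Proof.
pose em := e_minus f.
have inj : injective (quot_map (f := f)).
  elim/qproj_ind=> r; elim/qproj_ind=> s; rewrite !quot_mapE => /zprojP.
  rewrite -quiver_base_is_zmod_morphism => rs; apply/zprojP.
  have -> : r - s = coef_ep (quiver_base f (r - s) : quiver_alg f).
    by rewrite /quiver_base quiver_1E quiver_scaleE /= mulr1.
  elim: rs => {r s} [|_ [b [c ->]]|[? ? ? ?] [? ? ? ?] _ IHb _ IHc].
  - exact: zspan0.
  - case: b c => b1 b2 b3 b4 [c1 c2 c3 c4]; rewrite !quiver_mulE /=.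
    by apply: zspan_gen; exists b3, c4; ring.
  - exact: zspanB IHb IHc.
have surj c : exists q, quot_map (f := f) q = c.
  elim/qproj_ind: c => -[b1 b2 b3 b4]; exists (qproj f b1); rewrite quot_mapE.
  apply/zprojP; rewrite /quiver_base quiver_1E quiver_scaleE.
  (* The terms in [e_-] and [v] begin with [e_-], the term in [u] ends with [e_-]. *)
  have -> : Quiver f (b1 * 1) (b1 * 1) (b1 * 0) (b1 * 0) - Quiver f b1 b2 b3 b4 =
      1 * em * Quiver f 0 (b1 - b2) 0 (- b4) - Quiver f 0 0 b3 0 * em * 1.
    rewrite quiver_1E !quiver_mulE [LHS]/GRing.add [RHS]/GRing.add /=.
    by congr Quiver; ring.
  by apply: zspanB; apply: zspan_gen; do 2 eexists.
exists (fun c => sval (cid (surj c))) => [q|c].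
  by apply: inj; rewrite (svalP (cid (surj _))).
exact: svalP (cid (surj c)).
Qed.

Section EssentialSurjectivity.
Variables (R : idomainType) (f : R) (regR : regular_ring R) (f_neq0 : f != 0).
Local Notation S := (quot_ring f).
Local Notation rho := (qproj f : {rmorphism R -> S}).

(** The matrix factorization is a presentation of [N] by a free module with projective kernel:
    [down] is the inclusion of the kernel, and [up] is multiplication by [f], which lands in the
    kernel because [f] kills [N]. *)
Lemma i_star_ess_surj (N : lmodType S) : max_cohen_macaulay N ->
  exists X : lmodType (quiver_alg f)^c, is_CM_quiver X /\
  exists (a : {linear coker_v X -> N}) (b : {linear N -> coker_v X}),
    (forall y, a (b y) = y) /\ (forall y, b (a y) = y).
Proof.
move=> mcmN; have [[n [g gN]] _] := mcmN.
pose N' : lmodType R := restr rho N.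
pose p0 : {linear {ffun 'I_n -> R^o} -> N'} := lincomb (g : 'I_n -> N').
have p0E c : p0 c = \sum_i rho (c i) *: g i :> N by [].
have p0_surj y : exists c, p0 c = y.
  have [c ->] := gN y; exists [ffun i => sval (cid (qproj_surj (c i)))].
  rewrite p0E; apply: eq_bigr => i _; rewrite ffunE.
  by rewrite (svalP (cid (qproj_surj (c i)))).
have dbK := ker_dual_basis regR f_neq0 p0_surj mcmN.
have p0f q : p0 (f *: q) = 0.
  apply: etrans (linearZ_LR p0 f q) _.
  have -> : f *: p0 q = rho f *: (p0 q : N) :> N by [].
  by rewrite qproj_f scale0r.
have upP q : exists l : ker_mod p0, ker_val l = f *: q by apply: ker_mod_of.
have [up0 up0E] : exists up0, forall q, ker_val (up0 q : ker_mod p0) = f *: q.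
  by exists (fun q => sval (cid (upP q))) => q; apply: svalP (cid (upP q)).
have upL : linear up0.
  move=> r q q'; apply: ker_val_inj; rewrite (linearP (@ker_val _ _ _ p0)) /=.
  by rewrite !up0E; module_over R.
have [up upE] := linear_ex upL.
have down_up q : ker_val (up q) = f *: q by rewrite upE up0E.
have up_down (l : ker_mod p0) : up (ker_val l) = f *: l.
  by apply: ker_val_inj; rewrite down_up linearZ_LR.
pose down : {linear ker_mod p0 -> {ffun 'I_n -> R^o}} := @ker_val _ _ _ p0.
pose X : lmodType (quiver_alg f)^c := mf_mod (up := up) (down := down) down_up up_down.
have CM_X : is_CM_quiver X by apply: mf_CM => //; apply: dual_basis_free.
exists X; split=> //.
pose h (x : restr (quiver_base f) X) : N := p0 (x : ({ffun 'I_n -> R^o} * ker_mod p0)%type).1.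
apply: (surjection_iso (rho := rho) (M := restr (quiver_base f) X)
  (g := @coker_proj R f X) (h := h)).
- exact: qproj_surj.
- by move=> r x y; rewrite coker_projD coker_projZ.
- move=> r [q l] [q' l']; rewrite base_scaleE mf_act /h.
  have -> : (mf_scale (up := up) (down := down) (down_up := down_up) (up_down := up_down)
      (Quiver f r r 0 0) (q, l) + (q', l')).1 = r *: q + 0 *: ker_val l + q' by [].
  rewrite scale0r addr0; exact: (linearP p0 r q q').
- exact: coker_proj_surj.
- move=> y; have [c <-] := p0_surj y; by exists (c, 0).
- move=> [q l]; rewrite mf_coker_eq0 /h /=; split=> [[l' <-]|].
    exact: (ker_valP (g := p0) l').
  by move=> pq; have [l' <-] := ker_mod_of (g := p0) pq; exists l'.
Qed.
End EssentialSurjectivity.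

(** The bijection identifies B/Be_-B with R/(f). The existential quantifiers carry the two proofs
    from which the induced functor is built. *)
Theorem theoremC (R : idomainType) (f : R) (regR : regular_ring R) (f_neq0 : f != 0) :
  bijective (quot_map (f := f)) /\
  exists (i_star_CM : forall M : modcat (quiver_alg f)^c,
            is_CM_quiver M -> is_mcm (i_star_quot f M))
         (i_star_ideal : forall (M N : CM_quiver f) (g h : mor M N),
            crel (e_minus_congruence f) g h ->
            heq (fmap (i_star_quot f) g) (fmap (i_star_quot f) h)),
    is_equivalence (induced_functor i_star_CM i_star_ideal).
Proof.
split; first exact: quot_map_bijective.
have i_star_CM : forall M : modcat (quiver_alg f)^c,
    is_CM_quiver M -> is_mcm (i_star_quot f M).
  by move=> M CM_M; apply: (i_star_mcm f_neq0 CM_M regR).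
have i_star_ideal : forall (M N : CM_quiver f) (g h : mor M N),
    crel (e_minus_congruence f) g h ->
    heq (fmap (i_star_quot f) g) (fmap (i_star_quot f) h).
  move=> [M CM_M] [N CM_N] g h gh y; have [m <-] := coker_proj_surj y.
  apply: etrans (i_star_proj g m) _; apply: etrans _ (esym (i_star_proj h m)).
  exact: i_star_ideal_eq gh.
exists i_star_CM, i_star_ideal; apply: equivalence_of_full_faithful.
- move=> [M CM_M] [N CM_N] g0; have [g gE] := i_star_full f_neq0 CM_M CM_N g0.
  exists g => y; have [m <-] := coker_proj_surj y.
  exact: etrans (i_star_proj g m) (gE m).
- move=> [M CM_M] [N CM_N] g h gh; apply: (i_star_faithful f_neq0 CM_N) => m.
  apply: etrans (esym (i_star_proj g m)) _; apply: etrans _ (i_star_proj h m).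
  exact: gh.
- move=> [N mcmN]; have [X [CM_X [a [b [ab ba]]]]] := i_star_ess_surj regR f_neq0 mcmN.
  by exists (exist _ X CM_X), a, b; split=> y /=; [apply: ab | apply: ba].
Qed.
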